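(* Given $\rho_0$ with $0<\rho_0<1$, there exists a number $T_0=T_0(\rho_0,\lambda_1)$ with the following property. Let $\varphi\in H$ and $t_0\ge T_0$ (with $t_0\le T$). Then the inverse problem with observed value $d_0$ has a unique solution $\{u(t),\rho\}$ if and only if $$W(t_0,1)\le d_0\le W(t_0,\rho_0).$$ Here the inverse problem is to find a pair $\{u(t),\rho\}$ consisting of a parameter $\rho\in[\rho_0,1]$ and the solution $u(t)$ of the forward problem of order $\rho$ with datum $\varphi$ on $(0,T]$ such that the additional condition $W(t_0,\rho)=\|u(t_0)\|^2=d_0$ is satisfied.
   Context: $H$ is a separable Hilbert space with scalar product $(\cdot,\cdot)$ and norm $\|\cdot\|$, and $A:H\to H$ is an arbitrary positive self-adjoint operator in $H$ having a complete system of orthonormal eigenfunctions $\{v_k\}$ in $H$ and a countable set of eigenvalues $\lambda_k$, $Av_k=\lambda_kv_k$, with $0<\lambda_1\le\lambda_2\le\cdots$. Integrals and derivatives of $H$-valued functions are understood in the strong sense. For $\sigma<0$, the fractional integral of order $\sigma$ of a function $h$ defined on $[0,\infty)$ is $$\partial_t^{\sigma}h(t)=\frac{1}{\Gamma(-\sigma)}\int_0^t\frac{h(\xi)}{(t-\xi)^{\sigma+1}}\,d\xi,\quad t>0,$$ provided the right-hand side exists, where $\Gamma$ is Euler's gamma function. For $0<\rho<1$ the Riemann-Liouville fractional derivative of order $\rho$ is $\partial_t^\rho h(t)=\frac{d}{dt}\partial_t^{\rho-1}h(t)$; for $\rho=1$ it is the ordinary derivative $\partial_th=\frac{d}{dt}h$.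 The forward problem of order $\rho$ with datum $\varphi\in H$ on $(0,T]$ is $$\partial_t^\rho u(t)+Au(t)=0,\quad 0<t\le T;\qquad \lim_{t\to0}\partial_t^{\rho-1}u(t)=\varphi,$$ where for $\rho=1$ the initial condition has the form $u(0)=\varphi$. A solution is a function $u(t)$ with $\partial_t^\rho u(t),\,Au(t)\in C((0,T];H)$ (continuous functions on $(0,T]$ with values in $H$) satisfying the equation and the initial condition. The solution is unique and has the form $$u(t)=\sum_{k=1}^\infty t^{\rho-1}E_{\rho,\rho}(-\lambda_kt^\rho)(\varphi,v_k)v_k,\qquad E_{\rho,\mu}(t)=\sum_{k=0}^\infty\frac{t^k}{\Gamma(\rho k+\mu)}.$$ $W(t_0,\rho)=\|u(t_0)\|^2$, where $u$ is the solution of the forward problem of order $\rho$ with datum $\varphi$. The number $T_0$ is one for which, for all $t_0\ge T_0$ and arbitrary $\varphi\in H$, the function $W(t_0,\rho)$ decreases monotonically with respect to $\rho\in[\rho_0,1]$.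
   Formalization: The datum φ is assumed nonzero: for φ = 0 the solution is u = 0 for every ρ, so W ≡ 0, and with d_0 = 0 the inequality holds while every ρ in [ρ_0,1] gives a solution, so uniqueness fails. *)

(* Defs.v *)
From HB Require Import structures.
From mathcomp Require Import all_boot all_order all_algebra.
From mathcomp Require Import sesquilinear complex.
From mathcomp Require Import all_classical all_reals all_analysis.

Set Implicit Arguments.
Unset Strict Implicit.
Unset Printing Implicit Defensive.

Import Order.TTheory GRing.Theory Num.Theory.
Import numFieldNormedType.Exports.

Local Open Scope classical_set_scope.
Local Open Scope ring_scope.

(* The Hilbert space may be real or complex; in both cases the norm of the
   library takes its values in the field of scalars. *)
Variant scalar_kind := RealScalars | ComplexScalars.

Definition scalars (R : realType) (s : scalar_kind) : numFieldType :=
  match s with RealScalars => R | ComplexScalars => R[i] end.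

Definition of_real (R : realType) (s : scalar_kind) : R -> scalars R s :=
  match s with
  | RealScalars => fun x => x
  | ComplexScalars => fun x => real_complex R x
  end.

Definition real_part (R : realType) (s : scalar_kind) : scalars R s -> R :=
  match s with
  | RealScalars => fun z => z
  | ComplexScalars => fun z => complex.Re z
  end.

Definition conjugate (R : realType) (s : scalar_kind) :
    scalars R s -> scalars R s :=
  match s with
  | RealScalars => fun z => z
  | ComplexScalars => fun z => conjc z
  end.

Definition rnorm (R : realType) (s : scalar_kind)
    (H : normedModType (scalars R s)) (x : H) : R := real_part `|x|.

Definition rscale (R : realType) (s : scalar_kind)
    (H : normedModType (scalars R s)) (a : R) (x : H) : H := of_real s a *: x.

(* Together with completeness of [H], this makes [H] a Hilbert space. *)
Definition scalar_product_of_norm (R : realType) (s : scalar_kind)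
    (H : normedModType (scalars R s))
    (dot : {dot H for @conjugate R s}) : Prop :=
  forall x : H, dot x x = `|x| ^+ 2.

Definition separable (T : topologicalType) : Prop :=
  exists2 S : set T, countable S & dense S.

(* An operator in [H] is given by its domain [D] and a function [A] whose
   values outside [D] are irrelevant. The field [sa_adjoint] says that the
   graph of the adjoint of [A] is the graph of [A]. *)
Record selfadjoint (R : realType) (s : scalar_kind)
    (H : normedModType (scalars R s)) (dot : {dot H for @conjugate R s})
    (D : set H) (A : H -> H) : Prop := Selfadjoint {
  sa_dom0 : D 0;
  sa_domP : forall (a : scalars R s) (x y : H), D x -> D y -> D (a *: x + y);
  sa_linear : forall (a : scalars R s) (x y : H), D x -> D y ->
    A (a *: x + y) = a *: A x + A y;
  sa_dense : dense D;
  sa_adjoint : forall y z : H,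
    (forall x, D x -> dot (A x) y = dot x z) <-> (D y /\ z = A y)
}.

Definition positive_operator (R : realType) (s : scalar_kind)
    (H : normedModType (scalars R s)) (dot : {dot H for @conjugate R s})
    (D : set H) (A : H -> H) : Prop :=
  forall x : H, D x -> x != 0 -> 0 < dot (A x) x.

(* The sequences are indexed from 0, so that [lam 0] is the smallest
   eigenvalue; completeness of [v] means that its linear span is dense. *)
Record eigensystem (R : realType) (s : scalar_kind)
    (H : normedModType (scalars R s)) (dot : {dot H for @conjugate R s})
    (D : set H) (A : H -> H) (v : nat -> H) (lam : nat -> R) : Prop :=
  Eigensystem {
  es_orthonormal : forall j k : nat, dot (v j) (v k) = (j == k)%:R;
  es_complete : dense
    [set x : H | exists (n : nat) (c : nat -> scalars R s),
                   x = \sum_(k < n) c k *: v k];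
  es_dom : forall k : nat, D (v k);
  es_eigen : forall k : nat, A (v k) = rscale (lam k) (v k);
  es_pos : 0 < lam 0%N;
  es_nondecreasing : forall j k : nat, (j <= k)%N -> lam j <= lam k
}.

(* A list [(E_1, x_1); ...; (E_n, x_n)] stands for the simple function
   \1_(E_1) x_1 + ... + \1_(E_n) x_n. *)
Definition simple_eval (R : realType) (s : scalar_kind)
    (H : normedModType (scalars R s)) (f : seq (set R * H)) (t : R) : H :=
  \sum_(p <- f) rscale (\1_(p.1) t) p.2.

Definition simple_integral (R : realType) (s : scalar_kind)
    (H : normedModType (scalars R s)) (f : seq (set R * H)) : H :=
  \sum_(p <- f) rscale (fine (@lebesgue_measure R p.1)) p.2.

(* [y] is the Bochner (strong) integral of [f] over [D]. *)
Definition is_bochner_integral (R : realType) (s : scalar_kind)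
    (H : normedModType (scalars R s)) (D : set R) (f : R -> H) (y : H)
    : Prop :=
  exists g : nat -> seq (set R * H),
    [/\ forall n (p : set R * H), p \in g n ->
          [/\ measurable p.1, p.1 `<=` D & (@lebesgue_measure R p.1 < +oo)%E],
        forall n, measurable_fun D (fun t => rnorm (f t - simple_eval (g n) t)),
        (\int[@lebesgue_measure R]_(t in D)
           (rnorm (f t - simple_eval (g n) t))%:E)%E @[n --> \oo] --> 0%E
      & simple_integral (g n) @[n --> \oo] --> y].

Definition Gamma (R : realType) (z : R) : R :=
  \int[@lebesgue_measure R]_(x in `]0, +oo[) (x `^ (z - 1) * expR (- x)).

(* For [sigma < 0]: the fractional integral of order [sigma] of [h] at [t]
   exists and equals [y]. *)
Definition is_fractional_integral (R : realType) (s : scalar_kind)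
    (H : normedModType (scalars R s)) (sigma : R) (h : R -> H) (t : R) (y : H)
    : Prop :=
  exists2 z : H,
    is_bochner_integral `]0, t[
      (fun xi => rscale (((t - xi) `^ (sigma + 1))^-1) (h xi)) z
    & y = rscale ((Gamma (- sigma))^-1) z.

(* [g] is the derivative of [f] on ]0, T], one-sided at [T]. *)
Definition is_derivative_on (R : realType) (s : scalar_kind)
    (H : normedModType (scalars R s)) (T : R) (f g : R -> H) : Prop :=
  forall t, 0 < t <= T ->
    rscale ((r - t)^-1) (f r - f t) @[r --> within `]0, T] t^'] --> g t.

(* [J] is the function [d_t^(rho - 1) h] on ]0, T], which is [h] itself when
   [rho = 1]. *)
Definition is_lowered (R : realType) (s : scalar_kind)
    (H : normedModType (scalars R s)) (T rho : R) (h J : R -> H) : Prop :=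
  forall t, 0 < t <= T ->
    if rho == 1 then J t = h t
    else is_fractional_integral (rho - 1) h t (J t).

(* The Riemann-Liouville derivative of order [rho], 0 < rho <= 1. *)
Definition is_RL_derivative (R : realType) (s : scalar_kind)
    (H : normedModType (scalars R s)) (T rho : R) (h g : R -> H) : Prop :=
  exists2 J : R -> H, is_lowered T rho h J & is_derivative_on T J g.

(* For [rho = 1] the condition [u 0 = phi] is understood for a function that
   is continuous at 0: without continuity it would not constrain [u] on
   ]0, T]. For [rho < 1] the value [u 0] is irrelevant. *)
Definition initial_condition (R : realType) (s : scalar_kind)
    (H : normedModType (scalars R s)) (T rho : R) (phi : H) (u : R -> H)
    : Prop :=
  (exists2 J : R -> H, is_lowered T rho u J & J t @[t --> 0^'+] --> phi) /\
  (rho = 1 -> u 0 = phi).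

Definition forward_solution (R : realType) (s : scalar_kind)
    (H : normedModType (scalars R s)) (D : set H) (A : H -> H)
    (T rho : R) (phi : H) (u : R -> H) : Prop :=
  (exists2 g : R -> H, is_RL_derivative T rho u g &
    [/\ {within `]0, T], continuous g},
        forall t, 0 < t <= T -> D (u t),
        {within `]0, T], continuous (fun t => A (u t))}
      & forall t, 0 < t <= T -> g t + A (u t) = 0]) /\
  initial_condition T rho phi u.

(* The solution is unique on ]0, T], so that for 0 < t0 <= T the value does
   not depend on the one selected by [get]. *)
Definition W (R : realType) (s : scalar_kind)
    (H : normedModType (scalars R s)) (D : set H) (A : H -> H)
    (T : R) (phi : H) (t0 rho : R) : R :=
  rnorm (get [set u : R -> H | forward_solution D A T rho phi u] t0) ^+ 2.

Definition inverse_solution (R : realType) (s : scalar_kind)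
    (H : normedModType (scalars R s)) (D : set H) (A : H -> H)
    (T rho0 : R) (phi : H) (t0 d0 : R) (u : R -> H) (rho : R) : Prop :=
  [/\ rho0 <= rho <= 1, forward_solution D A T rho phi u
    & rnorm (u t0) ^+ 2 = d0].

(* Functions of time are compared on ]0, T] only. *)
Definition inverse_uniquely_solvable (R : realType) (s : scalar_kind)
    (H : normedModType (scalars R s)) (D : set H) (A : H -> H)
    (T rho0 : R) (phi : H) (t0 d0 : R) : Prop :=
  exists (u : R -> H) (rho : R),
    inverse_solution D A T rho0 phi t0 d0 u rho /\
    forall (u' : R -> H) (rho' : R),
      inverse_solution D A T rho0 phi t0 d0 u' rho' ->
      rho' = rho /\ (forall t, 0 < t <= T -> u' t = u t).

(* Main.v *)
(* On the eigenvector [v k] the solution of order [rho] is the scalar function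
   [mlf rho (lam k) t = t^(rho-1) E_(rho,rho)(- lam_k t^rho)] times the
   coefficient of [phi], so [W] is the sum of the [mlf^2 |(phi, v k)|^2].
   The function [mlf] is taken as the Bromwich integral of [1 / (z^rho + lam)]
   along the rays of angle [+-3pi/4]. Rotating rays gives its Laplace transform,
   and Lerch's theorem then identifies its fractional integral. A maximum
   principle for the fractional derivative bounds that integral and gives
   uniqueness for each component, hence for the forward problem.

   Expanding [1 / (z^rho + lam)] to second order in [1 / lam] gives
   [pi mlf = lam^-2 t^(-rho-1) sin (pi rho) Gamma (rho + 1) + ...] for large [t].
   The differences of [mlf] in [rho] are estimated directly, with a remainder
   that carries the factor [q - p]. The factor [t^(-rho)] wins on each compact
   part of [(0, 1)], and [sin] decreases near [rho = 1], so [mlf] is strictly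
   decreasing in [rho] on [[rho0, 1]], uniformly in [lam >= lam1]. Hence [W] is
   strictly decreasing; being continuous, it takes each value between
   [W(t0, 1)] and [W(t0, rho0)] exactly once. *)

Require Import Defs.
From HB Require Import structures.
From mathcomp Require Import all_boot all_order all_algebra.
From mathcomp Require Import sesquilinear complex.
From mathcomp Require Import all_classical all_reals all_analysis.
From mathcomp Require Import measurable_realfun ring lra.

Set Implicit Arguments.
Unset Strict Implicit.
Unset Printing Implicit Defensive.

Import Order.TTheory GRing.Theory Num.Theory.
Import numFieldNormedType.Exports.

Local Open Scope classical_set_scope.
Local Open Scope ring_scope.

(** The leading coefficient [sin (pi rho) Gamma (rho + 1)] vanishes at [rho = 1], so estimating each
    order separately fails there. For two orders [p < q] the main term of the difference is at least
    a constant times [(q - p) lam^-2 t^(-p-1)] and the remainder at most a constant times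
    [(q - p) lam^-3 t^(-2p-1) (1 + ln t)]. Their quotient is controlled by [lam >= lam1] and
    [t^(-rho0) ln t] alone, which gives uniformity in the eigenvalue. The bound on the main term
    holds for gaps up to [1 / ln t]; larger gaps are bridged by a chain of small ones. Comparing
    squares requires [mlf >= 0]. This comes from the monotonicity itself: [mlf] decreases in the
    order down to its value at order 1, which is an exponential. Ray integrals are real integrals in
    the radius, and turning a ray is differentiation in the angle. The angle lies above [pi / 2] for
    the decay of [e^(tz)] and below [pi] to keep [z^rho + lam] away from 0. The maximum principle
    has two uses: with initial value 1 it bounds the coefficients of the fractional integral
    uniformly in [lam], with initial value 0 it gives uniqueness. *)

Notation integ D f := ((@lebesgue_measure _).-integrable D (EFin \o f)).

(** * Integrals over subsets of the real line *)

Section integrals.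
Context {R : realType}.
Notation mu := (@lebesgue_measure R).
Implicit Types (D E : set R) (f g : R -> R).

(** Integration lemmas are stated over [measurableTypeR R]; the two types are convertible, and this
    fixes which one is displayed. *)
Lemma mR (D : set R) : measurable D -> measurable (D : set (measurableTypeR R)).
Proof. by []. Qed.

Lemma integ_measurable D f : integ D f -> measurable_fun D f.
Proof. by move=> /integrableP[/measurable_EFinP]. Qed.

Lemma integ_le D f g : measurable D -> measurable_fun D f -> integ D g ->
  (forall x, D x -> `|f x| <= g x) -> integ D f.
Proof.
move=> mD mf ig fg; apply: le_integrable ig => //; first exact/measurable_EFinP.
by move=> x Dx /=; rewrite lee_fin (le_trans (fg _ Dx))// ler_norm.
Qed.

Lemma integ_ext D f g : measurable D ->
  (forall x, D x -> f x = g x) -> integ D f -> integ D g.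
Proof.
by move=> mD fg; apply: eq_integrable => // x; rewrite inE => Dx /=; rewrite fg.
Qed.

Lemma integD D f g : measurable D -> integ D f -> integ D g ->
  integ D (fun x => f x + g x).
Proof. by move=> mD fi gi; exact: (eq_integrable (mR mD) _ _ _ (integrableD (mR mD) fi gi)). Qed.

Lemma integN D f : measurable D -> integ D f -> integ D (fun x => - f x).
Proof. by move=> mD fi; exact: (eq_integrable (mR mD) _ _ _ (integrableN fi)). Qed.

Lemma integB D f g : measurable D -> integ D f -> integ D g ->
  integ D (fun x => f x - g x).
Proof. by move=> mD fi gi; exact: (eq_integrable (mR mD) _ _ _ (integrableB (mR mD) fi gi)). Qed.

Lemma integZ D f k : measurable D -> integ D f -> integ D (fun x => k * f x).
Proof. by move=> mD fi; exact: (eq_integrable (mR mD) _ _ _ (integrableZl (mR mD) k fi)). Qed.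

Lemma integS D E f : measurable D -> measurable E -> E `<=` D -> integ D f ->
  integ E f.
Proof. by move=> mD mE ED; exact: integrableS. Qed.

Lemma integ_norm D f : measurable D -> integ D f -> integ D (fun x => `|f x|).
Proof. by move=> mD fi; exact: (eq_integrable (mR mD) _ _ _ (integrable_abse fi)). Qed.

Lemma eq_Rint D f g : (forall x, D x -> f x = g x) ->
  \int[mu]_(x in D) f x = \int[mu]_(x in D) g x.
Proof. by move=> fg; apply: eq_Rintegral => x; rewrite inE => /fg. Qed.

Lemma norm_Rint_le D f g : measurable D -> measurable_fun D f -> integ D g ->
  (forall x, D x -> `|f x| <= g x) ->
  `|\int[mu]_(x in D) f x| <= \int[mu]_(x in D) g x.
Proof.
move=> mD mf ig fg; have fi := integ_le mD mf ig fg.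
apply: (le_trans (le_normr_Rintegral (mR mD) fi)).
by apply: le_Rintegral => //; exact: integ_norm.
Qed.

Lemma dominated_cvg_Rint D (f_ : nat -> R -> R) f g : measurable D ->
  (forall n, measurable_fun D (f_ n)) -> integ D g ->
  (forall n x, D x -> `|f_ n x| <= g x) ->
  (forall x, D x -> f_ ^~ x @ \oo --> f x) ->
  integ D f /\ \int[mu]_(x in D) f_ n x @[n --> \oo] --> \int[mu]_(x in D) f x.
Proof.
move=> mD mf_ ig fg cf.
have mf : measurable_fun D f.
  by apply: (measurable_fun_cvg (h := f_)) => //.
have mf' : measurable_fun D (EFin \o f) by exact/measurable_EFinP.
have mf_' n : measurable_fun D (EFin \o f_ n) by exact/measurable_EFinP.
have [||fi _ h] := @dominated_convergence _ _ _ mu D (mR mD) (fun n => EFin \o f_ n) (EFin \o f) (EFin \o g) mf_' mf' _ ig.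
- by apply: aeW => x Dx; apply: cvg_EFin; [exact: nearW|exact: cf].
- by apply: aeW => x n Dx; rewrite /= lee_fin fg.
split => //; apply: fine_cvg.
by rewrite /Rintegral fineK//; exact: integrable_fin_num.
Qed.

Lemma ge0_integ D f : measurable D -> measurable_fun D f ->
  (forall x, D x -> 0 <= f x) ->
  (\int[mu]_(x in D) (f x)%:E < +oo)%E -> integ D f.
Proof.
move=> mD mf f0 fi; apply/integrableP; split; first exact/measurable_EFinP.
rewrite (_ : (\int[mu]_(x in D) _)%E = \int[mu]_(x in D) (f x)%:E)%E//.
by apply: eq_integral => x; rewrite inE => Dx; rewrite gee0_abs// lee_fin f0.
Qed.

(** By uniqueness of Lebesgue measure: the image of [mu] under [x |-> a x + b], multiplied by [a],
    agrees with [mu] on half-open intervals. *)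
Lemma lebesgue_measure_affine (a b : R) D : 0 < a -> measurable D ->
  mu D = (a%:E * mu [set x : R | D (a * x + b)%R])%E.
Proof.
move=> a0.
pose phi : measurableTypeR R -> measurableTypeR R := fun x => a * x + b.
have mphi : measurable_fun setT phi.
  by apply: measurable_funD => //; apply: measurable_funM.
pose nu := pushforward mu phi.
have a0' : 0 <= a by exact: ltW.
pose nu' := mscale (NngNum a0') nu.
move=> mD; rewrite (@lebesgue_measure_unique _ (nu' mphi))// => _ [[x y]] _ <-.
rewrite -[RHS]/(a%:E * mu (phi @^-1` `]x, y]%classic))%E.
rewrite (_ : phi @^-1` _ = `](x - b) / a, (y - b) / a]%classic); last first.
  apply/seteqP; split => z; rewrite /= !in_itv/= /phi ltr_pdivrMr// ler_pdivlMr//.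
    by move=> /andP[? ?]; apply/andP; split; lra.
  by move=> /andP[? ?]; apply/andP; split; lra.
rewrite !lebesgue_measure_itv/= !lte_fin ltr_pM2r ?invr_gt0// ltrD2r.
case: ifPn => _; last by rewrite mule0.
by rewrite -!EFinD -EFinM; congr EFin; field; rewrite gt_eqF.
Qed.

Lemma ge0_integral_affine (a b : R) D (f : R -> \bar R) : 0 < a -> measurable D ->
  measurable_fun D f -> (forall x, D x -> (0 <= f x)%E) ->
  (\int[mu]_(x in D) f x =
   a%:E * \int[mu]_(x in [set x : R | D (a * x + b)%R]) f (a * x + b)%R)%E.
Proof.
move=> a0 mD mf f0.
pose phi : measurableTypeR R -> measurableTypeR R := fun x => a * x + b.
have mphi : measurable_fun setT phi.
  by apply: measurable_funD => //; apply: measurable_funM.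
have a0' : 0 <= a by exact: ltW.
pose nu := pushforward mu phi.
pose nu' := mscale (NngNum a0') nu.
rewrite (@eq_measure_integral _ _ _ _ (nu' mphi))//; last first.
  by move=> A mA AD; exact: (lebesgue_measure_affine b a0 mA).
rewrite /nu' ge0_integral_mscale//=; congr (_ * _)%E.
by rewrite ge0_integral_pushforward// => x; rewrite inE => /f0.
Qed.

Lemma measurable_affine_set (a b : R) D : measurable D ->
  measurable [set x : R | D (a * x + b)].
Proof.
move=> mD.
have mphi : measurable_fun [set: R] (fun x : R => a * x + b).
  by apply: measurable_funD => //; apply: measurable_funM.
by have := mphi measurableT _ mD; rewrite setTI.
Qed.

Lemma measurable_affine_comp (a b : R) D f : measurable D -> measurable_fun D f ->
  measurable_fun [set x : R | D (a * x + b)] (fun x => f (a * x + b)).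
Proof.
move=> mD mf; apply: (measurable_comp mD) => //.
  by move=> _ [x /= Dx <-].
by apply: measurable_funD => //; apply: measurable_funM.
Qed.

Lemma integ_affine (a b : R) D f : 0 < a -> measurable D -> integ D f ->
  integ [set x : R | D (a * x + b)] (fun x => f (a * x + b)).
Proof.
move=> a0 mD /integrableP[mf fi]; apply/integrableP; split.
  by apply/measurable_EFinP; apply: measurable_affine_comp => //; exact/measurable_EFinP.
rewrite ltNge leye_eq; apply/eqP => foo.
move: fi; rewrite (@ge0_integral_affine a b)//; last exact: measurableT_comp.
rewrite (_ : (\int[mu]_(x in _) _)%E = +oo%E); last exact: foo.
by rewrite gt0_muley ?lte_fin// ltxx.
Qed.

(** The nonnegative case applied to the positive and negative parts. Scalings reduce time [t] to
    time 1, translations serve the convolutions. *)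
Lemma Rint_affine (a b : R) D f : 0 < a -> measurable D -> integ D f ->
  \int[mu]_(x in D) f x =
  a * \int[mu]_(x in [set x : R | D (a * x + b)]) f (a * x + b).
Proof.
move=> a0 mD fi; have fi' := integ_affine b a0 mD fi.
move: (fi) => /integrableP[mf _].
have a0' : 0 <= a by exact: ltW.
rewrite /Rintegral integralE [in RHS]integralE.
rewrite (ge0_integral_affine b a0 mD); last 2 first.
  by apply: measurable_funepos.
  by [].
rewrite (ge0_integral_affine b a0 mD) => [|//|//]; last first.
  by apply: measurable_funeneg.
have mD' := mR (measurable_affine_set a b mD).
have h1 := integrable_pos_fin_num mD' fi'.
have h2 := integrable_neg_fin_num mD' fi'.
have key (I1 I2 : \bar R) : I1 \is a fin_num -> I2 \is a fin_num ->
    fine (a%:E * I1 - a%:E * I2)%E = a * fine (I1 - I2)%E.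
  by move=> /fineK <- /fineK <- /=; rewrite mulrBr.
transitivity (a * fine
   (\int[mu]_(x in [set x : R | D (a * x + b)%R]) (EFin \o (fun x : R => f (a * x + b)%R))^\+ x -
    \int[mu]_(x in [set x : R | D (a * x + b)%R]) (EFin \o (fun x : R => f (a * x + b)%R))^\- x)%E); last by [].
rewrite -(key _ _ h1 h2); congr (fine (_ * _ - _ * _)%E).
  by apply: eq_integral => x _; rewrite !funeposE.
by apply: eq_integral => x _; rewrite !funenegE.
Qed.

End integrals.

(** * Integrals over the half-line: exhaustion, primitives, power bounds *)

Section half_line.
Context {R : realType}.
Notation mu := (@lebesgue_measure R).
Notation I0 := (`](0 : R), +oo[%classic).
Implicit Types (D E : set R) (f g F : R -> R) (a b c d x y M l : R).

Lemma der_eq f x d d' : is_derive x 1 f d -> d = d' -> is_derive x 1 f d'.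
Proof. by move=> ? <-. Qed.

Lemma der_cst c x : is_derive x 1 (fun _ : R => c) 0.
Proof. exact: is_derive_cst. Qed.

Lemma derD f g x a b : is_derive x 1 f a -> is_derive x 1 g b ->
  is_derive x 1 (fun y => f y + g y) (a + b).
Proof. exact: is_deriveD. Qed.

Lemma derN f x a : is_derive x 1 f a -> is_derive x 1 (fun y => - f y) (- a).
Proof. exact: is_deriveN. Qed.

Lemma derB f g x a b : is_derive x 1 f a -> is_derive x 1 g b ->
  is_derive x 1 (fun y => f y - g y) (a - b).
Proof. exact: is_deriveB. Qed.

Lemma derM f g x a b : is_derive x 1 f a -> is_derive x 1 g b ->
  is_derive x 1 (fun y => f y * g y) (a * g x + f x * b).
Proof.
move=> fa gb; apply: der_eq (is_deriveM fa gb) _.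
by rewrite /GRing.scale/=; ring.
Qed.

Lemma derZ f c x a : is_derive x 1 f a -> is_derive x 1 (fun y => c * f y) (c * a).
Proof. by move=> fa; apply: der_eq (derM (der_cst c x) fa) _; rewrite mul0r add0r. Qed.

Lemma derV f x a : f x != 0 -> is_derive x 1 f a ->
  is_derive x 1 (fun y => (f y)^-1) (- a / f x ^+ 2).
Proof.
move=> f0 fa; apply: der_eq (is_deriveV f0 fa) _.
by rewrite /GRing.scale/=; field.
Qed.

Lemma der_comp f g x a b : is_derive (g x) 1 f a -> is_derive x 1 g b ->
  is_derive x 1 (fun y => f (g y)) (a * b).
Proof.
by move=> fa gb; apply: der_eq (is_derive1_comp fa gb) _; rewrite mulrC.
Qed.

Lemma der_id x : is_derive x 1 (fun y : R => y) 1.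
Proof. exact: is_derive_id. Qed.

Lemma is_derive_continuous f (x d : R) : is_derive x 1 f d -> {for x, continuous f}.
Proof.
by move=> [fd _]; apply: differentiable_continuous; exact/derivable1_diffP.
Qed.

Lemma FTC_cc f (F : R -> R) (a b : R) : a < b ->
  (forall x, a <= x <= b -> is_derive x 1 F (f x)) ->
  (forall x, a <= x <= b -> {for x, continuous f}) ->
  integ `[a, b] f /\ \int[mu]_(x in `[a, b]) f x = F b - F a.
Proof.
move=> ab dF cf.
have cf' : {within `[a, b], continuous f}.
  apply: continuous_in_subspaceT => x; rewrite inE/= in_itv/=.
  exact: cf.
split.
  by apply: continuous_compact_integrable => //; exact: segment_compact.
rewrite /Rintegral (@continuous_FTC2 _ f F)//.
- split => [x| |].
  + rewrite in_itv/= => /andP[ax xb].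
    by have [] := dF x; rewrite ?(ltW ax) ?(ltW xb).
  + apply: cvg_at_right_filter; have : is_derive a 1 F (f a) by apply: dF; rewrite lexx ltW.
    exact: is_derive_continuous.
  + apply: cvg_at_left_filter; have : is_derive b 1 F (f b) by apply: dF; rewrite lexx ltW.
    exact: is_derive_continuous.
- move=> x; rewrite in_itv/= => /andP[ax xb]; rewrite derive1E.
  by have [] := dF x; rewrite ?(ltW ax) ?(ltW xb).
Qed.

(** Compact intervals that exhaust the open half-line; the shift by 2 keeps them nondegenerate from
    [n = 0] on. *)
Definition exh (n : nat) : set R := `[n.+2%:R^-1, n.+2%:R].

Lemma exh_lt n : (n.+2%:R^-1 : R) < n.+2%:R.
Proof.
apply: (@lt_trans _ _ 1); last by rewrite ltr1n.
by rewrite invf_lt1 ?ltr0n// ltr1n.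
Qed.

Lemma exh_near (x : R) : 0 < x -> \forall n \near \oo, exh n x.
Proof.
move=> x0.
have h (y : R) : \forall n \near \oo, y <= n.+2%:R.
  near=> n; apply: (@le_trans _ _ n%:R); last by rewrite ler_nat -addn2 leq_addr.
  by near: n; exact: nbhs_infty_ger.
near=> n; rewrite /exh/= in_itv/=; apply/andP; split.
  rewrite -[leRHS]invrK lef_pV2 ?posrE ?invr_gt0 ?ltr0n//.
  by near: n; exact: h.
by near: n; exact: h.
Unshelve. all: by end_near. Qed.

Lemma exh_subset n : exh n `<=` I0.
Proof.
move=> x; rewrite /exh/= !in_itv/= andbT => /andP[+ _].
by apply: lt_le_trans; rewrite invr_gt0 ltr0n.
Qed.

Lemma exh_measurable n : measurable (exh n).
Proof. exact: measurable_itv. Qed.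

Lemma exh_bigcup : \bigcup_n exh n = I0.
Proof.
apply/seteqP; split => [x [n _]|x]; first exact: exh_subset.
rewrite /= in_itv/= andbT => /exh_near[n _ h].
by exists n => //; apply: h => /=.
Qed.

Lemma cvg_Rint_exh f : integ I0 f ->
  \int[mu]_(x in exh n) f x @[n --> \oo] --> \int[mu]_(x in I0) f x.
Proof.
move=> fi; have mf := integ_measurable fi.
have [] := @dominated_cvg_Rint _ I0 (fun n => f \_ (exh n)) f (fun x => `|f x|).
- exact: measurable_itv.
- move=> n; apply/(measurable_restrict _ _ _).1 => //.
    exact: exh_measurable.
  by apply: measurable_funS mf => //; exact: subIsetl.
- exact: integ_norm.
- by move=> n x _; rewrite patchE; case: ifPn => // _; rewrite normr0.
- move=> x; rewrite /= in_itv/= andbT => x0.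
  apply: cvg_near_cst; near=> n; rewrite patchE mem_set//.
  by near: n; exact: exh_near.
move=> _; apply: cvg_trans; apply: near_eq_cvg; near=> n.
by rewrite -Rintegral_mkcondr setIidr//; exact: exh_subset.
Unshelve. all: by end_near. Qed.

Lemma ge0_integ_exh f (M : R) : measurable_fun I0 f ->
  (forall x, 0 < x -> 0 <= f x) -> (forall n, integ (exh n) f) ->
  (forall n, \int[mu]_(x in exh n) f x <= M) -> integ I0 f.
Proof.
move=> mf f0 fi fM.
have f0' x : I0 x -> 0 <= f x by rewrite /= in_itv/= andbT; exact: f0.
apply: ge0_integ => //.
have h : (\int[mu]_(x in exh n) (f x)%:E @[n --> \oo] --> \int[mu]_(x in I0) (f x)%:E)%E.
  rewrite -exh_bigcup; apply: ge0_nondecreasing_set_cvg_integral.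
  - move=> m n mn; apply/subsetPset => x; rewrite /exh/= !in_itv/= => /andP[h1 h2].
    rewrite (le_trans _ h1) ?(le_trans h2) ?ler_nat//.
    by rewrite lef_pV2 ?posrE ?ltr0n// ler_nat.
  - by move=> n; exact: exh_measurable.
  - by move=> n; apply/measurable_EFinP; apply: measurable_funS mf => //; exact: exh_subset.
  - by move=> n x /exh_subset xI; rewrite lee_fin f0'.
apply: (@le_lt_trans _ _ M%:E); last exact: ltry.
rewrite -(cvg_lim _ h)//; apply: lime_le; first by apply/cvg_ex; eexists; exact: h.
apply: nearW => n; rewrite -(fineK (integrable_fin_num _ (fi n))) ?lee_fin//; first exact: fM.
exact: exh_measurable.
Qed.

Lemma continuous_measurable_0y f : (forall x, 0 < x -> {for x, continuous f}) ->
  measurable_fun I0 f.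
Proof.
move=> cf; apply: open_continuous_measurable_fun => // x.
by rewrite inE/= in_itv/= andbT => /cf.
Qed.

Lemma exh_gt0 n x : n.+2%:R^-1 <= x <= n.+2%:R -> 0 < (x : R).
Proof. by move=> /andP[+ _]; apply: lt_le_trans; rewrite invr_gt0 ltr0n. Qed.

(** The integrals over [exh n] are differences of two values of [F], hence at most [M + M]; monotone
    convergence does the rest. *)
Lemma ge0_integ_FTC f (F : R -> R) (M : R) :
  (forall x, 0 < x -> is_derive x 1 F (f x)) ->
  (forall x, 0 < x -> {for x, continuous f}) ->
  (forall x, 0 < x -> 0 <= f x) -> (forall x, 0 < x -> `|F x| <= M) ->
  integ I0 f.
Proof.
move=> dF cf f0 FM.
have h n := @FTC_cc f F _ _ (exh_lt n) (fun x h => dF x (exh_gt0 h)) (fun x h => cf x (exh_gt0 h)).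
apply: (@ge0_integ_exh _ (M + M)) => //; first exact: continuous_measurable_0y.
  by move=> n; exact: (h n).1.
move=> n; rewrite (h n).2 (le_trans (ler_norm _))// (le_trans (ler_normB _ _))//.
by rewrite lerD// FM// ?invr_gt0 ltr0n.
Qed.

Lemma Rint_FTC f (F : R -> R) (l0 l1 : R) :
  (forall x, 0 < x -> is_derive x 1 F (f x)) ->
  (forall x, 0 < x -> {for x, continuous f}) ->
  integ I0 f -> F x @[x --> 0^'+] --> l0 -> F x @[x --> +oo] --> l1 ->
  \int[mu]_(x in I0) f x = l1 - l0.
Proof.
move=> dF cf fi Fl0 Fl1.
have h n := @FTC_cc f F _ _ (exh_lt n) (fun x h => dF x (exh_gt0 h)) (fun x h => cf x (exh_gt0 h)).
have c1 := cvg_Rint_exh fi.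
have c2 : \int[mu]_(x in exh n) f x @[n --> \oo] --> l1 - l0.
  under eq_fun do rewrite (h _).2.
  have cy : (n.+2%:R : R) @[n --> \oo] --> +oo.
    apply/cvgryPge => r; near=> n; apply: (@le_trans _ _ n%:R).
      by near: n; exact: nbhs_infty_ger.
    by rewrite ler_nat -addn2 leq_addr.
  apply: cvgB.
    exact: (cvg_comp _ _ cy Fl1).
  move/cvg_at_rightP : Fl0; apply; split => [n|]; first by rewrite invr_gt0 ltr0n.
  apply/gtr0_cvgV0; first by near=> n; rewrite ltr0n.
  exact: cy.
by rewrite -(cvg_lim _ c1)// (cvg_lim _ c2).
Unshelve. all: by end_near. Qed.

Lemma powR_derive (x c : R) : 0 < x -> is_derive x 1 (fun y => y `^ c) (c * x `^ (c - 1)).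
Proof. exact: is_derive1_powR. Qed.

Lemma powR_cont (x c : R) : 0 < x -> {for x, continuous (fun y : R => y `^ c)}.
Proof. by move=> /(powR_derive c); exact: is_derive_continuous. Qed.

(** The integrand is the derivative of the bounded function [- (c (1 + x^c))^-1]. It behaves like
    [x^(c-1)] near 0 and like [x^(-c-1)] at infinity, so it is a single majorant for both ends. *)
Lemma integ_bump (c : R) : 0 < c ->
  integ I0 (fun x => x `^ (c - 1) / (1 + x `^ c) ^+ 2).
Proof.
move=> c0.
have p0 (x : R) : 0 < 1 + x `^ c by rewrite ltr_wpDr// powR_ge0.
have cp (x : R) : 0 < x -> {for x, continuous (fun y : R => 1 + y `^ c)}.
  by move=> x0; apply: continuousD; [exact: cst_continuous|exact: powR_cont].
apply: (@ge0_integ_FTC (fun x => x `^ (c - 1) / (1 + x `^ c) ^+ 2) (fun x => - c^-1 * (1 + x `^ c)^-1) c^-1).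
- move=> x x0; have h := powR_derive c x0.
  have hV : is_derive x 1 (fun x => (1 + x `^ c)^-1) (- (1 + x `^ c) ^- 2 *: (c * x `^ (c - 1))).
    apply: is_deriveV; first by rewrite gt_eqF.
    by apply: der_eq (derD (der_cst 1 x) h) _; rewrite add0r.
  apply: (is_derive_eq (is_deriveZ (- c^-1) hV)).
  by rewrite /GRing.scale/=; field; rewrite !gt_eqF.
- move=> x x0; apply: continuousM; first exact: powR_cont.
  apply: continuousV; first by rewrite expf_neq0 ?gt_eqF.
  by apply: (@continuousM _ _ (fun x => 1 + x `^ c) (fun x => 1 + x `^ c)); exact: cp.
- by move=> x x0; rewrite divr_ge0 ?powR_ge0// exprn_ge0// ltW.
- move=> x x0; rewrite normrM normrN !gtr0_norm ?invr_gt0//.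
  rewrite -[leRHS]mulr1 ler_wpM2l ?invr_ge0 ?(ltW c0)// invf_le1//.
  by rewrite lerDl powR_ge0.
Qed.

Lemma bump_le1 c x : 0 < c -> 0 < x <= 1 ->
  x `^ (c - 1) <= 4 * (x `^ (c - 1) / (1 + x `^ c) ^+ 2).
Proof.
move=> c0 /andP[x0 x1].
have p0 (y : R) : 0 < 1 + y `^ c by rewrite ltr_wpDr// powR_ge0.
have e1 : 1 `^ c = 1 :> R by rewrite powR1.
rewrite mulrCA ler_peMr ?powR_ge0//.
rewrite ler_pdivlMr ?exprn_gt0// mul1r.
rewrite (_ : 4 = 2 ^+ 2); last by rewrite expr2; ring.
rewrite ler_pXn2r ?nnegrE ?(ltW (p0 _))//.
suff : x `^ c <= 1 by lra.
by rewrite -e1 ge0_ler_powR// ?nnegrE// ltW.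
Qed.

Lemma bump_ge1 c x : 0 < c -> 1 <= x ->
  x `^ (- c - 1) <= 4 * (x `^ (c - 1) / (1 + x `^ c) ^+ 2).
Proof.
move=> c0 x1; have x0 : 0 < x by lra.
have p0 (y : R) : 0 < 1 + y `^ c by rewrite ltr_wpDr// powR_ge0.
have e1 : 1 `^ c = 1 :> R by rewrite powR1.
rewrite mulrA ler_pdivlMr ?exprn_gt0//.
have xc1 : 1 <= x `^ c by rewrite -e1 ge0_ler_powR// ?nnegrE// ltW.
have -> : x `^ (c - 1) = x `^ (- c - 1) * (x `^ c) ^+ 2.
  rewrite -powR_mulrn ?powR_ge0// -powRrM -powRD; last by rewrite (gt_eqF x0) implybT.
  by congr (_ `^ _); ring.
rewrite [leRHS]mulrCA ler_wpM2l ?powR_ge0//.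
rewrite (_ : 4 = 2 ^+ 2); last by rewrite expr2; ring.
by rewrite -exprMn ler_pXn2r ?nnegrE ?mulr_ge0 ?(ltW (p0 _)) ?powR_ge0//; lra.
Qed.

(** The common integrability test for ray kernels: both power bounds lie below [4 K] times the
    function of [integ_bump]. *)
Lemma integ_pow f (K c : R) : 0 < c -> measurable_fun I0 f ->
  (forall x, 0 < x <= 1 -> `|f x| <= K * x `^ (c - 1)) ->
  (forall x, 1 <= x -> `|f x| <= K * x `^ (- c - 1)) ->
  integ I0 f.
Proof.
move=> c0 mf f1 f2.
have K0 : 0 <= K.
  have := f1 1; rewrite ltr01 lexx => /(_ isT); rewrite powR1 mulr1.
  exact: le_trans.
apply: (@integ_le _ _ _ (fun x => (4 * K) * (x `^ (c - 1) / (1 + x `^ c) ^+ 2))) => //.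
  by apply: integZ => //; exact: integ_bump.
move=> x; rewrite /= in_itv/= andbT => x0.
rewrite [4 * K]mulrC -mulrA.
have [x1|x1] := leP x 1.
  by rewrite (le_trans (f1 _ _)) ?x0// ler_wpM2l// bump_le1// x0.
by rewrite (le_trans (f2 _ (ltW x1)))// ler_wpM2l// bump_ge1// ltW.
Qed.

Lemma expR_decay (k : R) n : 0 < k -> exists2 K, 0 < K &
  forall x, 0 <= x -> x ^+ n * expR (- (k * x)) <= K.
Proof.
move=> k0; exists ((n.+1%:R / k) ^+ n).
  by rewrite exprn_gt0// divr_gt0// ltr0n.
move=> x x0; rewrite expRN ler_pdivrMr ?expR_gt0//.
case: n => [|n]; first by rewrite !expr0 mul1r -expR0 ler_expR mulr_ge0// ltW.
have -> : k * x = n.+1%:R * (k * x / n.+1%:R) by rewrite [RHS]mulrC divfK ?pnatr_eq0.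
rewrite expRM_natl -exprMn ler_pXn2r ?nnegrE//; last first.
  by rewrite mulr_ge0 ?expR_ge0// divr_ge0// ltW.
apply: (@le_trans _ _ (n.+1%:R / k * (k * x / n.+1%:R))).
  rewrite -mulrA [_^-1 * _]mulrA [_^-1 * (k * x)]mulrA mulVf ?gt_eqF// mul1r.
  by rewrite [leRHS]mulrC divfK ?pnatr_eq0.
apply: ler_pM => //.
- by rewrite divr_ge0// ltW.
- by rewrite divr_ge0 ?mulr_ge0// ltW.
- by rewrite ler_pM2r ?invr_gt0// ler_nat.
- by apply: le_trans (expR_ge1Dx _); rewrite lerDr.
Qed.

Lemma Rint_expN (a : R) : 0 < a ->
  integ I0 (fun x => expR (- (a * x))) /\
  \int[mu]_(x in I0) expR (- (a * x)) = a^-1.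
Proof.
move=> a0.
have dF x : is_derive x 1 (fun x => - a^-1 * expR (- (a * x))) (expR (- (a * x))).
  by apply: is_derive_eq; rewrite /GRing.scale/=; field; rewrite gt_eqF.
have cf x : {for x, continuous (fun x => expR (- (a * x)))}.
  have : is_derive x 1 (fun x => expR (- (a * x))) (expR (- (a * x)) * - a).
    by apply: is_derive_eq; rewrite /GRing.scale/=; ring.
  exact: is_derive_continuous.
have fi : integ I0 (fun x => expR (- (a * x))).
  apply: (@ge0_integ_FTC (fun x => expR (- (a * x))) _ a^-1 (fun x _ => dF x) (fun x _ => cf x)).
    by move=> x x0; rewrite expR_ge0.
  move=> x x0; rewrite normrM normrN !gtr0_norm ?invr_gt0 ?expR_gt0//.
  by rewrite ler_piMr ?invr_ge0 1?ltW// expR_lt1 oppr_lt0 mulr_gt0.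
split => //; rewrite (Rint_FTC (fun x _ => dF x) (fun x _ => cf x) fi (l0 := - a^-1) (l1 := 0)).
- by rewrite sub0r opprK.
- have := is_derive_continuous (dF 0).
  by move=> /cvg_at_right_filter; rewrite mulr0 oppr0 expR0 mulr1.
- rewrite -(mulr0 (- a^-1)); apply: cvgM; first exact: cvg_cst.
  apply: (@cvg_comp _ _ _ (fun x => a * x) (fun y => expR (- y)) _ (pinfty_nbhs R)).
    exact: gt0_cvgMry.
  exact: cvgr_expR.
Qed.

End half_line.

(** * Complex-valued functions in polar coordinates *)

Local Open Scope complex_scope.

Section complex_tools.
Context {R : realType}.
Implicit Types (x y a b c d r u v : R) (z w : R[i]).

Definition cabs z : R := complex.Re `|z|.

Lemma cabsE z : `|z| = (cabs z)%:C.
Proof. by rewrite /cabs normc_def. Qed.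

Lemma cabs_sqr z : cabs z ^+ 2 = complex.Re z ^+ 2 + complex.Im z ^+ 2.
Proof. by rewrite /cabs normc_def/= sqr_sqrtr// addr_ge0// sqr_ge0. Qed.

Lemma cabs_ge0 z : 0 <= cabs z.
Proof. by rewrite /cabs normc_def/= sqrtr_ge0. Qed.

Lemma cabsM z w : cabs (z * w) = cabs z * cabs w.
Proof. by apply: complexI; rewrite -cabsE normrM !cabsE rmorphM. Qed.

Lemma cabsV z : cabs z^-1 = (cabs z)^-1.
Proof. by apply: complexI; rewrite -cabsE normfV !cabsE fmorphV. Qed.

Lemma cabsD z w : cabs (z + w) <= cabs z + cabs w.
Proof. by rewrite -lecR -cabsE rmorphD/= -!cabsE ler_normD. Qed.

Lemma cabsN z : cabs (- z) = cabs z.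
Proof. by apply: complexI; rewrite -!cabsE normrN. Qed.

Lemma cabsB z w : cabs (z - w) <= cabs z + cabs w.
Proof. by rewrite -(cabsN w) cabsD. Qed.

Lemma cabs_real x : cabs x%:C = `|x|.
Proof. by rewrite /cabs normc_def/= expr0n/= addr0 sqrtr_sqr. Qed.

Lemma cabs1 : cabs 1 = 1. Proof. by rewrite (cabs_real 1) normr1. Qed.

Lemma Re_le_cabs z : `|complex.Re z| <= cabs z.
Proof.
by rewrite -ler_sqr ?nnegrE ?cabs_ge0// cabs_sqr real_normK ?num_real// lerDl sqr_ge0.
Qed.

Lemma Im_le_cabs z : `|complex.Im z| <= cabs z.
Proof.
by rewrite -ler_sqr ?nnegrE ?cabs_ge0// cabs_sqr real_normK ?num_real// lerDr sqr_ge0.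
Qed.

Lemma cabs_le z : cabs z <= `|complex.Re z| + `|complex.Im z|.
Proof.
rewrite -ler_sqr ?nnegrE ?cabs_ge0 ?addr_ge0// cabs_sqr sqrrD !real_normK ?num_real//.
by rewrite addrAC lerDl mulrn_wge0// mulr_ge0.
Qed.

Lemma cabs_eq0 z : (cabs z == 0) = (z == 0).
Proof. by rewrite -(inj_eq (@complexI _)) -cabsE normr_eq0. Qed.

Lemma cabs_gt0 z : (0 < cabs z) = (z != 0).
Proof. by rewrite lt_neqAle cabs_ge0 andbT eq_sym cabs_eq0. Qed.

Definition cis a : R[i] := cos a +i* sin a.

Lemma cabs_cis a : cabs (cis a) = 1.
Proof.
by apply/eqP; rewrite -(@eqrXn2 _ 2) ?cabs_ge0// cabs_sqr/= cos2Dsin2 expr1n.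
Qed.

Lemma cisD a b : cis (a + b) = cis a * cis b.
Proof. by rewrite /cis cosD sinD; apply/eqP; rewrite eq_complex /= addrC [cos a * sin b + _]addrC !eqxx. Qed.

Lemma cis0 : cis 0 = 1.
Proof. by rewrite /cis cos0 sin0. Qed.

Lemma cispi : cis pi = -1.
Proof. by rewrite /cis cospi sinpi; apply/eqP; rewrite eq_complex/= oppr0 !eqxx. Qed.

Lemma cos_lip a b : `|cos a - cos b| <= `|a - b|.
Proof.
wlog ab : a b / a < b => [h|].
  have [/h//|/h|->] := ltgtP a b; first by rewrite distrC [`|a - b|]distrC.
  by rewrite !subrr.
have [|c _] := @MVT _ cos (fun x => - sin x) a b ab (fun x _ => is_derive_cos x).
  by apply: continuous_subspaceT => x; apply: continuous_cos.
rewrite distrC => ->; rewrite normrM normrN distrC ler_piMl//.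
exact: sin_max.
Qed.

Lemma sin_lip a b : `|sin a - sin b| <= `|a - b|.
Proof. by rewrite -!cosBpihalf (le_trans (cos_lip _ _))// opprB addrA subrK. Qed.

Lemma cis_lip a b : cabs (cis a - cis b) <= 2 * `|a - b|.
Proof.
by apply: (le_trans (cabs_le _)); rewrite mulr2n mulrDl mul1r lerD ?cos_lip ?sin_lip.
Qed.

(** Componentwise, because the variable is real while the values lie in [R[i]]: the calculus reduces
    to real derivatives. *)
Definition cder (f : R -> R[i]) x (d : R[i]) : Prop :=
  is_derive x 1 (fun y => complex.Re (f y)) (complex.Re d) /\
  is_derive x 1 (fun y => complex.Im (f y)) (complex.Im d).

Implicit Types (f g : R -> R[i]).

Lemma cder_eq f x z w : cder f x z -> z = w -> cder f x w.
Proof. by move=> ? <-. Qed.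

Lemma cder_cst z x : cder (fun _ => z) x 0.
Proof. by split; exact: der_cst. Qed.

Lemma cder_real (h : R -> R) x d : is_derive x 1 h d -> cder (fun y => (h y)%:C) x d%:C.
Proof. by split => //=; exact: der_cst. Qed.

Lemma ReD z w : complex.Re (z + w) = complex.Re z + complex.Re w.
Proof. by case: z w => ? ? [? ?]. Qed.
Lemma ImD z w : complex.Im (z + w) = complex.Im z + complex.Im w.
Proof. by case: z w => ? ? [? ?]. Qed.
Lemma ReN z : complex.Re (- z) = - complex.Re z.
Proof. by case: z. Qed.
Lemma ImN z : complex.Im (- z) = - complex.Im z.
Proof. by case: z. Qed.
Lemma ReM z w : complex.Re (z * w) =
  complex.Re z * complex.Re w - complex.Im z * complex.Im w.
Proof. by case: z w => ? ? [? ?]. Qed.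
Lemma ImM z w : complex.Im (z * w) =
  complex.Re z * complex.Im w + complex.Im z * complex.Re w.
Proof. by case: z w => ? ? [? ?]. Qed.
Lemma ReV z : complex.Re z^-1 = complex.Re z / (complex.Re z ^+ 2 + complex.Im z ^+ 2).
Proof. by case: z => ? ?. Qed.
Lemma ImV z : complex.Im z^-1 = - complex.Im z / (complex.Re z ^+ 2 + complex.Im z ^+ 2).
Proof. by case: z => ? ?; rewrite /= mulNr. Qed.

Lemma cderD f g x z w : cder f x z -> cder g x w -> cder (fun y => f y + g y) x (z + w).
Proof.
move=> [f1 f2] [g1 g2]; split.
  by under eq_fun do rewrite ReD; rewrite ReD; exact: derD.
by under eq_fun do rewrite ImD; rewrite ImD; exact: derD.
Qed.

Lemma cderN f x z : cder f x z -> cder (fun y => - f y) x (- z).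
Proof.
move=> [f1 f2]; split.
  by under eq_fun do rewrite ReN; rewrite ReN; exact: derN.
by under eq_fun do rewrite ImN; rewrite ImN; exact: derN.
Qed.

Lemma cderM f g x z w : cder f x z -> cder g x w ->
  cder (fun y => f y * g y) x (z * g x + f x * w).
Proof.
move=> [f1 f2] [g1 g2]; split.
  under eq_fun do rewrite ReM.
  apply: der_eq (derB (derM f1 g1) (derM f2 g2)) _.
  by rewrite ReD !ReM; ring.
under eq_fun do rewrite ImM.
apply: der_eq (derD (derM f1 g2) (derM f2 g1)) _.
by rewrite ImD !ImM; ring.
Qed.

Lemma ReIm_neq0 z : z != 0 -> complex.Re z ^+ 2 + complex.Im z ^+ 2 != 0.
Proof. by rewrite -cabs_gt0 -cabs_sqr => h; rewrite expf_neq0// gt_eqF. Qed.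

Lemma cderV f x z : f x != 0 -> cder f x z ->
  cder (fun y => (f y)^-1) x (- z * (f x)^-1 ^+ 2).
Proof.
move=> /ReIm_neq0 f0 [f1 f2].
have hd := derD (derM f1 f1) (derM f2 f2).
have := f0; rewrite !expr2 => f0'.
have hV := @derV _ (fun y => complex.Re (f y) * complex.Re (f y) + complex.Im (f y) * complex.Im (f y)) _ _ f0' hd.
split.
  under eq_fun do rewrite ReV !expr2.
  apply: der_eq (derM f1 hV) _.
  by rewrite expr2 !ReM !ImM !ReV !ImV ReN ImN; field.
under eq_fun do rewrite ImV !expr2.
apply: der_eq (derM (derN f2) hV) _.
by rewrite expr2 !ImM !ReM !ReV !ImV ReN ImN; field.
Qed.

Lemma cder_cis (h : R -> R) x d : is_derive x 1 h d ->
  cder (fun y => cis (h y)) x ('i * d%:C * cis (h x)).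
Proof.
move=> hd; split; rewrite /cis/=.
  by apply: der_eq (der_comp (is_derive_cos (h x)) hd) _; ring.
by apply: der_eq (der_comp (is_derive_sin (h x)) hd) _; ring.
Qed.

Definition ccont f x : Prop := {for x, continuous (fun y => complex.Re (f y))} /\
  {for x, continuous (fun y => complex.Im (f y))}.

Lemma ccont_cder f x z : cder f x z -> ccont f x.
Proof. by move=> [f1 f2]; split; [exact: is_derive_continuous f1|exact: is_derive_continuous f2]. Qed.

Lemma cont_ext (f g : R -> R) x : f =1 g -> {for x, continuous f} -> {for x, continuous g}.
Proof. by move=> /funext ->. Qed.

Lemma ccontD f g x : ccont f x -> ccont g x -> ccont (fun y => f y + g y) x.
Proof.
move=> [f1 f2] [g1 g2]; split.
  by apply: (cont_ext (fun y => esym (ReD _ _))); exact: continuousD.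
by apply: (cont_ext (fun y => esym (ImD _ _))); exact: continuousD.
Qed.

Lemma ccontN f x : ccont f x -> ccont (fun y => - f y) x.
Proof.
move=> [f1 f2]; split.
  by apply: (cont_ext (fun y => esym (ReN _))); exact: continuousN.
by apply: (cont_ext (fun y => esym (ImN _))); exact: continuousN.
Qed.

Lemma ccontM f g x : ccont f x -> ccont g x -> ccont (fun y => f y * g y) x.
Proof.
move=> [f1 f2] [g1 g2]; split.
  by apply: (cont_ext (fun y => esym (ReM _ _))); apply: continuousB; exact: continuousM.
by apply: (cont_ext (fun y => esym (ImM _ _))); apply: continuousD; exact: continuousM.
Qed.

Lemma ImZ x z : complex.Im (x%:C * z) = x * complex.Im z.
Proof. by rewrite ImM/= mul0r addr0. Qed.
Lemma ReZ x z : complex.Re (x%:C * z) = x * complex.Re z.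
Proof. by rewrite ReM/= mul0r subr0. Qed.

(** [cpow c r a] is [z^c] and [cexp t r a] is [e^(t z)] at [z = r e^(i a)]. With the angle as an
    argument the branch is fixed and no logarithm or cut appears. *)
Definition cpow c r a : R[i] := (r `^ c)%:C * cis (c * a).
Definition cexp t r a : R[i] := (expR (t * r * cos a))%:C * cis (t * r * sin a).

Lemma cabs_cpow c r a : cabs (cpow c r a) = r `^ c.
Proof. by rewrite cabsM cabs_real cabs_cis mulr1 ger0_norm// powR_ge0. Qed.

Lemma cabs_cexp t r a : cabs (cexp t r a) = expR (t * r * cos a).
Proof. by rewrite cabsM cabs_real cabs_cis mulr1 gtr0_norm// expR_gt0. Qed.

Lemma cpow1 r a : 0 <= r -> cpow 1 r a = r%:C * cis a.
Proof. by move=> r0; rewrite /cpow powRr1// mul1r. Qed.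

Lemma ccont_cst z x : ccont (fun _ => z) x.
Proof. exact: ccont_cder (cder_cst z x). Qed.

Lemma ccontV f x : f x != 0 -> ccont f x -> ccont (fun y => (f y)^-1) x.
Proof.
move=> /ReIm_neq0 f0 [f1 f2].
have h : {for x, continuous (fun y => (complex.Re (f y) ^+ 2 + complex.Im (f y) ^+ 2)^-1)}.
  apply: continuousV => //; apply: continuousD.
    exact: (@continuousM _ _ (fun y => complex.Re (f y)) (fun y => complex.Re (f y))).
  exact: (@continuousM _ _ (fun y => complex.Im (f y)) (fun y => complex.Im (f y))).
split.
  by apply: (cont_ext (fun y => esym (ReV _))); exact: continuousM.
apply: (cont_ext (fun y => esym (ImV _))).
apply: (@continuousM _ _ (fun y => - complex.Im (f y)) _ x _ h).
exact: (@continuousN _ _ _ (fun y => complex.Im (f y))).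
Qed.

(* [z = r e^(i a)] in polar coordinates; [g] is [z f'(z)], that is
   [r d/dr f] and [- i d/da f]. *)
Definition polar_at (F G : R -> R -> R[i]) r a : Prop :=
  cder (F ^~ a) r (G r a / r%:C) /\ cder (F r) a ('i * G r a).

Implicit Types F G : R -> R -> R[i].

Lemma polar_cst z r a : polar_at (fun _ _ => z) (fun _ _ => 0) r a.
Proof. by split; rewrite ?mul0r ?mulr0; exact: cder_cst. Qed.

Lemma polarD F G F' G' r a : polar_at F G r a -> polar_at F' G' r a ->
  polar_at (fun r a => F r a + F' r a) (fun r a => G r a + G' r a) r a.
Proof.
move=> [h1 h2] [k1 k2]; split; rewrite ?mulrDl ?mulrDr; first exact: cderD h1 k1.
exact: cderD h2 k2.
Qed.

Lemma polarN F G r a : polar_at F G r a ->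
  polar_at (fun r a => - F r a) (fun r a => - G r a) r a.
Proof.
move=> [h1 h2]; split; rewrite ?mulNr ?mulrN; first exact: cderN h1.
exact: cderN h2.
Qed.

Lemma polarM F G F' G' r a : polar_at F G r a -> polar_at F' G' r a ->
  polar_at (fun r a => F r a * F' r a)
    (fun r a => G r a * F' r a + F r a * G' r a) r a.
Proof.
move=> [h1 h2] [k1 k2]; split.
  by apply: cder_eq (cderM h1 k1) _; ring.
by apply: cder_eq (cderM h2 k2) _; ring.
Qed.

Lemma polarV F G r a : F r a != 0 -> polar_at F G r a ->
  polar_at (fun r a => (F r a)^-1) (fun r a => - G r a * ((F r a)^-1 * (F r a)^-1)) r a.
Proof.
move=> F0 [h1 h2]; split.
  by apply: cder_eq (@cderV (F ^~ a) _ _ F0 h1) _; rewrite expr2; ring.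
by apply: cder_eq (cderV F0 h2) _; rewrite expr2; ring.
Qed.

Lemma polar_cpow c r a : 0 < r ->
  polar_at (cpow c) (fun r a => c%:C * cpow c r a) r a.
Proof.
move=> r0; split.
  apply: cder_eq (cderM (cder_real (powR_derive c r0)) (cder_cst (cis (c * a)) r)) _.
  rewrite mulr0 addr0 /cpow powRB ?powRr1 ?ltW//; last by rewrite (gt_eqF r0) implybT.
  by rewrite rmorphM/= fmorph_div/=; ring.
have hd : is_derive a 1 (fun a => c * a) c.
  by apply: der_eq (derZ c (der_id a)) _; rewrite mulr1.
apply: cder_eq (cderM (cder_cst (r `^ c)%:C a) (cder_cis hd)) _.
by rewrite mul0r add0r /cpow; ring.
Qed.

Lemma ciscE a : (cos a)%:C + 'i * (sin a)%:C = cis a.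
Proof. by apply/eqP; rewrite eq_complex/= !mul0r !mul1r oppr0 !addr0 !add0r !eqxx. Qed.

Lemma polar_cexp t r a : 0 < r ->
  polar_at (cexp t) (fun r a => t%:C * cpow 1 r a * cexp t r a) r a.
Proof.
move=> r0; rewrite /polar_at (cpow1 _ (ltW r0)); split.
  have h1 : is_derive r 1 (fun r => expR (t * r * cos a)) (expR (t * r * cos a) * (t * cos a)).
    apply: der_comp (is_derive_expR _) _.
    by apply: der_eq (derM (derZ t (der_id r)) (der_cst (cos a) r)) _; ring.
  have h2 : is_derive r 1 (fun r => t * r * sin a) (t * sin a).
    by apply: der_eq (derM (derZ t (der_id r)) (der_cst (sin a) r)) _; ring.
  apply: cder_eq (cderM (cder_real h1) (cder_cis h2)) _.
  have rc : r%:C != 0 by rewrite (inj_eq (@complexI _)) gt_eqF.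
  by rewrite /cexp -(ciscE a) !rmorphM/=; field.
have h1 : is_derive a 1 (fun a => expR (t * r * cos a)) (expR (t * r * cos a) * (t * r * - sin a)).
  exact: (@der_comp _ (@expR R) (fun a => t * r * cos a) _ _ _ (is_derive_expR _) (derZ (t * r) (is_derive_cos a))).
have h2 : is_derive a 1 (fun a => t * r * sin a) (t * r * cos a).
  exact: (derZ (t * r) (is_derive_sin a)).
apply: cder_eq (cderM (cder_real h1) (cder_cis h2)) _.
(* [ring] treats ['i] as an atom, so its square is supplied by hand between two ring identities. *)
have ii : 'i * 'i = -1 :> R[i] by rewrite -expr2 sqr_i.
rewrite /cexp -(ciscE a) !rmorphM/= rmorphN/=.
transitivity ((expR (t * r * cos a))%:C * cis (t * r * sin a) * (t%:C * r%:C) * ('i * (cos a)%:C - (sin a)%:C)); first by ring.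
transitivity ((expR (t * r * cos a))%:C * cis (t * r * sin a) * (t%:C * r%:C) * ('i * (cos a)%:C + ('i * 'i) * (sin a)%:C)); last by ring.
by rewrite ii mulN1r.
Qed.

(** Uniformity in the angle on compact ranges of radii is what dominates the angular derivative
    under the integral over [exh n]. *)
Definition bounded_sector u v F : Prop := forall e M, 0 < e -> exists K,
  forall r a, e <= r <= M -> u < a < v -> cabs (F r a) <= K.

Lemma bsec_cst u v z : bounded_sector u v (fun _ _ => z).
Proof. by move=> e M e0; exists (cabs z). Qed.

Lemma bsecD u v F G : bounded_sector u v F -> bounded_sector u v G ->
  bounded_sector u v (fun r a => F r a + G r a).
Proof.
move=> hF hG e M e0; have [K hK] := hF e M e0; have [L hL] := hG e M e0.
by exists (K + L) => r a h k; rewrite (le_trans (cabsD _ _))// lerD ?hK ?hL.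
Qed.

Lemma bsecN u v F : bounded_sector u v F -> bounded_sector u v (fun r a => - F r a).
Proof.
move=> hF e M e0; have [K hK] := hF e M e0.
by exists K => r a h k; rewrite cabsN hK.
Qed.

Lemma bsecM u v F G : bounded_sector u v F -> bounded_sector u v G ->
  bounded_sector u v (fun r a => F r a * G r a).
Proof.
move=> hF hG e M e0; have [K hK] := hF e M e0; have [L hL] := hG e M e0.
by exists (K * L) => r a h k; rewrite cabsM ler_pM ?cabs_ge0 ?hK ?hL.
Qed.

Lemma bsecV u v F m : 0 < m ->
  (forall r a, 0 < r -> u < a < v -> m <= cabs (F r a)) ->
  bounded_sector u v (fun r a => (F r a)^-1).
Proof.
move=> m0 hm e M e0; exists m^-1 => r a /andP[er _] h; rewrite cabsV.
by rewrite lef_pV2 ?posrE ?(lt_le_trans m0)// hm// (lt_le_trans e0).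
Qed.

Lemma bsec_cpow u v c : 0 <= c -> bounded_sector u v (cpow c).
Proof.
move=> c0 e M e0; exists (M `^ c) => r a /andP[er rM] _; rewrite cabs_cpow.
by rewrite ge0_ler_powR// nnegrE (le_trans (ltW e0))// (le_trans er).
Qed.

Lemma bsec_cexp u v : bounded_sector u v (cexp 1).
Proof.
move=> e M e0; exists (expR M) => r a /andP[er rM] _; rewrite cabs_cexp ler_expR mul1r.
rewrite (le_trans _ rM)// ler_piMr ?cos_le1// (le_trans (ltW e0))//.
Qed.

End complex_tools.

(** * Rotation of rays: Cauchy's theorem in polar coordinates *)

Section rotation.
Context {R : realType}.
Notation mu := (@lebesgue_measure R).
Notation I0 := (`](0 : R), +oo[%classic).
Implicit Types (r a b u v : R) (F G : R -> R -> R[i]).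

Lemma mvt (f df : R -> R) a b : a < b ->
  (forall x, a <= x <= b -> is_derive x 1 f (df x)) ->
  exists c, a < c < b /\ f b - f a = df c * (b - a).
Proof.
move=> ab h; have [||c] := @MVT _ f df a b ab.
- by move=> x; rewrite in_itv/= => /andP[/ltW ax /ltW xb]; apply: h; rewrite ax xb.
- by apply: derivable_within_continuous => x; rewrite in_itv/= => /h[].
- by rewrite in_itv/= => cab e; exists c.
Qed.

Lemma integ_cst (A : set R) k : measurable A -> (mu A < +oo)%E -> integ A (fun _ => k).
Proof.
move=> mA muA; apply/integrableP; split; first exact/measurable_EFinP.
rewrite integral_cst//= ltey_eq; apply/orP; left; rewrite fin_numM//.
by rewrite ge0_fin_numE.
Qed.

Lemma exh_finite n : (mu (exh n : set R) < +oo)%E.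
Proof. by rewrite /exh lebesgue_measure_itv/=; case: ifP => _; rewrite ltry. Qed.

Lemma ccont_integ_exh (f : R -> R) n : (forall r, 0 < r -> {for r, continuous f}) ->
  integ (exh n) f.
Proof.
move=> cf; apply: continuous_compact_integrable; first exact: segment_compact.
apply: continuous_in_subspaceT => x; rewrite inE => /exh_subset.
by rewrite /= in_itv/= andbT => /cf.
Qed.

(** Substitute for Cauchy's theorem. The derivative in the angle of the integral of [Im F / r] is
    the integral of [Re G / r], that is of the radial derivative of [Re F], so only end-point values
    remain. The mean value theorem in the angle then produces [p]. *)
Lemma ray_integral_exh u v a b F G (n : nat) : u < a -> a < b -> b < v ->
  (forall r p, 0 < r -> u < p < v -> polar_at F G r p) ->
  (forall r p, 0 < r -> u < p < v -> ccont (G ^~ p) r) ->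
  bounded_sector u v G ->
  exists p, a < p < b /\
  \int[mu]_(r in exh n) (complex.Im (F r b) / r) -
  \int[mu]_(r in exh n) (complex.Im (F r a) / r) =
  (complex.Re (F n.+2%:R p) - complex.Re (F n.+2%:R^-1 p)) * (b - a).
Proof.
move=> ua ab bv pF cG bG.
pose h p r := complex.Im (F r p) / r.
have cV r : 0 < r -> {for r, continuous (fun r : R => r^-1)}.
  by move=> r0; apply: continuousV => //; rewrite gt_eqF.
have ch p : u < p < v -> forall r, 0 < r -> {for r, continuous (h p)}.
  move=> upv r r0; apply: continuousM; last exact: cV.
  exact: (ccont_cder (pF r p r0 upv).1).2.
have dh r p : 0 < r -> u < p < v -> is_derive p 1 (h ^~ r) (complex.Re (G r p) / r).
  move=> r0 upv; have [_ [_ hd]] := pF r p r0 upv.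
  apply: der_eq (derM hd (der_cst r^-1 p)) _.
  by rewrite mulr0 addr0 ImM/= mul0r mul1r add0r.
have [K hK] := bG n.+2%:R^-1 n.+2%:R (ltac:(by rewrite invr_gt0)).
have exhP r : exh n r -> 0 < r /\ n.+2%:R^-1 <= r <= n.+2%:R.
  by rewrite /exh/= in_itv/= => H; split => //; exact: exh_gt0 H.
have K0 : 0 <= K.
  apply: (le_trans (cabs_ge0 (G n.+2%:R a))); apply: hK; rewrite ?ua ?(lt_trans ab)//.
  by rewrite lexx andbT ltW// exh_lt.
pose dP p := complex.Re (F n.+2%:R p) - complex.Re (F n.+2%:R^-1 p).
have dint p : u < p < v ->
    is_derive p 1 (fun p => \int[mu]_(r in exh n) h p r) (dP p).
  move=> upv.
  have pI : `]u, v[%classic p by rewrite /= in_itv.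
  have intf x : `]u, v[%classic x -> mu.-integrable (exh n) (EFin \o h x).
    rewrite /= in_itv/= => xuv; apply: ccont_integ_exh; exact: ch.
  have derf x y : `]u, v[%classic x -> exh n y -> derivable (h ^~ y) x 1.
    rewrite /= in_itv/= => xuv /exhP[y0 _].
    by have [] := dh y x y0 xuv.
  have d1 x y : `]u, v[%classic x -> exh n y -> partial1of2 h x y = complex.Re (G y x) / y.
    rewrite /= in_itv/= => xuv /exhP[y0 _]; rewrite partial1of2E.
    by have [] := dh y x y0 xuv.
  (* [K] bounds [G] on the truncated sector, and [1 / r <= n + 2] on [exh n]. *)
  pose B := fun _ : R => K * n.+2%:R.
  have B0 y : 0 <= B y by rewrite mulr_ge0.
  have intB : mu.-integrable (exh n) (EFin \o B).
    by apply: integ_cst; [exact: exh_measurable|exact: exh_finite].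
  have Bub x y : `]u, v[%classic x -> exh n y -> `|partial1of2 h x y| <= B y.
    move=> xuv ey; rewrite d1//; have [y0 yb] := exhP _ ey.
    rewrite normrM ler_pM//.
      by rewrite (le_trans (Re_le_cabs _))// hK//; move: xuv; rewrite /= in_itv.
    rewrite gtr0_norm ?invr_gt0// -[leRHS]invrK lef_pV2 ?posrE ?invr_gt0//.
    by case/andP: yb.
  have mexh := mR (@exh_measurable R n).
  apply: DeriveDef.
    exact: (derivable_under_integral mexh pI intf derf B0 intB Bub).
  rewrite -derive1E (differentiation_under_integral mexh pI intf derf B0 intB Bub).
  rewrite (@eq_Rint _ _ _ (fun r => complex.Re (G r p) / r)); last first.
    by move=> r er; rewrite d1.
  (* Cauchy-Riemann in polar form: the angular derivative of [Im F / r] is also the radial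
     derivative of [Re F]. *)
  apply: (@FTC_cc _ _ (fun r => complex.Re (F r p)) _ _ (exh_lt n) _ _).2.
    move=> r /exh_gt0 r0; have [[hd _] _] := pF r p r0 upv.
    apply: der_eq hd _.
    by rewrite -fmorphV/= [G r p * _]mulrC ReZ mulrC.
  move=> r /exh_gt0 r0; apply: continuousM; last exact: cV.
  exact: (cG r p r0 upv).1.
have [|c [cab e]] := @mvt (fun p => \int[mu]_(r in exh n) h p r) dP a b ab.
  by move=> x /andP[ax xb]; apply: dint; rewrite (lt_le_trans ua)// (le_lt_trans xb).
by exists c; split.
Qed.

(** On [exh n] the two integrals differ by at most [(B (n + 2) + B (1 / (n + 2))) (b - a)], which
    tends to 0. *)
Lemma ray_rotation u v a b F G (B : R -> R) : u < a -> a < b -> b < v ->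
  (forall r p, 0 < r -> u < p < v -> polar_at F G r p) ->
  (forall r p, 0 < r -> u < p < v -> ccont (G ^~ p) r) ->
  bounded_sector u v G ->
  (forall r p, 0 < r -> a < p < b -> cabs (F r p) <= B r) ->
  B r @[r --> 0^'+] --> 0 -> B r @[r --> +oo] --> 0 ->
  integ I0 (fun r => complex.Im (F r a) / r) ->
  integ I0 (fun r => complex.Im (F r b) / r) ->
  \int[mu]_(r in I0) (complex.Im (F r a) / r) =
  \int[mu]_(r in I0) (complex.Im (F r b) / r).
Proof.
move=> ua ab bv pF cG bG FB B0 By ia ib.
have ca := cvg_Rint_exh ia; have cb := cvg_Rint_exh ib.
have cab : \int[mu]_(r in exh n) (complex.Im (F r b) / r) -
    \int[mu]_(r in exh n) (complex.Im (F r a) / r) @[n --> \oo] -->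
    \int[mu]_(r in I0) (complex.Im (F r b) / r) -
    \int[mu]_(r in I0) (complex.Im (F r a) / r) by exact: cvgB.
apply/eqP; rewrite eq_sym -subr_eq0; apply/eqP.
apply: cvg_unique cab _ => //.
have cBy : (B n.+2%:R + B n.+2%:R^-1) * (b - a) @[n --> \oo] --> 0.
  suff : (B n.+2%:R + B n.+2%:R^-1) * (b - a) @[n --> \oo] --> (0 + 0) * (b - a).
    by rewrite addr0 mul0r.
  apply: cvgM; last exact: cvg_cst.
  have cy : (n.+2%:R : R) @[n --> \oo] --> +oo.
    apply/cvgryPge => r; near=> n; apply: (@le_trans _ _ n%:R).
      by near: n; exact: nbhs_infty_ger.
    by rewrite ler_nat -addn2 leq_addr.
  apply: cvgD; first exact: (cvg_comp _ _ cy By).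
  move/cvg_at_rightP : B0; apply; split => [n|]; first by rewrite invr_gt0 ltr0n.
  apply/gtr0_cvgV0; first by near=> n; rewrite ltr0n.
  exact: cy.
apply: norm_cvg0.
apply: (@squeeze_cvgr _ _ _ _ (cst 0) (fun n => (B n.+2%:R + B n.+2%:R^-1) * (b - a))) => //.
- apply: nearW => n; rewrite normr_ge0/=.
  have [p [pab ->]] := ray_integral_exh n ua ab bv pF cG bG.
  rewrite normrM [`|b - a|]gtr0_norm ?subr_gt0// ler_wpM2r ?subr_ge0 ?(ltW ab)//.
  rewrite (le_trans (ler_normB _ _))// lerD// (le_trans (Re_le_cabs _))// FB//.
- exact: cvg_cst.
Unshelve. all: by end_near. Qed.

(** The hypotheses of the rotation, together with a bound on [F] itself: the derivative of a product
    contains the undifferentiated factors, so this bound makes the class stable under products. *)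
Definition polar_on u v F : Prop := exists G, [/\
  forall r p, 0 < r -> u < p < v -> polar_at F G r p,
  forall r p, 0 < r -> u < p < v -> ccont (G ^~ p) r,
  bounded_sector u v F & bounded_sector u v G].

Lemma polar_on_ccont u v F r p : polar_on u v F -> 0 < r -> u < p < v -> ccont (F ^~ p) r.
Proof. by move=> [G [h _ _ _]] r0 upv; exact: ccont_cder (h r p r0 upv).1. Qed.

Lemma polar_on_cst u v z : polar_on u v (fun _ _ => z).
Proof.
exists (fun _ _ => 0); split.
- by move=> r p _ _; exact: polar_cst.
- by move=> r p _ _; exact: ccont_cst.
- exact: bsec_cst.
- exact: bsec_cst.
Qed.

Lemma polar_onD u v F F' : polar_on u v F -> polar_on u v F' ->
  polar_on u v (fun r a => F r a + F' r a).
Proof.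
move=> [G [h1 h2 h3 h4]] [G' [k1 k2 k3 k4]]; exists (fun r a => G r a + G' r a); split.
- by move=> r p r0 upv; apply: polarD; [exact: h1|exact: k1].
- by move=> r p r0 upv; apply: ccontD; [exact: h2|exact: k2].
- exact: bsecD.
- exact: bsecD.
Qed.

Lemma polar_onN u v F : polar_on u v F -> polar_on u v (fun r a => - F r a).
Proof.
move=> [G [h1 h2 h3 h4]]; exists (fun r a => - G r a); split.
- by move=> r p r0 upv; apply: polarN; exact: h1.
- by move=> r p r0 upv; apply: ccontN; exact: h2.
- exact: bsecN.
- exact: bsecN.
Qed.

Lemma polar_onM u v F F' : polar_on u v F -> polar_on u v F' ->
  polar_on u v (fun r a => F r a * F' r a).
Proof.
move=> hF hF'; have [G [h1 h2 h3 h4]] := hF; have [G' [k1 k2 k3 k4]] := hF'.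
exists (fun r a => G r a * F' r a + F r a * G' r a); split.
- by move=> r p r0 upv; apply: polarM; [exact: h1|exact: k1].
- move=> r p r0 upv; apply: ccontD; apply: ccontM.
  + exact: h2.
  + exact: polar_on_ccont hF' r0 upv.
  + exact: polar_on_ccont hF r0 upv.
  + exact: k2.
- exact: bsecM.
- by apply: bsecD; exact: bsecM.
Qed.

Lemma polar_onV u v F m : 0 < m ->
  (forall r a, 0 < r -> u < a < v -> m <= cabs (F r a)) ->
  polar_on u v F -> polar_on u v (fun r a => (F r a)^-1).
Proof.
move=> m0 hm hF; have [G [h1 h2 h3 h4]] := hF.
have F0 r p : 0 < r -> u < p < v -> F r p != 0.
  by move=> r0 upv; rewrite -cabs_gt0 (lt_le_trans m0)// hm.
exists (fun r a => - G r a * ((F r a)^-1 * (F r a)^-1)); split.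
- by move=> r p r0 upv; apply: polarV; [exact: F0|exact: h1].
- move=> r p r0 upv; apply: ccontM; first by apply: ccontN; exact: h2.
  by apply: ccontM; apply: (ccontV (F0 r p r0 upv)); exact: polar_on_ccont hF r0 upv.
- exact: bsecV m0 hm.
- by apply: bsecM; [exact: bsecN|apply: bsecM; exact: bsecV m0 hm].
Qed.

Lemma polar_on_cpow u v c : 0 <= c -> polar_on u v (@cpow R c).
Proof.
move=> c0; exists (fun r a => c%:C * cpow c r a); split.
- by move=> r p r0 _; exact: polar_cpow.
- move=> r p r0 _; apply: ccontM; first exact: ccont_cst.
  exact: ccont_cder (polar_cpow c p r0).1.
- exact: bsec_cpow.
- by apply: bsecM; [exact: bsec_cst|exact: bsec_cpow].
Qed.

Lemma polar_on_cexp u v : polar_on u v (@cexp R 1).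
Proof.
exists (fun r a => 1%:C * cpow 1 r a * cexp 1 r a); split.
- by move=> r p r0 _; exact: polar_cexp.
- move=> r p r0 _; apply: ccontM; last exact: ccont_cder (polar_cexp 1 p r0).1.
  apply: ccontM; first exact: ccont_cst.
  exact: ccont_cder (polar_cpow 1 p r0).1.
- exact: bsec_cexp.
- apply: bsecM; last exact: bsec_cexp.
  by apply: bsecM; [exact: bsec_cst|exact: bsec_cpow].
Qed.

Lemma powR_mulV (r c : R) : 0 < r -> r `^ c / r = r `^ (c - 1).
Proof. by move=> r0; rewrite powRB ?powRr1 ?ltW// (gt_eqF r0) implybT. Qed.

Lemma polar_integ u v a F K c : 0 < c -> u < a < v -> polar_on u v F ->
  (forall r, 0 < r <= 1 -> cabs (F r a) <= K * r `^ c) ->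
  (forall r, 1 <= r -> cabs (F r a) <= K * r `^ (- c)) ->
  integ I0 (fun r => complex.Im (F r a) / r).
Proof.
move=> c0 uav pF h1 h2.
have bd r M : 0 < r -> cabs (F r a) <= M -> `|complex.Im (F r a) / r| <= M / r.
  move=> r0 hM; rewrite normrM [`|r^-1|]gtr0_norm ?invr_gt0//.
  by rewrite ler_pM2r ?invr_gt0// (le_trans (Im_le_cabs _)).
apply: (@integ_pow _ _ K c) => //.
- apply: continuous_measurable_0y => r r0; apply: continuousM.
    exact: (polar_on_ccont pF r0 uav).2.
  by apply: continuousV => //; rewrite gt_eqF.
- move=> r /andP[r0 r1]; rewrite -powR_mulV// mulrA; apply: bd => //.
  by rewrite h1// r0.
- move=> r r1; have r0 : 0 < r by exact: lt_le_trans r1.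
  by rewrite -powR_mulV// mulrA; apply: bd => //; exact: h2.
Qed.

(** Power decay at both ends supplies the integrability on the two rays and a boundary majorant,
    defined piecewise with a cut at [r = 1]. *)
Lemma ray_rotation_pow u v a b F K c : 0 < c -> u < a -> a < b -> b < v ->
  polar_on u v F ->
  (forall r p, 0 < r <= 1 -> a <= p <= b -> cabs (F r p) <= K * r `^ c) ->
  (forall r p, 1 <= r -> a <= p <= b -> cabs (F r p) <= K * r `^ (- c)) ->
  \int[mu]_(r in I0) (complex.Im (F r a) / r) =
  \int[mu]_(r in I0) (complex.Im (F r b) / r).
Proof.
move=> c0 ua ab bv pF h1 h2.
have aab : a <= a <= b by rewrite lexx ltW.
have bab : a <= b <= b by rewrite lexx andbT ltW.
have ia : integ I0 (fun r => complex.Im (F r a) / r).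
  apply: (polar_integ c0 _ pF (fun r h => h1 r a h aab) (fun r h => h2 r a h aab)).
  by rewrite ua (lt_trans ab).
have ib : integ I0 (fun r => complex.Im (F r b) / r).
  apply: (polar_integ c0 _ pF (fun r h => h1 r b h bab) (fun r h => h2 r b h bab)).
  by rewrite bv (lt_trans ua).
have [G [pFG cG _ bG]] := pF.
apply: (@ray_rotation u v a b F G (fun r => if r <= 1 then K * r `^ c else K * r `^ (- c))) => //.
- move=> r p r0 /andP[/ltW ap /ltW pb]; case: (leP r 1) => r1.
    by apply: h1; rewrite ?r0 ?ap.
  by apply: h2; rewrite ?(ltW r1) ?ap.
- have : K * r `^ c @[r --> 0^'+] --> K * 0.
    by apply: cvgM; [exact: cvg_cst|exact: powR_cvg0].
  rewrite mulr0; apply: cvg_trans; apply: near_eq_cvg; near=> r.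
  by rewrite ifT//; near: r; exact: nbhs_right_le.
- have : K * (r `^ c)^-1 @[r --> +oo] --> K * 0.
    apply: cvgM; first exact: cvg_cst.
    apply/gtr0_cvgV0.
      by near=> r; rewrite powR_gt0//; near: r; exact: nbhs_pinfty_gt.
    apply/cvgryPge => M; near=> r.
    have M0 : 0 <= `|M| + 1 by rewrite addr_ge0.
    apply: (@le_trans _ _ (`|M| + 1)); first by rewrite (le_trans (ler_norm _))// lerDl.
    rewrite -[leLHS]powRr1// -(mulVf (lt0r_neq0 c0)) powRrM.
    have r0 : 0 <= r by near: r; exact: nbhs_pinfty_ge.
    have rM : (`|M| + 1) `^ c^-1 <= r by near: r; apply: nbhs_pinfty_ge; rewrite num_real.
    by rewrite ge0_ler_powR ?nnegrE ?powR_ge0 ?(ltW c0).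
  rewrite mulr0; apply: cvg_trans; apply: near_eq_cvg; near=> r.
  rewrite ifF ?powRN//; apply/negbTE; rewrite -ltNge.
  by near: r; exact: nbhs_pinfty_gt.
Unshelve. all: by end_near. Qed.

End rotation.

(** * Contour integrals *)

Section contour.
Context {R : realType}.
Notation mu := (@lebesgue_measure R).
Notation I0 := (`](0 : R), +oo[%classic).
Implicit Types (r a b c k l p t u v x : R).

Lemma I0P r : I0 r -> 0 < r.
Proof. by rewrite /= in_itv/= andbT. Qed.

(** An angle strictly between [pi / 2] and [pi]: on its ray [e^(t z)] decays with rate [kap t],
    while [z^c] with [c <= 1] stays off the negative axis. *)
Definition th : R := 3 / 4 * pi.
Definition kap : R := - cos th.

Lemma th_itv : pi / 2 < th < pi.
Proof. by rewrite /th; have := pi_gt0 R; move=> h; apply/andP; split; lra. Qed.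

Lemma th_gt0 : 0 < th.
Proof. by have /andP[h _] := th_itv; have := pi_gt0 R; lra. Qed.

Lemma cos_decr a b : 0 <= a -> a <= b -> b <= pi -> cos b <= cos a.
Proof.
move=> a0 ab bpi; have [->//|ne] := eqVneq a b.
rewrite ltW// ltr_cos ?in_itv/= ?a0 ?bpi ?(le_trans a0 ab) ?(le_trans ab bpi)//.
by rewrite lt_neqAle ne.
Qed.

Lemma cos_gtN1 a : 0 <= a -> a < pi -> -1 < cos a.
Proof.
by move=> a0 api; rewrite -cospi ltr_cos ?in_itv/= ?a0 ?(ltW api) ?lexx ?pi_ge0.
Qed.

Lemma kap_itv : 0 < kap < 1.
Proof.
have /andP[h1 h2] := th_itv; have h := pi_gt0 R; apply/andP; split.
  rewrite /kap oppr_gt0 -cos_pihalf ltr_cos ?in_itv//=; apply/andP; split; lra.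
by rewrite /kap ltrNl cos_gtN1// ltW// th_gt0.
Qed.

Lemma kap_gt0 : 0 < kap. Proof. by have /andP[] := kap_itv. Qed.

(** By the half-angle formula this is [cos (a / 2)] for [0 <= a <= pi], the best constant in the
    bound of [sector_lower]. *)
Definition aper a : R := Num.sqrt ((1 + cos a) / 2).

Lemma aper_gt0 a : 0 <= a -> a < pi -> 0 < aper a.
Proof.
by move=> a0 api; rewrite sqrtr_gt0 divr_gt0//; have := cos_gtN1 a0 api; lra.
Qed.

Lemma aper_decr a b : 0 <= a -> a <= b -> b <= pi -> aper b <= aper a.
Proof. by move=> a0 ab bpi; rewrite ler_wsqrtr// ler_pM2r// lerD2l cos_decr. Qed.

(* [x^2 + 2 x l cos a + l^2 - (1 + cos a)/2 (x + l)^2 = (1 - cos a)/2 (x - l)^2] *)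
Lemma sector_lower x l a : 0 <= x -> 0 <= l ->
  aper a * (x + l) <= cabs (x%:C * cis a + l%:C).
Proof.
move=> x0 l0; rewrite -ler_sqr ?nnegrE ?cabs_ge0 ?mulr_ge0 ?sqrtr_ge0 ?addr_ge0//.
rewrite cabs_sqr ReD ImD ReZ ImZ/= addr0 exprMn sqr_sqrtr; last first.
  by rewrite divr_ge0//; have := cos_geN1 a; lra.
rewrite -subr_ge0.
rewrite [X in 0 <= X](_ : _ = (1 - cos a) / 2 * (x - l) ^+ 2); last first.
  have := cos2Dsin2 a => h.
  rewrite [(x * sin a) ^+ 2]exprMn (_ : sin a ^+ 2 = 1 - cos a ^+ 2); last by rewrite -h; ring.
  by field.
by rewrite mulr_ge0 ?sqr_ge0// divr_ge0//; have := cos_le1 a; lra.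
Qed.

Definition dd : R := aper th.

Lemma dd_gt0 : 0 < dd.
Proof. by apply: aper_gt0; [exact: ltW th_gt0|have /andP[] := th_itv]. Qed.

Lemma dd_le1 : dd <= 1.
Proof.
rewrite /dd /aper -[leRHS]sqrtr1 ler_wsqrtr// ler_pdivrMr// mul1r.
by have := @cos_le1 R th; lra.
Qed.

(** Since [aper] decreases, its value at [th] serves for every angle [c p <= th]: the bound is
    uniform in the order [c] and in the direction [p]. *)
Lemma cpow_lower c l r p : 0 <= c <= 1 -> 0 <= r -> 0 <= l -> 0 <= p <= th ->
  dd * (r `^ c + l) <= cabs (cpow c r p + l%:C).
Proof.
move=> /andP[c0 c1] r0 l0 /andP[p0 pth].
apply: le_trans (sector_lower (c * p) (powR_ge0 _ _) l0).
rewrite ler_wpM2r ?addr_ge0 ?powR_ge0// aper_decr ?mulr_ge0//.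
  by rewrite (le_trans _ pth)// ler_piMl.
by have /andP[_ /ltW] := th_itv.
Qed.

Lemma powR_natC x n : 0 <= x -> x `^ n%:R = x ^+ n.
Proof. exact: powR_mulrn. Qed.

Lemma pexp_decay p k : 0 < k -> exists2 K, 0 < K &
  forall r, 1 <= r -> r `^ p * expR (- (k * r)) <= K.
Proof.
move=> k0; have [n pn] : exists n : nat, p <= n%:R.
  exists (Num.bound `|p|); rewrite (le_trans (ler_norm _))// ltW//.
  by have := archi_boundP (normr_ge0 p).
have [K K0 hK] := expR_decay n k0; exists K => // r r1.
have r0 : 0 <= r by lra.
apply: le_trans (hK r r0); rewrite ler_wpM2r ?expR_ge0// -powR_natC//.
by rewrite ler_powR.
Qed.

Lemma integ_pexp p k : -1 < p -> 0 < k ->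
  integ I0 (fun r => r `^ p * expR (- (k * r))).
Proof.
move=> p1 k0; have [K K0 hK] := pexp_decay (p + p + 2) k0.
have c0 : 0 < p + 1 by lra.
apply: (@integ_pow _ _ (1 + K) (p + 1)) => //.
- apply: continuous_measurable_0y => r r0; apply: continuousM; first exact: powR_cont.
  have : is_derive r 1 (fun x => expR (- (k * x))) (expR (- (k * r)) * - (k * 1)).
    exact: (@der_comp _ (@expR R) (fun x => - (k * x)) _ _ _ (is_derive_expR _) (derN (derZ k (der_id r)))).
  exact: is_derive_continuous.
- move=> r /andP[r0 r1]; rewrite ger0_norm ?mulr_ge0 ?powR_ge0 ?expR_ge0// addrK.
  rewrite mulrC ler_wpM2r ?powR_ge0//; apply: (@le_trans _ _ 1); last by lra.
  by rewrite expR_le1 oppr_le0 mulr_ge0 ?ltW.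
- move=> r r1; have r0 : 0 < r by lra.
  rewrite ger0_norm ?mulr_ge0 ?powR_ge0 ?expR_ge0//.
  rewrite (_ : - (p + 1) - 1 = - (p + 2)); last by ring.
  rewrite powRN ler_pdivlMr ?powR_gt0// mulrAC -powRD ?(gt_eqF r0) ?implybT//.
  by rewrite addrA (le_trans (hK _ r1))// lerDr.
Qed.

Lemma gamma_ray_bound c r p : 0 <= c <= 1 -> th <= p <= pi -> 0 < r ->
  cabs (cpow (c + 1) r p * cexp 1 r p) <= r `^ (c + 1) * expR (- (kap * r)).
Proof.
move=> c01 /andP[p1 p2] r0; rewrite cabsM cabs_cpow cabs_cexp mul1r.
rewrite ler_wpM2l ?powR_ge0// ler_expR mulrC -mulNr opprK ler_wpM2r ?(ltW r0)//.
by apply: cos_decr => //; rewrite ltW// th_gt0.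
Qed.

Lemma polar_on_gamma c : 0 <= c ->
  polar_on 0 (pi + pi) (fun r p : R => cpow (c + 1) r p * cexp 1 r p).
Proof.
by move=> c0; apply: polar_onM; [apply: polar_on_cpow; lra|exact: polar_on_cexp].
Qed.

Lemma cpowD1 c r p : 0 < r -> cpow (c + 1) r p = r%:C * cis p * cpow c r p.
Proof.
move=> r0; rewrite /cpow powRD ?(gt_eqF r0) ?implybT// powRr1 ?ltW//.
by rewrite mulrDl mul1r cisD rmorphM/=; ring.
Qed.

(** The ray is turned outward, from [th] to the negative axis. There [e^z = e^(-r)], [dz = - dr] and
    [z^c] has argument [pi c], which leaves the Gamma integral and the sine. The rotation is applied
    to [z^(c+1) e^z] because the measure in the rotation lemmas is [dr / r]. *)
Lemma gamma_ray c : 0 <= c <= 1 ->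
  integ I0 (fun r => complex.Im (cis th * cexp 1 r th * cpow c r th)) /\
  \int[mu]_(r in I0) complex.Im (cis th * cexp 1 r th * cpow c r th) =
  - sin (pi * c) * \int[mu]_(r in I0) (r `^ c * expR (- r)).
Proof.
move=> c01; have /andP[c0 c1] := c01.
have [K K0 hK] := pexp_decay (c + 2) kap_gt0.
have b1 r p : 0 < r <= 1 -> th <= p <= pi ->
    cabs (cpow (c + 1) r p * cexp 1 r p) <= (1 + K) * r `^ 1.
  move=> /andP[r0 r1] hp; rewrite (le_trans (gamma_ray_bound c01 hp r0))//.
  rewrite mulrC ler_pM ?expR_ge0 ?powR_ge0//.
    apply: (@le_trans _ _ 1); last by lra.
    by rewrite expR_le1 oppr_le0 mulr_ge0 ?ltW// kap_gt0.
  by apply: ger_powR; [rewrite r0|lra].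
have b2 r p : 1 <= r -> th <= p <= pi ->
    cabs (cpow (c + 1) r p * cexp 1 r p) <= (1 + K) * r `^ (- 1).
  move=> r1 hp; have r0 : 0 < r by lra.
  rewrite (le_trans (gamma_ray_bound c01 hp r0))//.
  rewrite powRN ler_pdivlMr ?powR_gt0// mulrAC -powRD ?(gt_eqF r0) ?implybT//.
  by rewrite -addrA (le_trans (hK _ r1))// lerDr.
have /andP[t1 t2] := th_itv; have t0 := th_gt0; have pi0 := pi_gt0 R.
have E r p : I0 r -> complex.Im (cpow (c + 1) r p * cexp 1 r p) / r =
    complex.Im (cis p * cexp 1 r p * cpow c r p).
  move=> /I0P r0; rewrite (cpowD1 c p r0).
  rewrite (_ : _ * cexp 1 r p = r%:C * (cis p * cexp 1 r p * cpow c r p)); last by ring.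
  by rewrite ImZ mulrAC divff ?gt_eqF// mul1r.
split.
  apply: integ_ext (polar_integ ltr01 _ (polar_on_gamma c0) (fun r h => b1 r th h _) (fun r h => b2 r th h _)) => //.
  - by move=> r rI; rewrite E.
  - by apply/andP; split; lra.
  - by rewrite lexx ltW.
  - by rewrite lexx ltW.
transitivity (\int[mu]_(r in I0) (complex.Im (cpow (c + 1) r th * cexp 1 r th) / r)).
  by apply: eq_Rint => r rI; rewrite E.
rewrite (ray_rotation_pow ltr01 t0 t2 _ (polar_on_gamma c0) b1 b2); last by lra.
rewrite -RintegralZl//; last first.
  have gi : integ I0 (fun r => r `^ c * expR (- (1 * r))) by apply: integ_pexp; lra.
  by apply: integ_ext gi => // r _; rewrite mul1r.
apply: eq_Rint => r rI; rewrite E//.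
have r0 := I0P rI.
rewrite cispi /cexp mul1r sinpi mulr0 cis0 mulr1 cospi mulrN1 /cpow.
by rewrite mulN1r mulNr ImN ImZ ImZ/= [c * pi]mulrC; ring.
Qed.

(** The primitive [atan ((r + cos b) / sin b)] runs from [pi / 2 - b] at 0 to [pi / 2] at
    infinity. *)
Lemma arctan_integral b : 0 < b < pi ->
  integ I0 (fun r => sin b / (r ^+ 2 + 2 * r * cos b + 1)) /\
  \int[mu]_(r in I0) (sin b / (r ^+ 2 + 2 * r * cos b + 1)) = b.
Proof.
move=> bpi; have /andP[b0 b1] := bpi.
have sb : 0 < sin b by apply: sin_gt0_pi.
have q r : r ^+ 2 + 2 * r * cos b + 1 = (r + cos b) ^+ 2 + sin b ^+ 2.
  by rewrite -[X in _ + X = _](cos2Dsin2 b); ring.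
have q0 r : 0 < r ^+ 2 + 2 * r * cos b + 1.
  by rewrite q ltr_wpDl ?sqr_ge0// exprn_gt0.
pose F r := atan ((r + cos b) * (sin b)^-1).
have dF r : is_derive r 1 F (sin b / (r ^+ 2 + 2 * r * cos b + 1)).
  have hd : is_derive r 1 (fun r => (r + cos b) * (sin b)^-1) (sin b)^-1.
    by apply: der_eq (derM (derD (der_id r) (der_cst (cos b) r)) (der_cst (sin b)^-1 r)) _; ring.
  apply: der_eq (@der_comp _ (@atan R) _ _ _ _ (is_derive1_atan _) hd) _.
  by rewrite q; field; rewrite ?gt_eqF//= -?q.
have cf r : {for r, continuous (fun r => sin b / (r ^+ 2 + 2 * r * cos b + 1))}.
  apply: continuousM; first exact: cst_continuous.
  apply: continuousV; first by rewrite gt_eqF.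
  have hd : is_derive r 1 (fun r => r * r + 2 * r * cos b + 1) (r + r + 2 * cos b).
    apply: der_eq (derD (derD (derM (der_id r) (der_id r)) (derM (derZ 2 (der_id r)) (der_cst (cos b) r))) (der_cst 1 r)) _.
    by ring.
  exact: is_derive_continuous hd.
have fi : integ I0 (fun r => sin b / (r ^+ 2 + 2 * r * cos b + 1)).
  apply: (@ge0_integ_FTC _ _ F pi (fun x _ => dF x) (fun x _ => cf x)).
    by move=> r _; rewrite divr_ge0// ltW.
  move=> r _; rewrite ler_norml /F; have := pi_gt0 R.
  have := atan_gtNpi2 ((r + cos b) * (sin b)^-1).
  have := atan_ltpi2 ((r + cos b) * (sin b)^-1).
  by move=> h1 h2 h3; apply/andP; split; lra.
split => //; rewrite (Rint_FTC (fun x _ => dF x) (fun x _ => cf x) fi (l0 := pi / 2 - b) (l1 := pi / 2)).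
- by ring.
- have := is_derive_continuous (dF 0) => /cvg_at_right_filter.
  rewrite /F add0r (_ : cos b * (sin b)^-1 = tan (pi / 2 - b)) ?tanK ?in_itv//=.
    by apply/andP; split; lra.
  by rewrite /tan -(opprB b) sinN cosN sinBpihalf cosBpihalf opprK.
- rewrite /F; apply: (@cvg_comp _ _ _ (fun x => (x + cos b) * (sin b)^-1) (@atan R) _ (pinfty_nbhs R)); last exact: cvgy_atan.
  apply: gt0_cvgMly; first by rewrite invr_gt0.
  apply/cvgryPge => M; near=> r; rewrite -lerBlDr.
  by near: r; apply: nbhs_pinfty_ge; rewrite num_real.
Unshelve. all: by end_near. Qed.

Lemma cis_sub_pi p : cis (p - pi) = - cis p :> R[i].
Proof.
rewrite cisD (_ : cis (- pi) = -1) ?mulrN1//.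
by rewrite /cis cosN sinN cospi sinpi; apply/eqP; rewrite eq_complex/= oppr0 !eqxx.
Qed.

(** [1 - z] is 1 plus the point of modulus [r] and angle [p - pi], so [sector_lower] applies with
    the complementary angle. It measures the distance to the singular point [z = 1]. *)
Lemma one_sub_lower r p : 0 <= r -> aper (pi - p) * (r + 1) <= cabs (1 - cpow 1 r p).
Proof.
move=> r0; have e : r%:C * cis (p - pi) + 1%:C = 1 - cpow 1 r p.
  by rewrite cis_sub_pi cpow1// mulrN addrC.
have := sector_lower (p - pi) r0 (@ler01 R); rewrite e.
by rewrite /aper -(cosN (p - pi)) opprB.
Qed.

Lemma cabs_one_sub c r p :
  cabs (1 - cpow c r p) ^+ 2 = (1 - r `^ c) ^+ 2 + 2 * r `^ c * (1 - cos (c * p)).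
Proof.
rewrite cabs_sqr ReD ImD ReN ImN /cpow ReZ ImZ/= add0r sqrrN exprMn.
rewrite (_ : sin _ ^+ 2 = 1 - cos (c * p) ^+ 2); last by rewrite -(cos2Dsin2 (c * p)); ring.
by ring.
Qed.

(** Keeps [(1 - z^c) / (1 - z)] under control near [z = 1], uniformly in the angle. The two summands
    of [cabs_one_sub] are compared separately, through [1 - r^c <= 1 - r] and
    [1 - cos (c p) <= 1 - cos p]. *)
Lemma one_sub_ratio_le1 c r p : 0 < c <= 1 -> 0 < r <= 1 -> 0 <= p <= pi ->
  cabs (1 - cpow c r p) <= r `^ (c - 1) * cabs (1 - cpow 1 r p).
Proof.
move=> /andP[c0 c1] /andP[r0 r1] /andP[p0 p1].
have q1 : 1 <= r `^ (c - 1).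
  by rewrite -[leLHS](powRr0 r) ger_powR ?r0//; lra.
rewrite -ler_sqr ?nnegrE ?cabs_ge0 ?mulr_ge0 ?powR_ge0 ?cabs_ge0// exprMn.
rewrite !cabs_one_sub powRr1 ?(ltW r0)// mul1r.
have E : r `^ c = r `^ (c - 1) * r by rewrite -powR_mulV// divfK ?gt_eqF.
have rc : r <= r `^ c by apply: ger1_powR => //; rewrite ?r0.
have rc1 : r `^ c <= 1.
  by rewrite -[leRHS](powRr0 r) ger_powR ?r0// ltW.
have cc : cos p <= cos (c * p).
  by apply: cos_decr => //; [rewrite mulr_ge0// ltW|rewrite ler_piMl].
have cp1 := cos_le1 (c * p).
set X := r `^ (c - 1) in q1 E *.
have XX : X <= X ^+ 2 by rewrite expr2 ler_peMl// (le_trans ler01 q1).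
apply: (@le_trans _ _ (X * ((1 - r) ^+ 2 + 2 * r * (1 - cos p)))); last first.
  by rewrite ler_wpM2r// addr_ge0 ?sqr_ge0// mulr_ge0//; have := cos_le1 p; lra.
rewrite [leRHS]mulrDr lerD//.
  apply: (@le_trans _ _ ((1 - r) ^+ 2)); last by rewrite ler_peMl ?sqr_ge0.
  by rewrite ler_sqr ?nnegrE; lra.
rewrite E [leRHS]mulrA [leRHS](_ : _ = 2 * (X * r) * (1 - cos p)); last by ring.
by rewrite ler_wpM2l ?mulr_ge0 ?(le_trans ler01 q1) ?(ltW r0)//; lra.
Qed.

Lemma one_sub_ratio_ge1 c r p : 0 < c <= 1 -> 1 <= r -> 0 <= p <= pi ->
  cabs (1 - cpow c r p) <= cabs (1 - cpow 1 r p).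
Proof.
move=> /andP[c0 c1] r1 /andP[p0 p1].
have r0 : 0 < r by lra.
rewrite -ler_sqr ?nnegrE ?cabs_ge0// !cabs_one_sub powRr1 ?(ltW r0)// mul1r.
have rc : r `^ c <= r by rewrite ler1_powR.
have rc1 : 1 <= r `^ c.
  by rewrite -[leLHS](powRr0 r) ler_powR// ltW.
have cc : cos p <= cos (c * p).
  by apply: cos_decr => //; [rewrite mulr_ge0// ltW|rewrite ler_piMl].
have cp1 := cos_le1 (c * p).
rewrite lerD//.
  by rewrite -sqrrN -[leRHS]sqrrN !opprB ler_sqr ?nnegrE; lra.
by rewrite ler_pM ?mulr_ge0 ?powR_ge0//; lra.
Qed.

End contour.

(** * The ray integral of [1 / ((1 - z) (z^c + m))] *)

Section laplace_kernel.
Context {R : realType}.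
Notation mu := (@lebesgue_measure R).
Notation I0 := (`](0 : R), +oo[%classic).
Notation th := (@th R).
Notation dd := (@dd R).
Implicit Types (r a b c k l p t u v x m s : R).

(* [z G(z)] where [G(z) = (1 - z^c)/((1 - z)(z^c + m)) - 1/(1 + z)] has a
   removable singularity at [z = 1] and decays like [z^(-1-c)]. *)
Definition reskern c m r p : R[i] :=
  cpow 1 r p * ((1 - cpow c r p) * (1 - cpow 1 r p)^-1 * (cpow c r p + m%:C)^-1 -
    (cpow 1 r p + 1)^-1).

(** Between the angles [u > 0] and [v < pi] all three denominators stay away from 0, so the closure
    rules of [polar_on] apply. An empty sector is set apart because the lower bounds use [0 < v]. *)
Lemma polar_on_reskern c m u v : 0 < c <= 1 -> 0 < m -> 0 < u -> v < pi ->
  polar_on u v (reskern c m).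
Proof.
move=> /andP[c0 c1] m0 u0 vpi.
have [uv|vu] := ltP u v; last first.
  exists (fun _ _ => 0); split=> [r p _ /andP[h1 h2]|r p _ /andP[h1 h2]|e M e0|e M e0].
  - by have := lt_le_trans (lt_trans h1 h2) vu; rewrite ltxx.
  - by have := lt_le_trans (lt_trans h1 h2) vu; rewrite ltxx.
  - by exists 0 => r p _ /andP[h1 h2]; have := lt_le_trans (lt_trans h1 h2) vu; rewrite ltxx.
  - by exists 0 => r p _ /andP[h1 h2]; have := lt_le_trans (lt_trans h1 h2) vu; rewrite ltxx.
have v0 : 0 < v by exact: lt_trans uv.
have pw d : 0 <= d -> polar_on u v (@cpow R d) by exact: polar_on_cpow.
have h1 := pw 1 ler01; have hc := pw c (ltW c0).
have lowz r p : 0 < r -> u < p < v -> aper (pi - u) <= cabs (1 - cpow 1 r p).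
  move=> r0 /andP[up pv]; apply: le_trans (one_sub_lower p (ltW r0)).
  apply: (@le_trans _ _ (aper (pi - p))); first by apply: aper_decr; lra.
  by rewrite ler_peMr ?sqrtr_ge0//; lra.
have lowc d l r p : 0 <= d <= 1 -> 0 < l -> 0 < r -> u < p < v ->
    aper v * l <= cabs (cpow d r p + l%:C).
  move=> /andP[d0 d1] l0 r0 /andP[up pv].
  apply: le_trans (sector_lower (d * p) (powR_ge0 _ _) (ltW l0)).
  apply: ler_pM; rewrite ?sqrtr_ge0 ?(ltW l0) ?lerDr ?powR_ge0//.
  have p0 : 0 <= p by lra.
  by apply: aper_decr; [rewrite mulr_ge0|rewrite (le_trans _ (ltW pv))// ler_piMl|exact: ltW].
apply: polar_onM => //; apply: polar_onD.
  apply: polar_onM.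
    apply: polar_onM.
      by apply: polar_onD; [exact: polar_on_cst|exact: polar_onN].
    apply: (polar_onV _ lowz); first by apply: aper_gt0; lra.
    by apply: polar_onD; [exact: polar_on_cst|exact: polar_onN].
  apply: (@polar_onV _ _ _ _ (aper v * m)).
  - by rewrite mulr_gt0// aper_gt0// ltW.
  - by move=> r p r0 upv; apply: lowc; rewrite ?(ltW c0).
  - by apply: polar_onD => //; exact: polar_on_cst.
apply: polar_onN; apply: (@polar_onV _ _ _ _ (aper v * 1)).
- by rewrite mulr1 aper_gt0// ltW.
- by move=> r p r0 upv; apply: (lowc 1 1); rewrite ?ler01 ?lexx.
- by apply: polar_onD => //; exact: polar_on_cst.
Qed.

Lemma unit_itv x : x = 1 -> 0 <= x <= 1.
Proof. by move=> ->; apply/andP; split; lra. Qed.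

(** Chosen to serve all radii: the factor 4 covers [r <= 1] and [1 <= r <= 2], the second summand
    covers [r > 2]. *)
Definition resK c m : R := 4 * ((dd * m)^-1 + dd^-1) + (4 * m + 8) / dd ^+ 2.

Lemma one_sub_neq0 r p : 0 <= r -> 0 < p <= th -> 1 - cpow 1 r p != 0.
Proof.
move=> r0 /andP[p0 pth]; rewrite -cabs_gt0.
apply: lt_le_trans (one_sub_lower p r0); rewrite mulr_gt0//; last by lra.
by have /andP[_ h] := @th_itv R; apply: aper_gt0; lra.
Qed.

(** An estimate without cancellation between the two terms, sufficient for bounded [r]; [X] bounds
    the quotient [(1 - z^c) / (1 - z)]. *)
Lemma reskern_pre c m r p X : 0 < c <= 1 -> 0 < m -> 0 < r -> 0 < p <= th -> 0 <= X ->
  cabs (1 - cpow c r p) <= X * cabs (1 - cpow 1 r p) ->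
  cabs (reskern c m r p) <= r * (X * (dd * m)^-1 + dd^-1).
Proof.
move=> /andP[c0 c1] m0 r0 /andP[p0 pth] X0 h.
have d0 := @dd_gt0 R.
have n0 : 0 < cabs (1 - cpow 1 r p) by rewrite cabs_gt0 one_sub_neq0 ?p0// ltW.
rewrite cabsM cabs_cpow powRr1 ?(ltW r0)// ler_wpM2l ?(ltW r0)//.
apply: (le_trans (cabsB _ _)); rewrite lerD//.
  rewrite !cabsM !cabsV ler_pM ?mulr_ge0 ?invr_ge0 ?cabs_ge0//.
    by rewrite ler_pdivrMr.
  have low : dd * m <= cabs (cpow c r p + m%:C).
    have hh : 0 <= c <= 1 by rewrite (ltW c0).
    have hp : 0 <= p <= th by rewrite (ltW p0).
    apply: le_trans (cpow_lower hh (ltW r0) (ltW m0) hp).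
    by rewrite ler_wpM2l ?(ltW d0)// lerDr powR_ge0.
  by rewrite lef_pV2 ?posrE ?mulr_gt0// (lt_le_trans _ low)// mulr_gt0.
rewrite cabsV.
have low : dd <= cabs (cpow 1 r p + 1).
  have hp : 0 <= p <= th by rewrite (ltW p0).
  have h1 := unit_itv (erefl (1 : R)).
  apply: le_trans (cpow_lower h1 (ltW r0) (@ler01 R) hp).
  by rewrite ler_peMr ?(ltW d0)// lerDr powR_ge0.
by rewrite lef_pV2 ?posrE ?(lt_le_trans d0).
Qed.

Lemma reskern_le1 c m r p : 0 < c <= 1 -> 0 < m -> 0 < r <= 1 -> 0 < p <= th ->
  cabs (reskern c m r p) <= resK c m * r `^ c.
Proof.
move=> hc m0 /andP[r0 r1] hp; have /andP[c0 c1] := hc; have /andP[p0 pth] := hp.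
have d0 := @dd_gt0 R; have /andP[_ tpi] := @th_itv R.
have q1 : 1 <= r `^ (c - 1).
  by rewrite -[leLHS](powRr0 r) ger_powR ?r0//; lra.
have ppi : 0 <= p <= pi by apply/andP; split; lra.
have rr : 0 < r <= 1 by rewrite r0.
apply: (le_trans (reskern_pre hc m0 r0 hp (powR_ge0 _ _) (one_sub_ratio_le1 hc rr ppi))).
have E : r `^ c = r * r `^ (c - 1) by rewrite -powR_mulV// mulrC divfK ?gt_eqF.
rewrite E mulrCA ler_wpM2l ?(ltW r0)//.
have A0 : 0 <= (dd * m)^-1 by rewrite invr_ge0 mulr_ge0 ?ltW.
have B0 : 0 <= dd^-1 by rewrite invr_ge0 ltW.
have C0 : 0 <= (4 * m + 8) / dd ^+ 2 by rewrite divr_ge0 ?exprn_ge0 ?(ltW d0)//; lra.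
rewrite mulrC /resK; set X := r `^ (c - 1) in q1 *; set A := (dd * m)^-1 in A0 *.
set B := dd^-1 in B0 *; set C := _ / _ in C0 *.
have : A * X <= (A + B + 4 * (A + B)) * X.
  by rewrite ler_wpM2r ?powR_ge0//; clear - A0 B0; lra.
have h : B <= B * X by rewrite ler_peMr.
have : 0 <= (3 * (A + B) + C) * X.
  by rewrite mulr_ge0 ?powR_ge0//; clear - A0 B0 C0; lra.
by rewrite !mulrDl; clear - h; lra.
Qed.

Lemma reskern_ge1 c m r p : 0 < c <= 1 -> 0 < m -> 1 <= r -> 0 < p <= th ->
  cabs (reskern c m r p) <= resK c m * r `^ (- c).
Proof.
move=> hc m0 r1 hp; have /andP[c0 c1] := hc; have /andP[p0 pth] := hp.
have d0 := @dd_gt0 R; have /andP[_ tpi] := @th_itv R.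
have r0 : 0 < r by lra.
have ppi : 0 <= p <= pi by apply/andP; split; lra.
have A0 : 0 <= (dd * m)^-1 by rewrite invr_ge0 mulr_ge0 ?ltW.
have B0 : 0 <= dd^-1 by rewrite invr_ge0 ltW.
have C0 : 0 <= (4 * m + 8) / dd ^+ 2 by rewrite divr_ge0 ?exprn_ge0 ?(ltW d0)//; lra.
have rc0 : 0 < r `^ c by rewrite powR_gt0.
have rcr : r `^ c <= r by rewrite ler1_powR.
rewrite powRN ler_pdivlMr//.
have [r2|r2] := leP r 2.
  have := @reskern_pre c m r p 1 hc m0 r0 hp ler01; rewrite !mul1r => /(_ (one_sub_ratio_ge1 hc r1 ppi)) h.
  apply: (@le_trans _ _ (2 * ((dd * m)^-1 + dd^-1) * 2)).
    by rewrite ler_pM ?cabs_ge0 ?(ltW rc0) ?(le_trans rcr)//; rewrite (le_trans h)// ler_wpM2r ?addr_ge0.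
  by rewrite /resK; lra.
have n0 : 1 - cpow 1 r p != 0 by rewrite one_sub_neq0// ltW.
have hp' : 0 <= p <= th by rewrite (ltW p0).
have hc' : 0 <= c <= 1 by rewrite (ltW c0).
have h1 := unit_itv (erefl (1 : R)).
have low1 : dd * r `^ c <= cabs (cpow c r p + m%:C).
  apply: le_trans (cpow_lower hc' (ltW r0) (ltW m0) hp').
  by rewrite ler_wpM2l ?(ltW d0)// lerDl ltW.
have low2 : dd * r <= cabs (cpow 1 r p + 1).
  apply: le_trans (cpow_lower h1 (ltW r0) (@ler01 R) hp').
  by rewrite ler_wpM2l ?(ltW d0)// powRr1 ?lerDl// ltW.
have low3 : r / 2 <= cabs (1 - cpow 1 r p).
  have : cabs (cpow 1 r p) <= cabs (1 - cpow 1 r p) + cabs 1.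
    by rewrite -(cabsN (1 - _)) opprB; apply: le_trans (cabsD _ _); rewrite subrK.
  by rewrite cabs_cpow powRr1 ?(ltW r0)// cabs1; lra.
have pos1 : 0 < dd * r `^ c by rewrite mulr_gt0.
have pos2 : 0 < dd * r by rewrite mulr_gt0.
have pos3 : 0 < r / 2 by rewrite divr_gt0.
have n1 : cpow c r p + m%:C != 0 by rewrite -cabs_gt0 (lt_le_trans pos1).
have n2 : cpow 1 r p + 1 != 0 by rewrite -cabs_gt0 (lt_le_trans pos2).
(* Over the common denominator the terms [z^(1+c)] cancel, and the numerator is only of order [r].
   This is where the decay [r^(-c)] comes from. *)
have -> : reskern c m r p = cpow 1 r p * ((1 - m%:C) + (1 + m%:C) * cpow 1 r p - 2 * cpow c r p)
    * (1 - cpow 1 r p)^-1 * (cpow c r p + m%:C)^-1 * (cpow 1 r p + 1)^-1.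
  by rewrite /reskern; field; rewrite n0 n1 n2.
rewrite 4!cabsM !cabsV cabs_cpow powRr1 ?(ltW r0)//.
have num : cabs (1 - m%:C + (1 + m%:C) * cpow 1 r p - 2 * cpow c r p) <= (2 * m + 4) * r.
  apply: (le_trans (cabsB _ _)); apply: (@le_trans _ _ ((1 + m) + (1 + m) * r + 2 * r)).
    apply: lerD.
      apply: (le_trans (cabsD _ _)); apply: lerD.
        by apply: (le_trans (cabsB _ _)); rewrite cabs1 cabs_real gtr0_norm.
      rewrite cabsM cabs_cpow powRr1 ?(ltW r0)// ler_wpM2r ?(ltW r0)//.
      by apply: (le_trans (cabsD _ _)); rewrite cabs1 cabs_real gtr0_norm.
    rewrite cabsM cabs_cpow ler_pM ?cabs_ge0 ?(ltW rc0)//.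
    by have := cabsD (1 : R[i]) 1; rewrite !cabs1.
  have : (1 + m) * 1 <= (1 + m) * r by rewrite ler_wpM2l//; clear - m0; lra.
  by rewrite mulr1 !mulrDl; clear; lra.
have inv1 : (cabs (cpow c r p + m%:C))^-1 <= (dd * r `^ c)^-1.
  by rewrite lef_pV2 ?posrE ?(lt_le_trans pos1).
have inv2 : (cabs (cpow 1 r p + 1))^-1 <= (dd * r)^-1.
  by rewrite lef_pV2 ?posrE ?(lt_le_trans pos2).
have inv3 : (cabs (1 - cpow 1 r p))^-1 <= (r / 2)^-1.
  by rewrite lef_pV2 ?posrE ?(lt_le_trans pos3).
apply: (@le_trans _ _ (r * ((2 * m + 4) * r) * (r / 2)^-1 * (dd * r `^ c)^-1 * (dd * r)^-1 * r `^ c)).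
  rewrite ler_wpM2r ?(ltW rc0)//.
  repeat apply: ler_pM => //; rewrite ?mulr_ge0 ?invr_ge0 ?cabs_ge0 ?(ltW r0)//.
rewrite [leLHS](_ : _ = (4 * m + 8) / dd ^+ 2); last first.
  by field; rewrite !gt_eqF.
by rewrite /resK lerDr mulr_ge0// addr_ge0.
Qed.

(** The integral is unchanged when the ray is turned down towards the positive axis, where the
    kernel is real. The bounds do not depend on the angle, so dominated convergence gives 0 in the
    limit. *)
Lemma reskern_integral c m : 0 < c <= 1 -> 0 < m ->
  integ I0 (fun r => complex.Im (reskern c m r th) / r) /\
  \int[mu]_(r in I0) (complex.Im (reskern c m r th) / r) = 0.
Proof.
move=> hc m0; have /andP[c0 c1] := hc.
have t0 := @th_gt0 R; have /andP[_ tpi] := @th_itv R.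
pose a n : R := th / n.+2%:R.
have a0 n : 0 < a n by rewrite divr_gt0.
have ath n : a n < th by rewrite ltr_pdivrMr// ltr_pMr// ltr1n.
pose h n r := complex.Im (reskern c m r (a n)) / r.
have bd1 r p : 0 < r <= 1 -> 0 < p <= th -> cabs (reskern c m r p) <= resK c m * r `^ c.
  by move=> *; exact: reskern_le1.
have bd2 r p : 1 <= r -> 0 < p <= th -> cabs (reskern c m r p) <= resK c m * r `^ (- c).
  by move=> *; exact: reskern_ge1.
have inI p : 0 < p <= th -> integ I0 (fun r => complex.Im (reskern c m r p) / r).
  move=> /andP[p0 pth].
  have pF : polar_on (p / 2) ((p + pi) / 2) (reskern c m) by apply: polar_on_reskern => //; lra.
  apply: (polar_integ c0 _ pF); first by apply/andP; split; lra.
    by move=> r hr; apply: bd1; rewrite ?p0.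
  by move=> r hr; apply: bd2; rewrite ?p0.
have it : integ I0 (fun r => complex.Im (reskern c m r th) / r).
  by apply: inI; rewrite t0 lexx.
split => //.
have E n : \int[mu]_(r in I0) h n r = \int[mu]_(r in I0) (complex.Im (reskern c m r th) / r).
  have pF : polar_on (a n / 2) ((th + pi) / 2) (reskern c m).
    by have := a0 n => an0; apply: polar_on_reskern => //; lra.
  apply: (ray_rotation_pow (K := resK c m) c0 _ (ath n) _ pF).
  - by have := a0 n; lra.
  - by lra.
  - by move=> r p hr /andP[ap pt]; apply: bd1 => //; rewrite (lt_le_trans (a0 n) ap).
  - by move=> r p hr /andP[ap pt]; apply: bd2 => //; rewrite (lt_le_trans (a0 n) ap).
(* On the positive axis the formula reads [0 / 0] at [r = 1]; this null set is removed before the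
   pointwise limit is taken. *)
pose J := I0 `\ (1 : R).
have mJ : measurable J by apply: measurableD => //; exact: measurable_set1.
have JE (f : R -> R) : measurable_fun I0 f -> \int[mu]_(r in J) f r = \int[mu]_(r in I0) f r.
  move=> mf; rewrite /Rintegral integral_setD1//.
  by apply/measurable_EFinP; apply: measurable_funS mf => // x [].
pose g r := (4 * resK c m) * (r `^ (c - 1) / (1 + r `^ c) ^+ 2).
have ig : integ J g.
  apply: (@integS _ I0) => //; first by move=> x [].
  by apply: integZ => //; exact: integ_bump.
have mh n : measurable_fun I0 (h n).
  by apply: integ_measurable; apply: inI; rewrite a0 ltW// ath.
have hg n r : J r -> `|h n r| <= g r.
  move=> [/I0P r0 _]; rewrite /h normrM [`|r^-1|]gtr0_norm ?invr_gt0//.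
  apply: (@le_trans _ _ (cabs (reskern c m r (a n)) / r)).
    by rewrite ler_wpM2r ?invr_ge0 ?(ltW r0)// Im_le_cabs.
  have K0 : 0 <= resK c m.
    by rewrite /resK addr_ge0 ?mulr_ge0 ?addr_ge0 ?invr_ge0 ?mulr_ge0 ?exprn_ge0 ?(ltW (@dd_gt0 R)) ?(ltW m0)//; lra.
  have han : 0 < a n <= th by rewrite a0 ltW// ath.
  rewrite /g [4 * _]mulrC -mulrA; have [r1|r1] := leP r 1.
    apply: (@le_trans _ _ (resK c m * r `^ c / r)).
      by rewrite ler_wpM2r ?invr_ge0 ?(ltW r0)// bd1 ?r0.
    by rewrite -mulrA powR_mulV// ler_wpM2l// bump_le1 ?r0.
  apply: (@le_trans _ _ (resK c m * r `^ (- c) / r)).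
    by rewrite ler_wpM2r ?invr_ge0 ?(ltW r0)// bd2 ?(ltW r1).
  by rewrite -mulrA powR_mulV// ler_wpM2l// bump_ge1 ?ltW.
have hc0 r : J r -> h n r @[n --> \oo] --> (0 : R).
  move=> [/I0P r0 /eqP r1].
  have cpw d : ccont (@cpow R d r) 0 by exact: ccont_cder (polar_cpow d 0 r0).2.
  have v0 d : @cpow R d r 0 = (r `^ d)%:C by rewrite /cpow mulr0 cis0 mulr1.
  have cc : ccont (reskern c m r) 0.
    have ccV d l : 0 < l -> ccont (fun p => (cpow d r p + l%:C)^-1) 0.
      move=> l0; apply: ccontV; last by apply: ccontD; [exact: cpw|exact: ccont_cst].
      rewrite v0 -rmorphD/= (inj_eq (@complexI _)) gt_eqF//.
      by rewrite ltr_wpDl// powR_ge0.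
    rewrite /reskern; apply: ccontM; first exact: cpw.
    apply: ccontD; last by apply: ccontN; exact: ccV.
    apply: ccontM; last exact: ccV.
    apply: ccontM.
      by apply: ccontD; [exact: ccont_cst|apply: ccontN; exact: cpw].
    apply: ccontV; last by apply: ccontD; [exact: ccont_cst|apply: ccontN; exact: cpw].
    rewrite v0 powRr1 ?(ltW r0)// -[1](rmorph1 (real_complex R)) -rmorphB/= (inj_eq (@complexI _)).
    by rewrite subr_eq0 eq_sym.
  have ca : a n @[n --> \oo] --> (0 : R).
    rewrite -(mulr0 th); apply: cvgM; first exact: cvg_cst.
    apply/gtr0_cvgV0; first by near=> n; rewrite ltr0n.
    apply/cvgryPge => M; near=> n; apply: (@le_trans _ _ n%:R).
      by near: n; exact: nbhs_infty_ger.
    by rewrite ler_nat -addn2 leq_addr.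
  have ci : complex.Im (reskern c m r (a n)) @[n --> \oo] --> complex.Im (reskern c m r 0).
    exact: (@cvg_comp _ _ _ a (fun p => complex.Im (reskern c m r p)) _ (nbhs (0:R)) _ ca cc.2).
  have z0 : complex.Im (reskern c m r 0) = 0.
    have one : (1 : R[i]) = 1%:C by [].
    rewrite /reskern !v0 one.
    by rewrite -!(rmorphD, rmorphB, rmorphM, fmorphV).
  rewrite -(mul0r r^-1) -z0; apply: cvgM => //.
  exact: cvg_cst.
have mhJ n : measurable_fun J (h n).
  by apply: measurable_funS (mh n) => // x [].
have [_ lim0] := dominated_cvg_Rint mJ mhJ ig hg hc0.
have e0 : \int[mu]_(r in J) (0 : R) = 0 by rewrite /Rintegral integral0.
rewrite e0 in lim0.
have cst_lim : \int[mu]_(r in J) h n r @[n --> \oo] -->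
    \int[mu]_(r in I0) (complex.Im (reskern c m r th) / r).
  by under eq_fun => n do rewrite JE// E; exact: cvg_cst.
exact: cvg_unique cst_lim lim0.
Unshelve. all: by end_near. Qed.

(** Writing [1 + m = (1 - z^c) + (z^c + m)] shows that [(1 + m) / ((1 - z) (z^c + m))] is
    [G(z) + 1 / (1 + z) + 1 / (1 - z)], with [G] the function behind [reskern]. The first term
    integrates to 0, the others to [th] and [pi - th]. *)
Lemma laplace_kernel1 c m : 0 < c <= 1 -> 0 < m ->
  integ I0 (fun r => complex.Im (cis th * ((1 - cpow 1 r th) * (cpow c r th + m%:C))^-1)) /\
  \int[mu]_(r in I0) complex.Im (cis th * ((1 - cpow 1 r th) * (cpow c r th + m%:C))^-1)
  = pi / (1 + m).
Proof.
move=> hc m0; have /andP[c0 c1] := hc.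
have t0 := @th_gt0 R; have /andP[_ tpi] := @th_itv R.
have [i1 e1] := reskern_integral hc m0.
have [|i2 e2] := @arctan_integral _ th; first by rewrite t0.
have [|i3 e3] := @arctan_integral _ (pi - th); first by apply/andP; split; lra.
pose T r := complex.Im (reskern c m r th) / r + (sin th / (r ^+ 2 + 2 * r * cos th + 1) +
  sin (pi - th) / (r ^+ 2 + 2 * r * cos (pi - th) + 1)).
have iT : integ I0 T by apply: integD => //; exact: integD.
have E r : I0 r -> (1 + m)^-1 * T r =
    complex.Im (cis th * ((1 - cpow 1 r th) * (cpow c r th + m%:C))^-1).
  move=> /I0P r0.
  have hth : 0 < th <= th by rewrite t0 lexx.
  have hth' : 0 <= th <= th by rewrite (ltW t0) lexx.
  have n0 := one_sub_neq0 (ltW r0) hth.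
  have hc' : 0 <= c <= 1 by rewrite (ltW c0).
  have h1 := unit_itv (erefl (1 : R)).
  have n1 : cpow c r th + m%:C != 0.
    rewrite -cabs_gt0; apply: lt_le_trans (cpow_lower hc' (ltW r0) (ltW m0) hth').
    by rewrite mulr_gt0 ?dd_gt0// ltr_wpDl// powR_ge0.
  have n2 : cpow 1 r th + 1 != 0.
    rewrite -cabs_gt0; apply: lt_le_trans (cpow_lower h1 (ltW r0) (@ler01 R) hth').
    by rewrite mulr_gt0 ?dd_gt0// ltr_wpDl// powR_ge0.
  have n3 : 1 + m%:C != 0 :> R[i].
    by rewrite -[1](rmorph1 (real_complex R)) -rmorphD/= (inj_eq (@complexI _)) gt_eqF//; clear - m0; lra.
  have Z : cpow 1 r th = r%:C * cis th by rewrite cpow1// ltW.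
  have e : cis th * ((1 - cpow 1 r th) * (cpow c r th + m%:C))^-1 =
      ((1 + m)^-1)%:C * ((r^-1)%:C * reskern c m r th + (cis th / (r%:C * cis th + 1) + cis th / (1 - r%:C * cis th))).
    have rc : r%:C != 0 by rewrite (inj_eq (@complexI _)) gt_eqF.
    have cisE : cis th = cpow 1 r th / r%:C by rewrite Z mulrC mulKf.
    rewrite !fmorphV rmorphD rmorph1/= -Z /reskern cisE.
    by field; rewrite n0 n1 n2 n3 rc.
  rewrite e ImZ ImD ImZ ImD; congr (_ * (_ + (_ + _))).
  - by rewrite mulrC.
  - rewrite ImM ReV ImV !ReD !ImD !ReZ !ImZ/= addr0.
    have := cos2Dsin2 th => cs.
    rewrite (_ : (r * cos th + 1) ^+ 2 + (r * sin th) ^+ 2 = r ^+ 2 + 2 * r * cos th + 1); last first.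
      transitivity (r ^+ 2 * (cos th ^+ 2 + sin th ^+ 2) + 2 * r * cos th + 1); first by ring.
      by rewrite cs mulr1.
    by ring.
  - rewrite ImM ReV ImV !ReD !ImD !ReN !ImN !ReZ !ImZ/= add0r.
    rewrite sinB cosB sinpi cospi !mul0r !mulN1r sub0r opprK addr0.
    have := cos2Dsin2 th => cs.
    rewrite (_ : (1 - r * cos th) ^+ 2 + (- (r * sin th)) ^+ 2 = r ^+ 2 + 2 * r * - cos th + 1); last first.
      transitivity (r ^+ 2 * (cos th ^+ 2 + sin th ^+ 2) - 2 * r * cos th + 1); first by ring.
      by rewrite cs mulr1; ring.
    by ring.
split.
  apply: integ_ext (integZ (1 + m)^-1 _ iT) => //.
rewrite -(eq_Rint E) RintegralZl// mulrC; congr (_ / _).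
transitivity (\int[mu]_(r in I0) (complex.Im (reskern c m r th) / r) +
  \int[mu]_(r in I0) (sin th / (r ^+ 2 + 2 * r * cos th + 1) +
  sin (pi - th) / (r ^+ 2 + 2 * r * cos (pi - th) + 1))).
  by apply: RintegralD => //; exact: integD.
rewrite e1 add0r; transitivity (th + (pi - th)); last by rewrite addrC subrK.
by rewrite -[in RHS]e3 -[X in _ = X + _]e2; exact: RintegralD.
Qed.

End laplace_kernel.

(** * Uniqueness of the Laplace transform *)

Section laplace_uniqueness.
Context {R : realType}.
Notation mu := (@lebesgue_measure R).
Notation I0 := (`](0 : R), +oo[%classic).
Implicit Types (r a b c k l p t u v x m s : R) (h w : R -> R).

Lemma I0_gt0 r : I0 r -> 0 < r.
Proof. by rewrite /= in_itv/= andbT. Qed.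

Lemma der_expN c t : is_derive t 1 (fun t => expR (- (c * t))) (- c * expR (- (c * t))).
Proof.
apply: der_eq (@der_comp _ (@expR R) (fun x => - (c * x)) _ _ _ (is_derive_expR _) (derN (derZ c (der_id t)))) _.
by ring.
Qed.

Lemma cont_expN c t : {for t, continuous (fun t => expR (- (c * t)))}.
Proof. exact: is_derive_continuous (der_expN c t). Qed.

Lemma cont_exp_opp t : {for t, continuous (fun t => expR (- t))}.
Proof.
have := @cont_expN 1 t; rewrite (_ : (fun t => expR (- (1 * t))) = (fun t => expR (- t)))//.
by apply/funext => x; rewrite mul1r.
Qed.

Lemma integ_indic (D A : set R) : measurable D -> measurable A -> (mu A < +oo)%E ->
  integ D (\1_A : R -> R).
Proof.
move=> mD mA fA; apply: ge0_integ => //.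
by rewrite integral_indic// (le_lt_trans _ fA)// measureIl.
Qed.

Lemma itv_finite a b (x y : bool) :
  (mu [set` Interval (BSide x a) (BSide y b)] < +oo)%E.
Proof. by rewrite lebesgue_measure_itv/=; case: ifP => _; rewrite ltry. Qed.

Lemma Rint_indic (D A : set R) : measurable D -> measurable A ->
  \int[mu]_(x in D) (\1_A x : R) = fine (mu (A `&` D)).
Proof. by move=> mD mA; rewrite /Rintegral integral_indic. Qed.

Lemma min_lel a b : Num.min a b <= a. Proof. by rewrite ge_min lexx. Qed.
Lemma min_ler a b : Num.min a b <= b. Proof. by rewrite ge_min lexx orbT. Qed.

Lemma poly_exp_integral w : integ I0 w ->
  (forall n : nat, \int[mu]_(t in I0) (w t * expR (- t) ^+ n) = 0) ->
  forall (p : {poly R}),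
  integ I0 (fun t => w t * p.[expR (- t)]) /\
  \int[mu]_(t in I0) (w t * p.[expR (- t)]) = 0.
Proof.
move=> iw w0 p.
have ik n : integ I0 (fun t => w t * expR (- t) ^+ n).
  apply: (@integ_le _ _ _ (fun t => `|w t|)) => //.
  - apply: measurable_funM; first exact: integ_measurable iw.
    apply: continuous_measurable_0y => t _.
    apply: (@continuous_comp _ _ _ (fun t => expR (- t)) (fun y => y ^+ n)); last exact: exprn_continuous.
    exact: cont_exp_opp.
  - exact: integ_norm.
  - move=> t /I0_gt0 t0; rewrite normrM ler_piMr// normrX exprn_ile1//.
    by rewrite gtr0_norm ?expR_gt0// expR_le1 oppr_le0 ltW.
(* The additional factor [e^(-n t)] makes the recursion [p 'X + c] fit the induction. *)
suff : forall n, integ I0 (fun t => w t * expR (- t) ^+ n * p.[expR (- t)]) /\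
    \int[mu]_(t in I0) (w t * expR (- t) ^+ n * p.[expR (- t)]) = 0.
  move=> /(_ 0%N) [h1 h2]; split.
    by apply: integ_ext h1 => // t _; rewrite expr0 mulr1.
  by rewrite -[RHS]h2; apply: eq_Rint => t _; rewrite expr0 mulr1.
elim/poly_ind: p => [|p c IH] n.
  have E t : I0 t -> 0 = w t * expR (- t) ^+ n * (0 : {poly R}).[expR (- t)].
    by move=> _; rewrite horner0 mulr0.
  split; first by apply: integ_ext E _ => //; exact: integrable0.
  by rewrite -(eq_Rint E) /Rintegral integral0.
have [h1 h2] := IH n.+1.
have E t : I0 t -> w t * expR (- t) ^+ n.+1 * p.[expR (- t)] + c * (w t * expR (- t) ^+ n) =
    w t * expR (- t) ^+ n * (p * 'X + c%:P).[expR (- t)].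
  by move=> _; rewrite hornerD hornerMX hornerC exprS; ring.
have ic : integ I0 (fun t => c * (w t * expR (- t) ^+ n)) by exact: integZ.
split; first by apply: integ_ext E _ => //; exact: integD.
by rewrite -(eq_Rint E) RintegralD// h2 add0r RintegralZl// w0 mulr0.
Qed.

(* The transform vanishes against every polynomial in [expR (- t)], among them
   [(1 + e^2 - (expR (- t) - expR (- t0))^2)^n], which concentrate at [t0]. *)
Lemma lerch_pos h s : (forall t, 0 < t -> {for t, continuous h}) ->
  integ I0 (fun t => expR (- (s * t)) * h t) ->
  (forall n : nat, \int[mu]_(t in I0) (expR (- ((s + n%:R) * t)) * h t) = 0) ->
  forall t, 0 < t -> h t <= 0.
Proof.
move=> ch iw hn t0 t00; rewrite leNgt; apply/negP => ht0.
pose w t := expR (- (s * t)) * h t.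
have w0 : forall n : nat, \int[mu]_(t in I0) (w t * expR (- t) ^+ n) = 0.
  move=> n; rewrite -[RHS](hn n); apply: eq_Rint => t _.
  by rewrite /w -expRM_natl mulrAC -expRD; congr (expR _ * _); ring.
have cw : {for t0, continuous w}.
  apply: continuousM; last exact: ch.
  exact: cont_expN.
have wt0 : 0 < w t0 by rewrite mulr_gt0 ?expR_gt0.
pose x0 := expR (- t0).
have [d0 /= d00 hd0] : \forall t \near t0, w t0 / 2 < w t.
  by apply: (cvgr_gt _ cw); rewrite ltr_pdivrMr// ltr_pMr// ltr1n.
pose d := Num.min d0 t0 / 2.
have dmin : 0 < Num.min d0 t0 by rewrite lt_min d00.
have dd0 : 0 < d by rewrite divr_gt0.
have dd1 : d < d0 by rewrite /d ltr_pdivrMr// (le_lt_trans (min_lel _ _))// ltr_pMr// ltr1n.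
have dd2 : d < t0 by rewrite /d ltr_pdivrMr// (le_lt_trans (min_ler _ _))// ltr_pMr// ltr1n.
have wd t : `|t - t0| <= d -> w t0 / 2 < w t.
  by move=> ht; apply: hd0; rewrite /= distrC (le_lt_trans ht).
(* The distance of [expR (- t)] from [x0] is at least [e] as soon as [t] is farther than [d] from
   [t0], so that [P <= 1] there. *)
pose e := Num.min (expR (- (t0 - d)) - x0) (x0 - expR (- (t0 + d))).
have e0 : 0 < e.
  by rewrite lt_min /x0 !subr_gt0 !ltr_expR !ltrN2; apply/andP; split; clear - dd0; lra.
have out t : d < `|t - t0| -> e <= `|expR (- t) - x0|.
  rewrite lter_normr => /orP[h1|h1].
    have : expR (- t) <= expR (- (t0 + d)) by rewrite ler_expR lerN2; clear - h1; lra.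
    rewrite ler0_norm ?opprB => [h2|].
      by rewrite (le_trans (min_ler _ _))// lerD2l lerN2.
    by rewrite subr_le0 /x0 ler_expR lerN2; clear - h1 dd0; lra.
  have : expR (- (t0 - d)) <= expR (- t) by rewrite ler_expR lerN2; clear - h1; lra.
  rewrite ger0_norm => [h2|].
    by rewrite (le_trans (min_lel _ _))// lerD2r.
  by rewrite subr_ge0 /x0 ler_expR lerN2; clear - h1 dd0; lra.
have [d' /= d'0 hd'] : \forall t \near t0, `|expR (- t) - x0| < e / 2.
  have := @cont_exp_opp t0 => /cvgrPdist_lt /(_ (e / 2)); rewrite divr_gt0// => /(_ isT).
  by apply: filterS => t; rewrite distrC.
(* A smaller window, on which [expR (- t)] is within [e / 2] of [x0] and [P] exceeds 1 by a fixed
   amount. *)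
pose d2 := Num.min d' d / 2.
have d2min : 0 < Num.min d' d by rewrite lt_min d'0.
have d20 : 0 < d2 by rewrite divr_gt0.
have d21 : d2 < d' by rewrite /d2 ltr_pdivrMr// (le_lt_trans (min_lel _ _))// ltr_pMr// ltr1n.
have d22 : d2 < d by rewrite /d2 ltr_pdivrMr// (le_lt_trans (min_ler _ _))// ltr_pMr// ltr1n.
pose P : {poly R} := (1 + e ^+ 2)%:P - ('X - x0%:P) ^+ 2.
have PE t : P.[expR (- t)] = 1 + e ^+ 2 - (expR (- t) - x0) ^+ 2.
  by rewrite /P hornerD hornerN horner_exp hornerXsubC hornerC.
(* Lower bound of [P] on the small window: [1 + e^2 - (e / 2)^2]. *)
pose q := 1 + e ^+ 2 * (3 / 4).
have q1 : 1 < q by rewrite /q ltrDl mulr_gt0 ?exprn_gt0.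
have sq01 t : 0 < t -> (expR (- t) - x0) ^+ 2 <= 1.
  move=> t1; rewrite -real_normK ?num_real// exprn_ile1// ler_norml.
  have := expR_gt0 (- t); have := expR_gt0 (- t0).
  have h1 : expR (- t) <= 1 by rewrite expR_le1 oppr_le0 ltW.
  have h2 : x0 <= 1 by rewrite expR_le1 oppr_le0 ltW.
  by rewrite -/x0 => h3 h4; apply/andP; split; clear - h1 h2 h3 h4; lra.
have P0 t : 0 < t -> 0 <= P.[expR (- t)].
  by move=> t1; rewrite PE; have := sq01 _ t1; have := sqr_ge0 e; clear; lra.
pose A := `](t0 - d2), (t0 + d2)[%classic : set R.
have muA : fine (mu A) = d2 + d2.
  by rewrite /A lebesgue_measure_itv/= ifT ?lte_fin//=; clear - d20; lra.
have AI : A `<=` I0 by move=> t; rewrite /A/= !in_itv/= andbT => /andP[h1 _]; clear - h1 d22 dd2; lra.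
have mA : measurable A by exact: measurable_itv.
have iA1 : integ I0 (\1_A : R -> R).
  by apply: integ_indic => //; exact: itv_finite.
have key n : w t0 / 2 * q ^+ n * (d2 + d2) <= \int[mu]_(t in I0) `|w t|.
  have [iP eP] := poly_exp_integral iw w0 (P ^+ n).
  have iA : integ I0 (fun t => (w t0 / 2 * q ^+ n) * \1_A t).
    by apply: integZ => //; exact: iA1.
  (* The summand [|w|] compensates the possible negative values of [w P^n] farther than [d] from
     [t0], where [0 <= P <= 1]; within distance [d] both [w] and [P] are nonnegative. *)
  have le1 : \int[mu]_(t in I0) ((w t0 / 2 * q ^+ n) * \1_A t) <=
      \int[mu]_(t in I0) (`|w t| + w t * (P ^+ n).[expR (- t)]).
    apply: le_Rintegral => //.
      by apply: integD => //; exact: integ_norm.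
    move=> t /I0_gt0 t1; rewrite horner_exp indicE.
    have [tA|tA] := boolP (t \in A).
      rewrite mulr1 -[leLHS]add0r lerD//.
      have h1 : `|t - t0| < d2.
        by move: tA; rewrite inE /A/= in_itv/= ltr_norml => /andP[h1 h2]; apply/andP; split; clear - h1 h2; lra.
      have h2 : w t0 / 2 < w t by apply/wd/ltW/(lt_trans h1).
      have h3 : `|expR (- t) - x0| < e / 2 by apply: hd'; rewrite /= distrC (lt_trans h1).
      apply: ler_pM; rewrite ?exprn_ge0 ?(ltW h2) ?divr_ge0 ?(ltW wt0) ?(ltW (lt_trans ltr01 q1))//.
      rewrite lerXn2r ?nnegrE ?(ltW (lt_trans ltr01 q1)) ?P0//.
      rewrite PE /q; have : (expR (- t) - x0) ^+ 2 <= (e / 2) ^+ 2.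
        by rewrite -real_normK ?num_real// lerXn2r ?nnegrE ?divr_ge0 ?(ltW e0) ?(ltW h3).
      by rewrite exprMn; clear; lra.
    rewrite mulr0; have [h1|h1] := leP `|t - t0| d.
      rewrite addr_ge0// mulr_ge0 ?exprn_ge0 ?P0//.
      by apply/ltW/(lt_trans _ (wd _ h1)); rewrite divr_gt0.
    have h2 := out _ h1.
    have h3 : P.[expR (- t)] <= 1.
      rewrite PE; suff : e ^+ 2 <= (expR (- t) - x0) ^+ 2 by clear; lra.
      by rewrite -[leRHS]real_normK ?num_real// lerXn2r ?nnegrE ?(ltW e0).
    have h4 : `|w t * P.[expR (- t)] ^+ n| <= `|w t|.
      by rewrite normrM ler_piMr// ger0_norm ?exprn_ge0 ?P0// exprn_ile1 ?P0.
    have := ler_norm (- (w t * P.[expR (- t)] ^+ n)); rewrite normrN.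
    by move: h4; clear; lra.
  move: le1; rewrite RintegralD//; last exact: integ_norm.
  rewrite eP addr0; apply: le_trans.
  rewrite RintegralZl// ler_wpM2l ?mulr_ge0 ?exprn_ge0 ?(ltW (lt_trans ltr01 q1))//; first exact: ltW.
  by rewrite Rint_indic// setIidl// muA.
(* Bernoulli's inequality makes [q^n] exceed every bound, against [key]. *)
have [n hn'] : exists n : nat, \int[mu]_(t in I0) `|w t| < w t0 / 2 * q ^+ n * (d2 + d2).
  have c0 : 0 < w t0 / 2 * (d2 + d2) by rewrite mulr_gt0 ?divr_gt0 ?addr_gt0.
  pose M := \int[mu]_(t in I0) `|w t|.
  have qn n : 1 + (q - 1) *+ n <= q ^+ n.
    elim: n => [|n IH]; first by rewrite mulr0n addr0 expr0.
    have q0 : 0 <= q - 1 by rewrite subr_ge0 ltW.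
    rewrite exprS -{2}(subrK 1 q) mulrDl mul1r mulrS.
    have : (q - 1) <= (q - 1) * q ^+ n by rewrite ler_peMr// exprn_ege1// ltW.
    by move: IH; clear; lra.
  exists (Num.bound (M / (w t0 / 2 * (d2 + d2)) / (q - 1))).
  set N := Num.bound _.
  have hN : M / (w t0 / 2 * (d2 + d2)) / (q - 1) < N%:R.
    by apply: archi_boundP; rewrite divr_ge0 ?divr_ge0 ?(ltW c0) ?Rintegral_ge0// subr_ge0 ltW.
  have h5 : M < N%:R * (q - 1) * (w t0 / 2 * (d2 + d2)).
    by rewrite -ltr_pdivrMr// -ltr_pdivrMr ?subr_gt0.
  rewrite mulrAC; apply: (lt_le_trans h5); rewrite mulrC ler_pM2l//.
  by apply: le_trans (qn N); rewrite mulr_natl lerDr.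
by have := lt_le_trans hn' (key n); rewrite ltxx.
Qed.

Lemma lerch h s : (forall t, 0 < t -> {for t, continuous h}) ->
  integ I0 (fun t => expR (- (s * t)) * h t) ->
  (forall n : nat, \int[mu]_(t in I0) (expR (- ((s + n%:R) * t)) * h t) = 0) ->
  forall t, 0 < t -> h t = 0.
Proof.
move=> ch iw hn t t0; apply/eqP; rewrite eq_le (lerch_pos ch iw hn t0)/=.
rewrite -oppr_le0; apply: (@lerch_pos (fun t => - h t) s _ _ _ t t0).
- by move=> x x0; apply: continuousN; exact: ch.
- by apply: integ_ext (integN _ iw) => // x _; rewrite mulrN.
- move=> n; transitivity (-1 * \int[mu]_(t in I0) (expR (- ((s + n%:R) * t)) * h t)); last by rewrite hn mulr0.
  rewrite -RintegralZl//.
    by apply: eq_Rint => x _; rewrite mulN1r mulrN.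
  apply: (@integ_le _ _ _ (fun t => `|expR (- (s * t)) * h t|)) => //.
  + apply: continuous_measurable_0y => x x0; apply: continuousM; last exact: ch.
    exact: cont_expN.
  + exact: integ_norm.
  + move=> x /I0_gt0 x0; rewrite !normrM ler_wpM2r// !gtr0_norm ?expR_gt0//.
    by rewrite ler_expR lerN2 ler_wpM2r ?(ltW x0)// lerDl.
Qed.

Lemma integ_restrict (D : set R) h : measurable D -> integ D h -> integ setT (h \_ D).
Proof.
move=> mD ih; have /(integrable_mkcond _ (mR mD)) := ih.
by rewrite restrict_EFin.
Qed.

Lemma Rint_restrict (D : set R) h : \int[mu]_(x in D) h x = \int[mu]_x (h \_ D) x.
Proof. exact: Rintegral_mkcond. Qed.

(** Tonelli and the majorant [B] give integrability on the plane. Sections are assumed integrable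
    everywhere, so that the real inner integrals agree with the extended ones at every point and not
    just almost everywhere. *)
Lemma fubini_real (f : measurableTypeR R * measurableTypeR R -> R) (B : R -> R) :
  measurable_fun setT f ->
  (forall y, integ setT (fun x => f (x, y))) ->
  (forall y, \int[mu]_x `|f (x, y)| <= B y) -> integ setT B ->
  (forall x, integ setT (fun y => f (x, y))) ->
  integ setT (fun x => \int[mu]_y f (x, y)) /\
  \int[mu]_x \int[mu]_y f (x, y) = \int[mu]_y \int[mu]_x f (x, y).
Proof.
move=> mf ix fB iB iy.
pose g := EFin \o f.
have mg : measurable_fun setT g by exact/measurable_EFinP.
have ig : (mu \x mu)%E.-integrable setT g.
  apply/(integrable21ltyP _ _ mg).
  have /integrableP[mB] := iB; apply: le_lt_trans.
  apply: ge0_le_integral => //.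
  - by move=> y _; exact: integral_ge0.
  - apply: (measurable_fun_fubini_tonelli_G (abse \o g)) => //=.
    exact: measurableT_comp.
  - exact: measurableT_comp.
  move=> y _.
  have /integ_norm ixy := ix y.
  rewrite [leLHS](_ : _ = (\int[mu]_x `|f (x, y)|)%:E).
    by rewrite /= lee_fin (le_trans (fB y))// ler_norm.
  by rewrite /Rintegral fineK//; apply: integrable_fin_num => //; exact: ixy.
have FE : fubini_F mu g = EFin \o (fun x => \int[mu]_y f (x, y)).
  apply/funext => x; rewrite /fubini_F /= /Rintegral fineK//.
  by apply: integrable_fin_num => //; exact: iy.
have GE : fubini_G mu g = EFin \o (fun y => \int[mu]_x f (x, y)).
  apply/funext => y; rewrite /fubini_G /= /Rintegral fineK//.
  by apply: integrable_fin_num => //; exact: ix.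
split; first by have := integrable_fubini_F ig; rewrite FE.
have := integral12_prod_meas1 ig; rewrite -(integral21_prod_meas1 ig) FE GE.
by rewrite /Rintegral => ->.
Qed.

Lemma conv_integral (K F : R -> R) : integ setT K -> integ setT F ->
  (forall t, integ setT (fun x => K (t - x) * F x)) ->
  integ setT (fun t => \int[mu]_x (K (t - x) * F x)) /\
  \int[mu]_t \int[mu]_x (K (t - x) * F x) = \int[mu]_t K t * \int[mu]_x F x.
Proof.
move=> iK iF iKF.
have mK := integ_measurable iK; have mF := integ_measurable iF.
pose f (z : measurableTypeR R * measurableTypeR R) := K (z.1 - z.2) * F z.2.
have mf : measurable_fun setT f.
  apply: measurable_funM; last by apply: measurableT_comp => //; exact: measurable_snd.
  apply: measurableT_comp => //; apply: measurable_funB; first exact: measurable_fst.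
  exact: measurable_snd.
have shift (g : R -> R) y : integ setT g -> integ setT (fun t => g (t - y)) /\
    \int[mu]_t g (t - y) = \int[mu]_t g t.
  move=> ig; have := integ_affine (- y) ltr01 measurableT ig.
  have := Rint_affine (- y) ltr01 measurableT ig.
  rewrite mul1r (_ : [set x : R | setT (1 * x - y)] = setT); last by apply/seteqP; split.
  have -> : (fun x : R => g (1 * x - y)) = (fun x => g (x - y)).
    by apply/funext => x; rewrite mul1r.
  by move=> -> ->.
have ix y : integ setT (fun x => f (x, y)).
  rewrite /f /=; apply: integ_ext (integZ (F y) measurableT (shift _ y iK).1) => //.
  by move=> x _; rewrite mulrC.
have fB y : \int[mu]_x `|f (x, y)| <= (\int[mu]_x `|K x|) * `|F y|.
  have [i1 i2] := shift (fun x => `|K x|) y (integ_norm measurableT iK).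
  rewrite /f /= -i2 mulrC -RintegralZl//.
  rewrite le_eqVlt; apply/orP; left; apply/eqP; apply: eq_Rint => x _.
  by rewrite normrM mulrC.
have iB : integ setT (fun y => (\int[mu]_x `|K x|) * `|F y|).
  by apply: integZ => //; exact: integ_norm.
have [h1 h2] := fubini_real mf ix fB iB iKF.
split; first exact: h1.
rewrite h2 -[RHS](RintegralZl _ _ iF)//; apply: eq_Rint => y _.
have [k1 k2] := shift _ y iK.
by rewrite /f /= (RintegralZr _ _ k1)// k2.
Qed.

(** The weight factorises as [e^(-s (t - x)) e^(-s x)]; once extended by 0 off the half-line, the
    weighted functions form a convolution on the whole line. *)
Lemma laplace_conv s (k e : R -> R) :
  integ I0 (fun t => expR (- (s * t)) * k t) ->
  integ I0 (fun t => expR (- (s * t)) * e t) ->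
  (forall t, 0 < t -> integ `]0, t[ (fun x => k (t - x) * e x)) ->
  integ I0 (fun t => expR (- (s * t)) * \int[mu]_(x in `]0, t[) (k (t - x) * e x)) /\
  \int[mu]_(t in I0) (expR (- (s * t)) * \int[mu]_(x in `]0, t[) (k (t - x) * e x)) =
  (\int[mu]_(t in I0) (expR (- (s * t)) * k t)) *
  \int[mu]_(t in I0) (expR (- (s * t)) * e t).
Proof.
move=> ik ie ike.
pose K := (fun t => expR (- (s * t)) * k t) \_ I0.
pose F := (fun t => expR (- (s * t)) * e t) \_ I0.
pose g t := expR (- (s * t)) * \int[mu]_(x in `]0, t[) (k (t - x) * e x).
have E t : (fun x => K (t - x) * F x) =
    (fun x => expR (- (s * t)) * (k (t - x) * e x)) \_ `]0, t[.
  apply/funext => x; rewrite /K /F !patchE.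
  have I0E y : (y \in I0) = (0 < y).
    by apply/idP/idP; [rewrite inE => /I0_gt0|move=> ?; rewrite inE /= in_itv/= andbT].
  have -> : (x \in `]0, t[%classic) = (0 < x) && (0 < t - x).
    by rewrite subr_gt0; apply/idP/idP; rewrite ?inE /= in_itv.
  rewrite !I0E; case: (0 < x) => /=; last by rewrite -[point]/(0 : R) mulr0.
  case: (0 < t - x) => /=; last by rewrite -[point]/(0 : R) mul0r.
  transitivity ((expR (- (s * (t - x))) * expR (- (s * x))) * (k (t - x) * e x)); first by ring.
  by rewrite -expRD; congr (expR _ * _); ring.
have t0P t : ~~ (0 < t) -> `]0, t[%classic = set0.
  by move=> t0; rewrite set_itv_ge// bnd_simp.
have iKF t : integ setT (fun x => K (t - x) * F x).
  rewrite E; apply: integ_restrict => //; apply: integZ => //.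
  have [t0|t0] := boolP (0 < t); first exact: ike.
  by rewrite t0P//; exact: integrable_set0.
have GE : (fun t => \int[mu]_x (K (t - x) * F x)) = g \_ I0.
  apply/funext => t; rewrite E -Rint_restrict patchE.
  case: ifPn => tI.
    rewrite /g RintegralZl//; apply: ike.
    by move: tI; rewrite inE => /I0_gt0.
  rewrite t0P ?Rintegral_set0//; apply: contra tI => t0.
  by rewrite inE /= in_itv/= andbT.
have [h1 h2] := conv_integral (integ_restrict (measurable_itv _) ik) (integ_restrict (measurable_itv _) ie) iKF.
split.
  have := h1; rewrite GE => h3; apply/(integrable_mkcond _ (mR (measurable_itv _))).
  by rewrite restrict_EFin.
by rewrite Rint_restrict -/g -GE h2 -!Rint_restrict.
Qed.

End laplace_uniqueness.

(** * The Mittag-Leffler function *)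

Section ml_function.
Context {R : realType}.
Notation mu := (@lebesgue_measure R).
Notation I0 := (`](0 : R), +oo[%classic).
Notation th := (@th R).
Notation dd := (@dd R).
Notation kap := (@kap R).
Implicit Types (r a b c k l p q t u v x y m s : R).

Lemma I0_scale (f : R -> R) a : 0 < a -> integ I0 f ->
  integ I0 (fun r => f (a * r)) /\
  \int[mu]_(r in I0) f r = a * \int[mu]_(r in I0) f (a * r).
Proof.
move=> a0 fi.
have e : [set x : R | I0 (a * x + 0)] = I0.
  by apply/seteqP; split => x; rewrite /= !in_itv/= !andbT addr0 pmulr_rgt0.
have e2 : (fun x : R => f (a * x + 0)) = (fun x => f (a * x)).
  by apply/funext => x; rewrite addr0.
have h1 := integ_affine 0 a0 (measurable_itv _) fi.
have h2 := Rint_affine 0 a0 (measurable_itv _) fi.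
by move: h1 h2; rewrite e e2.
Qed.

(** Real form of the transform of a complex exponential; it evaluates the integral in time of the
    ray kernel in the proof of [mlf_laplace]. *)
Lemma exp_trig_integral a b A B : 0 < a ->
  integ I0 (fun t => expR (- (a * t)) * (A * sin (b * t) + B * cos (b * t))) /\
  \int[mu]_(t in I0) (expR (- (a * t)) * (A * sin (b * t) + B * cos (b * t))) =
  (A * b + B * a) / (a ^+ 2 + b ^+ 2).
Proof.
move=> a0.
have n0 : a ^+ 2 + b ^+ 2 != 0 by rewrite gt_eqF// ltr_wpDr ?sqr_ge0// exprn_gt0.
have ds t : is_derive t 1 (fun t => sin (b * t)) (b * cos (b * t)).
  apply: der_eq (@der_comp _ (@sin R) _ _ _ _ (is_derive_sin _) (derZ b (der_id t))) _.
  by ring.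
have dc t : is_derive t 1 (fun t => cos (b * t)) (- b * sin (b * t)).
  apply: der_eq (@der_comp _ (@cos R) _ _ _ _ (is_derive_cos _) (derZ b (der_id t))) _.
  by ring.
pose G t := (A * a - B * b) * sin (b * t) + (A * b + B * a) * cos (b * t).
pose F t := - (a ^+ 2 + b ^+ 2)^-1 * (expR (- (a * t)) * G t).
pose f t := expR (- (a * t)) * (A * sin (b * t) + B * cos (b * t)).
have dF t : is_derive t 1 F (f t).
  apply: der_eq (derZ (- (a ^+ 2 + b ^+ 2)^-1) (derM (der_expN a t)
    (derD (derZ (A * a - B * b) (ds t)) (derZ (A * b + B * a) (dc t))))) _.
  by rewrite /f; field.
have cf t : {for t, continuous f}.
  exact: is_derive_continuous (derM (der_expN a t) (derD (derZ A (ds t)) (derZ B (dc t)))).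
have fi : integ I0 f.
  apply: (@integ_le _ _ _ (fun t => (`|A| + `|B|) * expR (- (a * t)))) => //.
  - by apply: continuous_measurable_0y => t _.
  - by apply: integZ => //; exact: (Rint_expN a0).1.
  - move=> t _; rewrite normrM mulrC (gtr0_norm (expR_gt0 _)).
    rewrite ler_wpM2r ?expR_ge0//.
    rewrite (le_trans (ler_normD _ _))// lerD// normrM ler_piMr//.
      exact: sin_max.
    exact: cos_max.
split; first exact: fi.
rewrite (Rint_FTC (fun t _ => dF t) (fun t _ => cf t) fi (l0 := F 0) (l1 := 0)).
- by rewrite sub0r /F /G !mulr0 oppr0 expR0 sin0 cos0; field.
- by have /cvg_at_right_filter := is_derive_continuous (dF 0).
- pose M := `|(a ^+ 2 + b ^+ 2)^-1| * (`|A * a - B * b| + `|A * b + B * a|).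
  have ce : M * expR (- (a * t)) @[t --> +oo] --> 0.
    rewrite -(mulr0 M); apply: cvgM; first exact: cvg_cst.
    apply: (@cvg_comp _ _ _ (fun x => a * x) (fun y => expR (- y)) _ (pinfty_nbhs R)).
      exact: gt0_cvgMry.
    exact: cvgr_expR.
  apply: norm_cvg0; apply: (@squeeze_cvgr _ _ _ _ (cst 0) (fun t => M * expR (- (a * t)))) => //.
    apply: nearW => t; rewrite normr_ge0/= /F normrM normrN /M -mulrA ler_wpM2l//.
    rewrite normrM mulrC (gtr0_norm (expR_gt0 _)) ler_wpM2r ?expR_ge0//.
    rewrite (le_trans (ler_normD _ _))// lerD// normrM ler_piMr//.
      exact: sin_max.
    exact: cos_max.
  exact: cvg_cst.
Qed.

(** [cis th] is [dz / dr]. The conjugate ray, run in the opposite direction, contributes minus the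
    conjugate, so the factor [1 / (2 pi i)] leaves [1 / pi] times the imaginary part. *)
Definition mlq c l t r : R := complex.Im (cis th * cexp t r th * (cpow c r th + l%:C)^-1).

(* The Bromwich integral of [1 / (z^c + l)] along the ray of angle [th] and its
   conjugate: [mlf c l t = t^(c-1) E_(c,c) (- l t^c)]. *)
Definition mlf c l t : R := pi^-1 * \int[mu]_(r in I0) mlq c l t r.

Section fixed.
Variables (c l : R).
Hypotheses (c01 : 0 < c <= 1) (l0 : 0 < l).

Let c0 : 0 < c. Proof. by have /andP[] := c01. Qed.
Let c1 : c <= 1. Proof. by have /andP[] := c01. Qed.

Lemma cexp_th t r : cabs (cexp t r th) = expR (- (kap * t * r)).
Proof. by rewrite cabs_cexp /kap; congr expR; ring. Qed.

Lemma den_lower r : 0 <= r -> dd * (r `^ c + l) <= cabs (cpow c r th + l%:C).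
Proof.
move=> r0; apply: cpow_lower; rewrite ?(ltW c0) ?(ltW l0)//.
by rewrite (ltW (@th_gt0 R)) lexx.
Qed.

Lemma den_gt0 r : 0 < dd * (r `^ c + l).
Proof. by rewrite mulr_gt0 ?dd_gt0// ltr_wpDl ?powR_ge0. Qed.

Lemma den_neq0 r : 0 <= r -> cpow c r th + l%:C != 0.
Proof. by move=> r0; rewrite -cabs_gt0 (lt_le_trans (den_gt0 r))// den_lower. Qed.

Lemma cabs_denV r : 0 <= r -> cabs (cpow c r th + l%:C)^-1 <= (dd * (r `^ c + l))^-1.
Proof.
move=> r0; have h := den_lower r0; have h0 := den_gt0 r.
by rewrite cabsV lef_pV2 ?posrE// (lt_le_trans h0).
Qed.

Lemma mlq_bound t r : 0 <= r ->
  `|mlq c l t r| <= expR (- (kap * t * r)) * (dd * (r `^ c + l))^-1.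
Proof.
move=> r0; rewrite (le_trans (Im_le_cabs _))// 2!cabsM cabs_cis mul1r cexp_th.
by rewrite ler_wpM2l ?expR_ge0// cabs_denV.
Qed.

Lemma mlq_bound_l t r : 0 <= r ->
  `|mlq c l t r| <= (dd * l)^-1 * expR (- (kap * t * r)).
Proof.
move=> r0; rewrite mulrC (le_trans (mlq_bound t r0))// ler_wpM2l ?expR_ge0//.
rewrite lef_pV2 ?posrE ?den_gt0 ?mulr_gt0 ?dd_gt0//.
by rewrite ler_wpM2l ?(ltW (@dd_gt0 R))// lerDr powR_ge0.
Qed.

Lemma ccont_den r : 0 < r -> ccont (fun r => (cpow c r th + l%:C)^-1) r.
Proof.
move=> r0; apply: (ccontV (den_neq0 (ltW r0))); apply: ccontD; last exact: ccont_cst.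
exact: ccont_cder (polar_cpow c th r0).1.
Qed.

Lemma mlq_cont t r : 0 < r -> {for r, continuous (mlq c l t)}.
Proof.
move=> r0; suff : ccont (fun r => cis th * cexp t r th * (cpow c r th + l%:C)^-1) r by case.
apply: ccontM; last exact: ccont_den.
by apply: ccontM; [exact: ccont_cst|exact: ccont_cder (polar_cexp t th r0).1].
Qed.

Lemma mlq_measurable t : measurable_fun I0 (mlq c l t).
Proof. by apply: continuous_measurable_0y => r r0; exact: mlq_cont. Qed.

Lemma kap_t_gt0 t : 0 < t -> 0 < kap * t.
Proof. by move=> t0; rewrite mulr_gt0// kap_gt0. Qed.

Lemma mlq_integ t : 0 < t -> integ I0 (mlq c l t).
Proof.
move=> t0; apply: (@integ_le _ _ _ (fun r => (dd * l)^-1 * expR (- (kap * t * r)))) => //.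
- exact: mlq_measurable.
- by apply: integZ => //; exact: (Rint_expN (kap_t_gt0 t0)).1.
- by move=> r /I0P r0; exact: mlq_bound_l (ltW r0).
Qed.

(** The factor [l] comes from [|z^c + l| >= dd l]. It makes [lam k * mlf] bounded in [k], which
    places the solution in the domain of [A] at positive times for every datum. *)
Lemma mlf_bound t : 0 < t -> l * `|mlf c l t| <= (pi * dd * kap)^-1 / t.
Proof.
move=> t0; rewrite /mlf normrM gtr0_norm ?invr_gt0 ?pi_gt0//.
have h : `|\int[mu]_(r in I0) mlq c l t r| <= (dd * l)^-1 * (kap * t)^-1.
  rewrite -(Rint_expN (kap_t_gt0 t0)).2 -RintegralZl//; last exact: (Rint_expN (kap_t_gt0 t0)).1.
  apply: norm_Rint_le => //.
  - exact: mlq_measurable.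
  - by apply: integZ => //; exact: (Rint_expN (kap_t_gt0 t0)).1.
  - by move=> r /I0P r0; exact: mlq_bound_l (ltW r0).
apply: (@le_trans _ _ (l * (pi^-1 * ((dd * l)^-1 * (kap * t)^-1)))).
  by rewrite ler_pM2l// ler_pM2l ?invr_gt0 ?pi_gt0.
rewrite le_eqVlt; apply/orP; left; apply/eqP.
move: (@dd_gt0 R) (@kap_gt0 R) (@pi_gt0 R); move: dd kap pi => d k p d0 k0' p0.
by field; rewrite !gt_eqF.
Qed.

Lemma expN_lip x y : 0 <= x -> 0 <= y ->
  `|expR (- x) - expR (- y)| <= expR (- Num.min x y) * `|x - y|.
Proof.
wlog xy : x y / x <= y => [h x0 y0|x0 y0].
  case/orP: (le_total x y) => xy; first exact: h xy x0 y0.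
  by rewrite distrC [`|x - y|]distrC minC; exact: h xy y0 x0.
rewrite min_l// distrC.
rewrite ler0_norm ?subr_le0 ?ler_expR ?lerN2// opprB.
rewrite -[in leRHS]opprB normrN ger0_norm ?subr_ge0//.
have := expR_ge1Dx (x - y) => h.
have -> : expR (- y) = expR (- x) * expR (x - y) by rewrite -expRD; congr expR; ring.
by rewrite -{1}(mulr1 (expR (- x))) -mulrBr ler_pM2l ?expR_gt0//; lra.
Qed.

Lemma cexp_lip t t' r : 0 <= r -> 0 < t -> 0 < t' ->
  cabs (cexp t r th - cexp t' r th) <=
  3 * `|t - t'| * (r * expR (- (kap * Num.min t t' * r))).
Proof.
move=> r0 t0 t'0; pose m := Num.min t t'.
have m0 : 0 < m by rewrite lt_min t0.
have e1 u : expR (u * r * cos th) = expR (- (kap * u * r)).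
  by rewrite /kap; congr expR; ring.
have -> : cexp t r th - cexp t' r th =
    (expR (- (kap * t * r)) - expR (- (kap * t' * r)))%:C * cis (t * r * sin th) +
    (expR (- (kap * t' * r)))%:C * (cis (t * r * sin th) - cis (t' * r * sin th)).
  by rewrite /cexp !e1 rmorphB/=; ring.
have k0 := ltW (@kap_gt0 R); have k1 : kap <= 1 by have /andP[_ /ltW] := @kap_itv R.
have kr u : 0 < u -> 0 <= kap * u * r by move=> u0; rewrite !mulr_ge0// ltW.
have emin : Num.min (kap * t * r) (kap * t' * r) = kap * m * r.
  by rewrite /m -minr_pMl// -minr_pMr.
apply: (le_trans (cabsD _ _)); rewrite !cabsM cabs_cis mulr1 !cabs_real.
have h1 := expN_lip (kr t t0) (kr t' t'0).
rewrite emin in h1.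
have h2 : `|kap * t * r - kap * t' * r| <= `|t - t'| * r.
  rewrite -mulrBl -mulrBr !normrM (ger0_norm k0) (ger0_norm r0).
  by rewrite ler_wpM2r// ler_piMl.
have h3 : cabs (cis (t * r * sin th) - cis (t' * r * sin th)) <= 2 * (`|t - t'| * r).
  apply: (le_trans (cis_lip _ _)); rewrite ler_pM2l// -!mulrBl !normrM (ger0_norm r0).
  by rewrite ler_piMr ?mulr_ge0// sin_max.
have h4 : `|expR (- (kap * t' * r))| <= expR (- (kap * m * r)).
  rewrite gtr0_norm ?expR_gt0// ler_expR lerN2 ler_wpM2r// ler_wpM2l//.
  by rewrite /m ge_min lexx orbT.
apply: (@le_trans _ _ (expR (- (kap * m * r)) * (`|t - t'| * r) + expR (- (kap * m * r)) * (2 * (`|t - t'| * r)))).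
  apply: lerD; first by rewrite (le_trans h1)// ler_wpM2l ?expR_ge0.
  by rewrite ler_pM// cabs_ge0.
by rewrite le_eqVlt; apply/orP; left; apply/eqP; ring.
Qed.

(** Half of the exponential absorbs the factor [r]. *)
Lemma rexp_le k r : 0 < k -> 0 <= r ->
  r * expR (- (k * r)) <= 2 / k * expR (- (k / 2 * r)).
Proof.
move=> k0 r0.
have -> : expR (- (k * r)) = expR (- (k / 2 * r)) * expR (- (k / 2 * r)).
  by rewrite -expRD; congr expR; field.
rewrite mulrA ler_wpM2r ?expR_ge0// expRN ler_pdivrMr ?expR_gt0//.
rewrite -ler_pdivrMl ?divr_gt0// invf_div mulrAC -mulrA.
by apply: le_trans (expR_ge1Dx _); rewrite mulrA lerDr.
Qed.

Lemma mlq_lip t t' r : 0 <= r -> 0 < t -> 0 < t' ->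
  `|mlq c l t r - mlq c l t' r| <=
  (dd * l)^-1 * (3 * `|t - t'|) * (2 / (kap * Num.min t t')) *
    expR (- (kap * Num.min t t' / 2 * r)).
Proof.
move=> r0 t0 t'0.
have m0 : 0 < Num.min t t' by rewrite lt_min t0.
have -> : mlq c l t r - mlq c l t' r =
    complex.Im (cis th * (cexp t r th - cexp t' r th) * (cpow c r th + l%:C)^-1).
  by rewrite /mlq -ImN -ImD; congr complex.Im; ring.
rewrite (le_trans (Im_le_cabs _))// 2!cabsM cabs_cis mul1r mulrC -mulrA.
apply: (@le_trans _ _ ((dd * l)^-1 * cabs (cexp t r th - cexp t' r th))).
  rewrite ler_wpM2r ?cabs_ge0// (le_trans (cabs_denV r0))//.
  rewrite lef_pV2 ?posrE ?den_gt0 ?mulr_gt0 ?dd_gt0//.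
  by rewrite ler_wpM2l ?(ltW (@dd_gt0 R))// lerDr powR_ge0.
rewrite -!mulrA ler_wpM2l ?invr_ge0 ?mulr_ge0 ?(ltW (@dd_gt0 R)) ?(ltW l0)//.
apply: (le_trans (cexp_lip r0 t0 t'0)); rewrite -mulrA ler_pM2l// ler_wpM2l//.
have := rexp_le (kap_t_gt0 m0) r0.
by rewrite -!mulrA.
Qed.

(** The constant 12 is 3 from [cexp_lip], 2 from [rexp_le] and 2 from integrating the halved
    exponential. The factor [l] is kept for the continuity of [A u]. *)
Lemma mlf_lip t t' : 0 < t -> 0 < t' ->
  l * `|mlf c l t - mlf c l t'| <=
  12 / (pi * dd * kap ^+ 2) * (`|t - t'| / Num.min t t' ^+ 2).
Proof.
move=> t0 t'0; set m := Num.min t t'.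
have m0 : 0 < m by rewrite lt_min t0.
have k0 : 0 < kap * m / 2 by rewrite divr_gt0 ?kap_t_gt0.
have [ie ee] := Rint_expN k0.
rewrite /mlf -mulrBr -RintegralB//; last 2 first.
  exact: mlq_integ.
  exact: mlq_integ.
rewrite normrM gtr0_norm ?invr_gt0 ?pi_gt0//.
have h : `|\int[mu]_(r in I0) (mlq c l t r - mlq c l t' r)| <=
    (dd * l)^-1 * (3 * `|t - t'|) * (2 / (kap * m)) * (kap * m / 2)^-1.
  rewrite -ee -RintegralZl//; apply: norm_Rint_le => //.
  - by apply: measurable_funB; exact: mlq_measurable.
  - by apply: integZ.
  - by move=> r /I0P r0; exact: mlq_lip (ltW r0) t0 t'0.
apply: (@le_trans _ _ (l * (pi^-1 * ((dd * l)^-1 * (3 * `|t - t'|) * (2 / (kap * m)) * (kap * m / 2)^-1)))).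
  by rewrite ler_pM2l// ler_pM2l ?invr_gt0 ?pi_gt0.
rewrite le_eqVlt; apply/orP; left; apply/eqP.
move: (@dd_gt0 R) (@kap_gt0 R) (@pi_gt0 R); move: dd kap pi => d k p d0 k0' p0.
by field; rewrite !gt_eqF.
Qed.

Lemma mlf_cont t : 0 < t -> {for t, continuous (mlf c l)}.
Proof.
move=> t0; apply/cvgrPdist_le => /= e e0.
pose C := 12 / (pi * dd * kap ^+ 2) / l.
have C0 : 0 < C.
  by rewrite !divr_gt0// !mulr_gt0 ?exprn_gt0 ?pi_gt0 ?dd_gt0 ?kap_gt0.
have n0 : 0 < Num.min (t / 2) (e / (C / (t / 2) ^+ 2)).
  by rewrite lt_min divr_gt0//= divr_gt0// divr_gt0// exprn_gt0// divr_gt0.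
exists (Num.min (t / 2) (e / (C / (t / 2) ^+ 2))) => //= t'.
rewrite /ball_/= lt_min => /andP[h1 h2].
have t't : t / 2 < t' by move: h1; rewrite ltr_norml => /andP[_]; lra.
have t'0 : 0 < t' by apply: lt_trans t't; rewrite divr_gt0.
have := mlf_lip t0 t'0; rewrite -ler_pdivlMl// => h3; apply: (le_trans h3).
have hm : t / 2 <= Num.min t t' by rewrite le_min (ltW t't) andbT; lra.
have m0 : 0 < Num.min t t' by rewrite lt_min t0.
have q0 : 0 < C / (t / 2) ^+ 2 by rewrite divr_gt0// exprn_gt0// divr_gt0.
move: h2; rewrite ltr_pdivlMr// => /ltW h2.
apply: le_trans h2.
rewrite [leLHS](_ : _ = `|t - t'| * (C / Num.min t t' ^+ 2)); last first.
  rewrite /C; move: (@dd_gt0 R) (@kap_gt0 R) (@pi_gt0 R) m0.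
  move: dd kap pi (Num.min t t') => d k p m d0 k0 p0 m0.
  by field; rewrite !gt_eqF.
rewrite ler_wpM2l// ler_pM2l// lef_pV2 ?posrE ?exprn_gt0 ?divr_gt0//.
by rewrite lerXn2r ?nnegrE ?divr_ge0 ?(ltW t0) ?(ltW m0).
Qed.

End fixed.

(** The inequality [r^c + l >= 2 r^(c/2) sqrt l] in the denominator trades decay in [l] for a milder
    singularity: [t^(c/2 - 1)] is integrable at 0, which the bound [1 / t] is not. *)
Lemma mlf_power_bound c : 0 < c <= 1 -> exists2 C, 0 <= C & forall l t, 0 < l -> 0 < t ->
  `|mlf c l t| <= C / Num.sqrt l * t `^ (c / 2 - 1).
Proof.
move=> c01; have /andP[c0 c1] := c01.
have cc : -1 < - (c / 2) by lra.
have iP := integ_pexp cc (@kap_gt0 R).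
pose J := \int[mu]_(r in I0) (r `^ (- (c / 2)) * expR (- (kap * r))).
have J0 : 0 <= J.
  by apply: Rintegral_ge0 => r _; rewrite mulr_ge0 ?powR_ge0 ?expR_ge0.
exists (pi^-1 * (dd * 2)^-1 * J).
  by rewrite !mulr_ge0 ?invr_ge0 ?mulr_ge0 ?pi_ge0 ?(ltW (@dd_gt0 R)).
move=> l t l0 t0; have sl : 0 < Num.sqrt l by rewrite sqrtr_gt0.
have [iS eS] := I0_scale t0 iP.
pose f r := (dd * 2 * Num.sqrt l)^-1 * t `^ (c / 2) * ((t * r) `^ (- (c / 2)) * expR (- (kap * (t * r)))).
have bd r : I0 r -> `|mlq c l t r| <= f r.
  move=> /I0P r0; apply: (le_trans (mlq_bound c01 l0 t (ltW r0))).
  rewrite /f mulrC powRM ?(ltW t0) ?(ltW r0)// !mulrA.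
  rewrite -[kap * t * r]mulrA ler_wpM2r ?expR_ge0//.
  rewrite -[_ * t `^ (c / 2) * t `^ _]mulrA powRN [t `^ _ * _]divff ?mulr1 ?gt_eqF ?powR_gt0//.
  rewrite powRN -invfM lef_pV2 ?posrE ?den_gt0 ?mulr_gt0 ?dd_gt0 ?powR_gt0//.
  rewrite -!mulrA ler_pM2l ?dd_gt0//.
  have e : r `^ c = (r `^ (c / 2)) ^+ 2.
    by rewrite -powR_mulrn ?powR_ge0// -powRrM; congr (_ `^ _); field.
  have e' : l = Num.sqrt l ^+ 2 by rewrite sqr_sqrtr// ltW.
  rewrite e [X in _ <= _ + X]e' -subr_ge0.
  rewrite [X in 0 <= X](_ : _ = (r `^ (c / 2) - Num.sqrt l) ^+ 2); last by ring.
  by rewrite sqr_ge0.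
have if' : integ I0 f by exact: integZ.
have h : `|\int[mu]_(r in I0) mlq c l t r| <= \int[mu]_(r in I0) f r.
  by apply: norm_Rint_le => //; exact: mlq_measurable.
rewrite /mlf normrM gtr0_norm ?invr_gt0 ?pi_gt0//.
have ef : \int[mu]_(r in I0) f r = (dd * 2 * Num.sqrt l)^-1 * t `^ (c / 2) * (J / t).
  rewrite /f RintegralZl//; congr (_ * _).
  by rewrite /J eS mulrAC divff ?mul1r ?gt_eqF.
apply: (@le_trans _ _ (pi^-1 * ((dd * 2 * Num.sqrt l)^-1 * t `^ (c / 2) * (J / t)))).
  by rewrite ler_pM2l ?invr_gt0 ?pi_gt0// -ef.
rewrite -powR_mulV// le_eqVlt; apply/orP; left; apply/eqP.
move: (@dd_gt0 R) (@pi_gt0 R); move: dd pi => d p d0 p0.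
by field; rewrite !gt_eqF.
Qed.

End ml_function.

(** * Laplace transform of the Mittag-Leffler function *)

Section ml_laplace.
Context {R : realType}.
Notation mu := (@lebesgue_measure R).
Notation I0 := (`](0 : R), +oo[%classic).
Notation th := (@th R).
Notation dd := (@dd R).
Notation kap := (@kap R).
Implicit Types (r a b k p q t u v x y m s : R).
Variables (c l : R).
Hypotheses (c01 : 0 < c <= 1) (l0 : 0 < l).

Let c0 : 0 < c. Proof. by have /andP[] := c01. Qed.
Let c1 : c <= 1. Proof. by have /andP[] := c01. Qed.

Lemma Rint0 (D : set R) : \int[mu]_(x in D) (0 : R) = 0.
Proof. by rewrite /Rintegral integral0. Qed.

Lemma RintZ (D : set R) (f : R -> R) k : measurable D -> integ D f ->
  \int[mu]_(x in D) (k * f x) = k * \int[mu]_(x in D) f x.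
Proof. by move=> mD fi; rewrite RintegralZl. Qed.

Lemma mlf_laplace_integ s : 0 < s -> integ I0 (fun t => expR (- (s * t)) * mlf c l t).
Proof.
move=> s0; have cc : -1 < c / 2 - 1 by rewrite -subr_gt0 opprK subrK divr_gt0.
have [C C0 hC] := mlf_power_bound c01.
apply: (integ_le _ _ (integZ (C / Num.sqrt l) _ (integ_pexp cc s0))) => //.
  apply: continuous_measurable_0y => t t0; apply: continuousM.
    exact: cont_expN.
  exact: mlf_cont.
move=> t /I0P t0; rewrite normrM (gtr0_norm (expR_gt0 _)) mulrC mulrA.
by rewrite ler_wpM2r ?expR_ge0// hC.
Qed.

Let cf r : R[i] := cis th * (cpow c r th + l%:C)^-1.
(** [P] and [Q] are the real and imaginary parts of the time-independent factor of the kernel, set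
    to 0 off the half-line so that Fubini's theorem can be used on the whole plane. *)
Let P := (fun r => complex.Re (cf r)) \_ I0.
Let Q := (fun r => complex.Im (cf r)) \_ I0.

Let ccont_cf r : 0 < r -> ccont cf r.
Proof. by move=> r0; apply: ccontM; [exact: ccont_cst|exact: ccont_den]. Qed.

Let mP : measurable_fun setT P.
Proof.
apply/(measurable_restrictT _ _).1 => //.
by apply: continuous_measurable_0y => r /ccont_cf[].
Qed.

Let mQ : measurable_fun setT Q.
Proof.
apply/(measurable_restrictT _ _).1 => //.
by apply: continuous_measurable_0y => r /ccont_cf[].
Qed.

Let P0 r : 0 < r -> P r = complex.Re (cf r).
Proof. by move=> r0; rewrite /P patchE ifT// inE /= in_itv/= r0. Qed.
Let Q0 r : 0 < r -> Q r = complex.Im (cf r).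
Proof. by move=> r0; rewrite /Q patchE ifT// inE /= in_itv/= r0. Qed.
Let PN r : r <= 0 -> P r = 0.
Proof. by move=> r0; rewrite /P patchE ifF//; apply/negP; rewrite inE => /I0P; rewrite ltNge r0. Qed.
Let QN r : r <= 0 -> Q r = 0.
Proof. by move=> r0; rewrite /Q patchE ifF//; apply/negP; rewrite inE => /I0P; rewrite ltNge r0. Qed.

Let mlqE t r : 0 < r -> mlq c l t r =
  expR (- (kap * t * r)) * (P r * sin (t * r * sin th) + Q r * cos (t * r * sin th)).
Proof.
move=> r0; rewrite P0// Q0// /mlq.
have -> : cis th * cexp t r th * (cpow c r th + l%:C)^-1 =
    (expR (- (kap * t * r)))%:C * (cf r * cis (t * r * sin th)).
  have -> : expR (- (kap * t * r)) = expR (t * r * cos th) by rewrite /kap; congr expR; ring.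
  by rewrite /cf /cexp; ring.
by rewrite ImZ ImM.
Qed.

Let pi_mlf t : pi * mlf c l t = \int[mu]_(r in I0) mlq c l t r.
Proof. by rewrite /mlf mulVKf// gt_eqF// pi_gt0. Qed.

(** With [z = s z'] one has [s - z = s (1 - z')] and [z^c + l = s^c (z'^c + l / s^c)], which reduces
    to the kernel of [laplace_kernel1]. The left side is the imaginary part of [cf r / (s - z)]
    written out. *)
Let kernel_scale s r : 0 < s -> 0 < r ->
  (P r * (r * sin th) + Q r * (s + kap * r)) / ((s + kap * r) ^+ 2 + (r * sin th) ^+ 2) =
  (s * s `^ c)^-1 * complex.Im (cis th *
    ((1 - cpow 1 (s^-1 * r) th) * (cpow c (s^-1 * r) th + (l / s `^ c)%:C))^-1).
Proof.
move=> s0 r0; rewrite P0// Q0//.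
have sc : 0 < s `^ c by rewrite powR_gt0.
have sr : 0 <= s^-1 * r by rewrite mulr_ge0 ?invr_ge0 ?(ltW s0) ?(ltW r0).
have n0 : s != 0 by rewrite gt_eqF.
pose D := s%:C * (1 - cpow 1 (s^-1 * r) th).
have reD : complex.Re D = s + kap * r.
  rewrite /D cpow1// ReZ ReD ReN ReZ /kap mulrDr mulrN mulrA mulrA divff// mul1r.
  by rewrite mulr1 mulNr mulrC.
have imD : complex.Im D = - (r * sin th).
  rewrite /D cpow1// ImZ ImD ImN ImZ mulrDr mulrN mulrA mulrA divff// mul1r.
  by rewrite mulr0 add0r.
have e2 : (s `^ c)%:C * (cpow c (s^-1 * r) th + (l / s `^ c)%:C) = cpow c r th + l%:C.
  rewrite mulrDr /cpow mulrA -!rmorphM/= -powRM ?(ltW s0)//.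
  rewrite mulrA divff ?mul1r//; congr (_ + _%:C).
  by rewrite mulrC divfK// gt_eqF.
rewrite -ImZ.
have -> : (s * s `^ c)^-1%:C * (cis th * ((1 - cpow 1 (s^-1 * r) th) * (cpow c (s^-1 * r) th + (l / s `^ c)%:C))^-1)
    = cf r * D^-1.
  rewrite /cf -e2 /D !invfM -!invfM rmorphV ?unitfE ?mulf_neq0 ?(gt_eqF sc)// rmorphM/= !invfM; ring.
rewrite ImM ReV ImV reD imD.
by rewrite opprK sqrrN !mulrA -mulrDl.
Qed.

(** After exchanging the integrals, the one in time turns [e^(t z)] into [1 / (s - z)]. What is left
    is the ray integral of [1 / ((s - z) (z^c + l))], known up to scaling. *)
Lemma mlf_laplace s : 0 < s ->
  \int[mu]_(t in I0) (expR (- (s * t)) * mlf c l t) = (s `^ c + l)^-1.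
Proof.
move=> s0; have k0 := @kap_gt0 R; have d0 := @dd_gt0 R.
pose g t r := expR (- ((s + kap * r) * t)) * (P r * sin (r * sin th * t) + Q r * cos (r * sin th * t)).
pose f (z : measurableTypeR R * measurableTypeR R) := \1_I0 z.1 * g z.1 z.2.
have gE t r : 0 < r -> g t r = expR (- (s * t)) * mlq c l t r.
  move=> r0; rewrite /g mlqE// mulrA -expRD; congr (expR _ * _); first by ring.
  by congr (_ * sin _ + _ * cos _); ring.
have gN t r : r <= 0 -> g t r = 0.
  by move=> r0; rewrite /g PN// QN// !mul0r addr0 mulr0.
have mf : measurable_fun setT f.
  have m1 : measurable_fun setT (fun z : measurableTypeR R * measurableTypeR R => z.1 : R).
    exact: measurable_fst.
  have m2 : measurable_fun setT (fun z : measurableTypeR R * measurableTypeR R => z.2 : R).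
    exact: measurable_snd.
  have ms : measurable_fun setT (fun z : measurableTypeR R * measurableTypeR R => z.2 * sin th * z.1).
    by apply: measurable_funM => //; apply: measurable_funM.
  apply: measurable_funM; first by apply: measurableT_comp => //; exact: measurable_indic.
  apply: measurable_funM.
    apply: measurableT_comp => //; apply: measurableT_comp => //; apply: measurable_funM => //.
    by apply: measurable_funD => //; apply: measurable_funM.
  apply: measurable_funD; apply: measurable_funM.
  - exact: measurableT_comp.
  - by apply: measurableT_comp => //; apply: continuous_measurable_fun; exact: continuous_sin.
  - exact: measurableT_comp.
  - by apply: measurableT_comp => //; apply: continuous_measurable_fun; exact: continuous_cos.
have fE t r : f (t, r) = ((g ^~ r) \_ I0) t 
  by rewrite /f /= patchE indicE; case: (t \in I0); rewrite ?mul1r ?mul0r.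
have fEr t : (fun r => f (t, r)) = (fun r => \1_I0 t * (expR (- (s * t)) * mlq c l t r)) \_ I0.
  apply/funext => r; rewrite patchE /f/=; case: ifPn => rI.
    by move: rI; rewrite inE => /I0P r0; rewrite gE.
  rewrite gN ?mulr0// leNgt; apply: contra rI => r0.
  by rewrite inE /= in_itv/= r0.
have fN t r : r \notin I0 -> f (t, r) = 0.
  move=> rI; rewrite /f/= gN ?mulr0// leNgt; apply: contra rI => r0.
  by rewrite inE /= in_itv/= r0.
have a0 r : 0 < r -> 0 < s + kap * r by move=> r0; rewrite addr_gt0// mulr_gt0.
have it r : 0 < r -> integ I0 (g ^~ r) /\ \int[mu]_(t in I0) g t r =
    (P r * (r * sin th) + Q r * (s + kap * r)) / ((s + kap * r) ^+ 2 + (r * sin th) ^+ 2).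
  by move=> r0; exact: exp_trig_integral (a0 r r0).
have ix r : integ setT (fun t => f (t, r)).
  rewrite (_ : (fun t => f (t, r)) = (g ^~ r) \_ I0); last exact/funext.
  apply: integ_restrict => //; have [r0|r0] := ltP 0 r; first exact: (it r r0).1.
  rewrite (_ : g ^~ r = (fun t => 0 * expR (- (1 * t)))).
    by apply: integZ => //; exact: (Rint_expN ltr01).1.
  by apply/funext => t; rewrite gN// mul0r.
(* The bound on the kernel integrated in [t]: bounded near 0 and of order [r^(-c-1)] at infinity. *)
pose b r := ((s + kap * r) * (dd * (r `^ c + l)))^-1.
have fB r : \int[mu]_t `|f (t, r)| <= (b \_ I0) r.
  rewrite patchE; case: ifPn => rI; last first.
    rewrite le_eqVlt; apply/orP; left; apply/eqP; rewrite -[RHS](Rint0 setT).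
    by apply: eq_Rint => t _; rewrite fN// normr0.
  move: rI; rewrite inE => /I0P r0.
  rewrite [leLHS](_ : _ = \int[mu]_(t in I0) `|g t r|); last first.
    rewrite [RHS]Rint_restrict; apply: eq_Rint => t _; rewrite fE !patchE.
    by case: ifPn => // _; rewrite normr0.
  rewrite /b invfM mulrC -(Rint_expN (a0 r r0)).2 -RintegralZl//; last exact: (Rint_expN (a0 r r0)).1.
  rewrite -[leLHS]ger0_norm; last by apply: Rintegral_ge0 => t _.
  apply: norm_Rint_le => //.
  - by apply: measurableT_comp => //; exact: integ_measurable (it r r0).1.
  - by apply: integZ => //; exact: (Rint_expN (a0 r r0)).1.
  - move=> t /I0P t0; rewrite normr_id gE// normrM (gtr0_norm (expR_gt0 _)).
    have := mlq_bound c01 l0 t (ltW r0) => h.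
    rewrite (le_trans (ler_wpM2l (expR_ge0 _) h))// mulrA -expRD mulrC.
    by rewrite (_ : - (s * t) - kap * t * r = - ((s + kap * r) * t))//; ring.
have iB : integ setT (b \_ I0).
  apply: integ_restrict => //.
  apply: (integ_pow (K := (s * (dd * l))^-1 + (kap * dd)^-1) c0).
  - apply: continuous_measurable_0y => r r0; apply: continuousV.
      by rewrite gt_eqF// mulr_gt0 ?a0// den_gt0.
    apply: continuousM.
      apply: continuousD; first exact: cst_continuous.
      by apply: continuousM; [exact: cst_continuous|exact: (is_derive_continuous (der_id _))].
    apply: continuousM; first exact: cst_continuous.
    by apply: continuousD; [exact: powR_cont|exact: cst_continuous].
  - move=> r /andP[r0 r1]; rewrite gtr0_norm; last by rewrite invr_gt0 mulr_gt0 ?a0// den_gt0.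
    apply: (@le_trans _ _ (s * (dd * l))^-1).
      rewrite /b lef_pV2 ?posrE ?(mulr_gt0 (a0 r r0)) ?den_gt0 ?mulr_gt0//.
      apply: ler_pM; first exact: ltW.
      - by rewrite mulr_ge0 ?ltW.
      - by rewrite lerDl mulr_ge0 ?ltW.
      - by rewrite ler_pM2l// lerDr powR_ge0.
    have s1 : 0 < (s * (dd * l))^-1 by rewrite invr_gt0 mulr_gt0// mulr_gt0.
    have s2 : 0 < (kap * dd)^-1 by rewrite invr_gt0 mulr_gt0.
    rewrite -[leLHS]mulr1; apply: ler_pM; rewrite ?(ltW s1)// ?lerDl ?(ltW s2)//.
    by rewrite -[leLHS](powRr0 r) ger_powR ?subr_le0// r0.
  - move=> r r1; have r0 : 0 < r by apply: lt_le_trans r1.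
    rewrite gtr0_norm; last by rewrite invr_gt0 mulr_gt0 ?a0// den_gt0.
    apply: (@le_trans _ _ ((kap * dd)^-1 * r `^ (- c - 1))); last first.
      by rewrite ler_wpM2r ?powR_ge0// lerDr invr_ge0 ltW// mulr_gt0// mulr_gt0.
    have -> : r `^ (- c - 1) = (r * r `^ c)^-1.
      by rewrite -powR_mulV// powRN invfM mulrC.
    rewrite -invfM /b lef_pV2 ?posrE ?(mulr_gt0 (a0 r r0)) ?den_gt0//; last first.
      by rewrite !mulr_gt0 ?powR_gt0.
    rewrite [leLHS](_ : _ = kap * r * (dd * r `^ c)); last by ring.
    apply: ler_pM; first by rewrite mulr_ge0 ?ltW.
    - by rewrite mulr_ge0 ?powR_ge0 ?ltW.
    - by rewrite lerDr ltW.
    - by rewrite ler_pM2l// lerDl ltW.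
have iy t : integ setT (fun r => f (t, r)).
  rewrite fEr; apply: integ_restrict => //.
  have [t0|t0] := ltP 0 t.
    by apply: integZ => //; apply: integZ => //; exact: mlq_integ.
  rewrite indicE (_ : (t \in I0) = false).
    rewrite (_ : (fun _ => _) = (fun t => 0 * expR (- (1 * t)))).
      by apply: integZ => //; exact: (Rint_expN ltr01).1.
    by apply/funext => r; rewrite !mul0r.
  by apply/negP; rewrite inE => /I0P; rewrite ltNge t0.
have [_ h] := fubini_real mf ix fB iB iy.
have L : \int[mu]_t \int[mu]_r f (t, r) = pi * \int[mu]_(t in I0) (expR (- (s * t)) * mlf c l t).
  rewrite -(RintZ _ (measurable_itv _) (mlf_laplace_integ s0)).
  rewrite [RHS]Rint_restrict; apply: eq_Rint => t _.
  rewrite fEr -Rint_restrict patchE; case: ifPn => tI.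
    rewrite indicE tI.
    move: tI; rewrite inE => /I0P t0; have im := mlq_integ c01 l0 t0.
    rewrite (RintZ _ (measurable_itv _) (integZ (expR (- (s * t))) (measurable_itv _) im)).
    rewrite (RintZ _ (measurable_itv _) im) mul1r mulrCA pi_mlf. by [].
  rewrite -[RHS](Rint0 I0); apply: eq_Rint => r _.
  by rewrite indicE (negbTE tI) mul0r.
(* What [l] becomes under the scaling [r = s r']. *)
pose m := l / s `^ c.
have sc : 0 < s `^ c by rewrite powR_gt0.
have m0 : 0 < m by rewrite divr_gt0.
have [k1 k2] := laplace_kernel1 c01 m0.
have si : 0 < s^-1 by rewrite invr_gt0.
have [k3 k4] := I0_scale si k1.
have Rr : \int[mu]_r \int[mu]_t f (t, r) = (s * s `^ c)^-1 * (s * (pi / (1 + m))).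
  rewrite -k2 k4 (mulVKf (lt0r_neq0 s0)) -(RintZ _ (measurable_itv _) k3) [RHS]Rint_restrict.
  apply: eq_Rint => r _; rewrite patchE; case: ifPn => rI; last first.
    by rewrite -[RHS](Rint0 setT); apply: eq_Rint => t _; exact: fN.
  move: rI; rewrite inE => /I0P r0.
  rewrite [LHS](_ : _ = \int[mu]_(t in I0) g t r); last first.
    by rewrite [RHS]Rint_restrict; apply: eq_Rint => t _; exact: fE.
  by rewrite (it r r0).2; exact: kernel_scale.
apply: (@mulfI _ (pi : R)); first by rewrite gt_eqF ?pi_gt0.
rewrite -L h Rr /m.
move: (@pi_gt0 R) sc; move: pi (s `^ c) => p q p0 q0.
by field; rewrite !gt_eqF ?addr_gt0.
Qed.

End ml_laplace.

(** * Fractional integrals *)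

Section convolution.
Context {R : realType}.
Notation mu := (@lebesgue_measure R).
Notation I0 := (`](0 : R), +oo[%classic).
Implicit Types (r a b k p q t u v x y m s c l : R) (w f g : R -> R).

Lemma integ_opp f : integ setT f -> integ setT (fun x => f (- x)).
Proof.
move=> /integrableP[mf fi].
have mo : measurable_fun setT (-%R : measurableTypeR R -> measurableTypeR R).
  exact: measurable_funN.
apply/integrableP; split.
  by apply/measurable_EFinP; apply: (measurableT_comp _ mo); exact/measurable_EFinP.
rewrite [ltLHS](_ : _ = \int[mu]_x `|(EFin \o f) x|)%E//.
rewrite [RHS](@eq_measure_integral _ _ _ _ (pushforward mu (-%R : measurableTypeR R -> measurableTypeR R)))//.
  rewrite ge0_integral_pushforward//; first exact: measurableT_comp.
by move=> A mA _; exact/esym/lebesgue_measureN.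
Qed.

Lemma itv0P t x : (`]0, t[%classic : set R) x -> 0 < x /\ x < t.
Proof. by rewrite /= in_itv/= => /andP. Qed.

Lemma measurable_0t f t : (forall x, 0 < x -> {for x, continuous f}) ->
  measurable_fun `]0, t[ f.
Proof.
move=> cf; apply: (measurable_funS (E := I0)) => //; last exact: continuous_measurable_0y.
by move=> x /itv0P[x0 _]; rewrite /= in_itv/= x0.
Qed.

Lemma integ_itv_pow q t : 0 < q -> integ `]0, t[ (fun x => x `^ (q - 1)).
Proof.
move=> q0; have q1 : -1 < q - 1 by rewrite ltrBrDr addNr.
have h : integ `]0, t[ (fun x => x `^ (q - 1) * expR (- (1 * x))).
  apply: (@integS _ I0) => //; last exact: integ_pexp.
  by move=> x /itv0P[x0 _]; rewrite /= in_itv/= x0.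
apply: (integ_le _ _ (integZ (expR t) _ h)) => //.
  by apply: measurable_0t => x; exact: powR_cont.
move=> x /itv0P[x0 xt]; rewrite ger0_norm ?powR_ge0// mulrCA -expRD mul1r.
by rewrite ler_peMr ?powR_ge0// -expR0 ler_expR subr_ge0 ltW.
Qed.

Lemma integ_itv_pow_refl q t : 0 < q -> integ `]0, t[ (fun x => (t - x) `^ (q - 1)).
Proof.
move=> q0; pose h := (fun x => x `^ (q - 1)) \_ `]0, t[.
have h1 : integ setT (fun x => h (- (1 * x - t))).
  apply: (integ_affine (f := fun x => h (- x)) (- t) ltr01 measurableT).
  by apply: integ_opp; apply: integ_restrict => //; exact: integ_itv_pow.
apply: (@integ_ext _ _ (fun x => h (- (1 * x - t)))) => //; last exact: integS h1.
move=> x /itv0P[x0 xt]; rewrite mul1r opprB /h patchE ifT// inE /= in_itv/=.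
by rewrite subr_gt0 xt ltrBlDl ltrDr.
Qed.

Lemma measurable_0t_sub f t : (forall x, 0 < x -> {for x, continuous f}) ->
  measurable_fun `]0, t[ (fun x => f (t - x)).
Proof.
move=> cf; apply: (measurable_comp (F := I0)) => //.
- by move=> _ [x /itv0P[x0 xt] <-]; rewrite /= in_itv/= subr_gt0 xt.
- exact: continuous_measurable_0y.
- exact: measurable_funB.
Qed.

Lemma pow_decr a x y : a <= 0 -> 0 < x -> x <= y -> y `^ a <= x `^ a.
Proof.
move=> a0 x0 xy; have y0 := lt_le_trans x0 xy.
rewrite -(opprK a) ![_ `^ (- - a)]powRN lef_pV2 ?posrE ?powR_gt0//.
by apply: ge0_ler_powR; rewrite ?nnegrE ?oppr_ge0 ?(ltW x0) ?(ltW y0).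
Qed.

(** Each factor is singular at one end only: on either half of the interval the other factor is
    bounded by its value at [t / 2]. *)
Lemma integ_beta p q t : p < 1 -> 0 < q -> 0 <= p -> q <= 1 ->
  integ `]0, t[ (fun x => (t - x) `^ (- p) * x `^ (q - 1)).
Proof.
move=> p1 q0 p0 q1.
have p1' : 0 < 1 - p by rewrite subr_gt0.
have i1 := integZ ((t / 2) `^ (- p)) (measurable_itv _) (integ_itv_pow t q0).
have i2 := integZ ((t / 2) `^ (q - 1)) (measurable_itv _) (integ_itv_pow_refl t p1').
apply: (integ_le _ _ (integD _ i1 i2)) => //.
  apply: measurable_funM; last by apply: measurable_0t => x; exact: powR_cont.
  by apply: (measurable_0t_sub (f := fun x => x `^ (- p))) => x; exact: powR_cont.
move=> x /itv0P[x0 xt]; rewrite ger0_norm ?mulr_ge0 ?powR_ge0//.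
have t0 := lt_trans x0 xt; have t20 : 0 < t / 2 by rewrite divr_gt0.
rewrite (_ : 1 - p - 1 = - p); last by ring.
have [h|h] := leP x (t / 2).
  rewrite (@le_trans _ _ ((t / 2) `^ (- p) * x `^ (q - 1)))//.
    by rewrite ler_wpM2r ?powR_ge0// pow_decr ?oppr_le0//; lra.
  by rewrite lerDl mulr_ge0 ?powR_ge0.
rewrite mulrC (@le_trans _ _ ((t / 2) `^ (q - 1) * (t - x) `^ (- p)))//.
  by rewrite ler_wpM2r ?powR_ge0// pow_decr ?subr_le0// ltW.
by rewrite lerDr mulr_ge0 ?powR_ge0.
Qed.

(** The fractional integral of order [p - 1] without the factor [1 / Gamma (1 - p)]; at [p = 0] it
    is the ordinary primitive, so both cases share their estimates. *)
Definition conv p w t := \int[mu]_(x in `]0, t[) ((t - x) `^ (- p) * w x).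

Section power_growth.
Variables (w : R -> R) (C q p : R).
Hypotheses (cw : forall x, 0 < x -> {for x, continuous w})
  (C0 : 0 <= C) (wC : forall x, 0 < x -> `|w x| <= C * x `^ (q - 1))
  (q01 : 0 < q <= 1) (p01 : 0 <= p < 1).

Let q0 : 0 < q. Proof. by have /andP[] := q01. Qed.
Let q1 : q <= 1. Proof. by have /andP[] := q01. Qed.
Let p0 : 0 <= p. Proof. by have /andP[] := p01. Qed.
Let p1 : p < 1. Proof. by have /andP[] := p01. Qed.

Lemma conv_integ t : integ `]0, t[ (fun x => (t - x) `^ (- p) * w x).
Proof.
apply: (integ_le _ _ (integZ C _ (integ_beta t p1 q0 p0 q1))) => //.
  apply: measurable_funM; last exact: measurable_0t.
  by apply: (measurable_0t_sub (f := fun x => x `^ (- p))) => x; exact: powR_cont.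
move=> x /itv0P[x0 xt]; rewrite normrM ger0_norm ?powR_ge0// mulrCA.
by rewrite ler_wpM2l ?powR_ge0// wC.
Qed.

(** The substitution [x = t y] fixes the domain of integration; growth and continuity in [t] then
    follow from bounds on the integrand. *)
Lemma conv_scale t : 0 < t ->
  conv p w t = t `^ (1 - p) * \int[mu]_(y in `]0, 1[) ((1 - y) `^ (- p) * w (t * y)) /\
  integ `]0, 1[ (fun y => (1 - y) `^ (- p) * w (t * y)).
Proof.
move=> t0.
have e : [set x : R | `]0, t[%classic (t * x + 0)] = `]0, 1[%classic.
  apply/seteqP; split => x; rewrite /= !in_itv/= addr0 pmulr_rgt0//.
    by rewrite gtr_pMr.
  by rewrite gtr_pMr.
have h1 := integ_affine 0 t0 (measurable_itv _) (conv_integ t).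
have h2 := Rint_affine 0 t0 (measurable_itv _) (conv_integ t).
rewrite e in h1 h2.
have ef x : (`]0, 1[%classic : set R) x ->
    t `^ (- p) * ((1 - x) `^ (- p) * w (t * x)) = (t - (t * x + 0)) `^ (- p) * w (t * x + 0).
  move=> /itv0P[x0 x1]; rewrite addr0 mulrA -powRM ?(ltW t0) ?subr_ge0 ?(ltW x1)//.
  by rewrite mulrBr mulr1.
have i1 : integ `]0, 1[ (fun y => (1 - y) `^ (- p) * w (t * y)).
  have := integZ (t `^ p) (measurable_itv _) h1 => h3.
  apply: integ_ext h3 => // x x01; rewrite -ef// mulrA -powRD; last by rewrite (gt_eqF t0) implybT.
  by rewrite subrr powRr0 mul1r.
split=> //; rewrite /conv h2 -(eq_Rint ef) RintZ// mulrA; congr (_ * _).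
by rewrite (@powRD _ t 1 (- p)) ?(gt_eqF t0) ?implybT// powRr1// ltW.
Qed.

Lemma conv_bound t : 0 < t -> `|conv p w t| <=
  C * (\int[mu]_(y in `]0, 1[) ((1 - y) `^ (- p) * y `^ (q - 1))) * t `^ (q - p).
Proof.
move=> t0; have [-> i1] := conv_scale t0.
have i2 := integZ (C * t `^ (q - 1)) (measurable_itv _) (integ_beta 1 p1 q0 p0 q1).
have h : `|\int[mu]_(y in `]0, 1[) ((1 - y) `^ (- p) * w (t * y))| <=
   C * t `^ (q - 1) * \int[mu]_(y in `]0, 1[) ((1 - y) `^ (- p) * y `^ (q - 1)).
  rewrite -RintZ//; last exact: integ_beta.
  apply: norm_Rint_le => //; first exact: integ_measurable i1.
  move=> x /itv0P[x0 x1]; rewrite normrM ger0_norm ?powR_ge0//.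
  rewrite mulrCA ler_wpM2l ?powR_ge0// (le_trans (wC _)) ?mulr_gt0//.
  by rewrite -mulrA -powRM ?(ltW t0) ?(ltW x0).
rewrite normrM ger0_norm ?powR_ge0// (le_trans (ler_wpM2l (powR_ge0 _ _) h))//.
rewrite (_ : q - p = (1 - p) + (q - 1)); last by ring.
rewrite (@powRD _ t (1 - p) (q - 1)); last by rewrite (gt_eqF t0) implybT.
by rewrite le_eqVlt; apply/orP; left; apply/eqP; ring.
Qed.

Lemma conv_cont t : 0 < t -> {for t, continuous (conv p w)}.
Proof.
move=> t0; pose G t := \int[mu]_(y in `]0, 1[) ((1 - y) `^ (- p) * w (t * y)).
have cG : {for t, continuous G}.
  (* Domination for times in []t / 2, 2 t[]: the exponent [q - 1] is at most 0, so the bound is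
     largest at [t / 2]. *)
  pose B y := C * (t / 2) `^ (q - 1) * ((1 - y) `^ (- p) * y `^ (q - 1)).
  have [iB B1] : integ `]0, 1[ B /\ True by split=> //; apply: integZ => //; exact: integ_beta.
  apply: (@continuity_under_integral _ _ _ mu (fun t y => (1 - y) `^ (- p) * w (t * y))
    `]0, 1[%classic (mR (measurable_itv _)) (t / 2) (2 * t) _ _ B iB).
  - move=> x /=; rewrite in_itv/= => /andP[h _]; apply: (conv_scale _).2.
    by apply: lt_trans h; rewrite divr_gt0.
  - apply: aeW => y /itv0P[y0 y1] x; rewrite inE/= in_itv/= => /andP[h _].
    have x0 : 0 < x by apply: lt_trans h; rewrite divr_gt0.
    suff : {for x, continuous (fun x => (1 - y) `^ (- p) * w (x * y))} by [].
    apply: continuousM; first exact: cst_continuous.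
    apply: (continuous_comp (f := fun x => x * y)).
      by apply: continuousM; [exact: (is_derive_continuous (der_id _))|exact: cst_continuous].
    by apply: cw; rewrite mulr_gt0.
  - move=> x /=; rewrite in_itv/= => /andP[h _]; apply: aeW => y /itv0P[y0 y1].
    have x0 : 0 < x by apply: lt_trans h; rewrite divr_gt0.
    rewrite normrM ger0_norm ?powR_ge0// /B mulrCA ler_wpM2l ?powR_ge0//.
    rewrite (le_trans (wC _)) ?mulr_gt0// -mulrA ler_wpM2l// powRM ?(ltW x0) ?(ltW y0)//.
    by rewrite ler_wpM2r ?powR_ge0// pow_decr ?subr_le0 ?divr_gt0// ltW.
  - by rewrite inE /= in_itv/=; lra.
have cp : {for t, continuous (fun t => t `^ (1 - p) * G t)}.
  by apply: continuousM => //; exact: powR_cont.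
apply/cvgrPdist_le => /= e e0.
move/cvgrPdist_le : cp => /= /(_ e e0) cp.
near=> x; rewrite !(conv_scale _).1//; last by near: x; exact: lt_nbhsr.
by near: x.
Unshelve. all: by end_near. Qed.

End power_growth.

Lemma laplace_pow p s : p < 1 -> 0 < s ->
  integ I0 (fun t => expR (- (s * t)) * t `^ (- p)) /\
  \int[mu]_(t in I0) (expR (- (s * t)) * t `^ (- p)) = Gamma (1 - p) * s `^ (p - 1).
Proof.
move=> p1 s0.
have p1' : -1 < - p by rewrite ltrN2.
have E : (fun t => expR (- (s * t)) * t `^ (- p)) = (fun t => t `^ (- p) * expR (- (s * t))).
  by apply/funext => t; rewrite mulrC.
rewrite E; split; first exact: integ_pexp.
have i1 := integ_pexp p1' (@ltr01 R).
have [i2 e2] := I0_scale s0 i1.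
have -> : Gamma (1 - p) = \int[mu]_(x in I0) (x `^ (- p) * expR (- (1 * x))).
  apply: eq_Rint => x _; rewrite mul1r; congr (_ `^ _ * _); ring.
have -> : \int[mu]_(x in I0) (x `^ (- p) * expR (- (1 * x))) =
    s * (s `^ (- p) * \int[mu]_(x in I0) (x `^ (- p) * expR (- (s * x)))).
  rewrite e2; congr (_ * _); rewrite -RintZ//; last exact: integ_pexp.
  by apply: eq_Rint => x /I0P x0; rewrite mul1r powRM ?(ltW s0) ?(ltW x0)// mulrA.
move: (\int[mu]_(x in I0) (x `^ (- p) * expR (- (s * x)))) => L.
rewrite [RHS](_ : _ = s * (s `^ (- p) * s `^ (p - 1)) * L); last by ring.
rewrite -powRD; last by rewrite (gt_eqF s0) implybT.
rewrite (_ : - p + (p - 1) = - 1); last by ring.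
by rewrite powR_inv1 ?(ltW s0)// divff ?mul1r// gt_eqF.
Qed.

Lemma Rint_cst0t k t : 0 < t -> integ `]0, t[ (fun _ => k).
Proof. by move=> t0; apply: integ_cst => //; exact: itv_finite. Qed.

Section mittag_leffler.
Variables (c l : R).
Hypotheses (c01 : 0 < c <= 1) (l0 : 0 < l).

Let c0 : 0 < c. Proof. by have /andP[] := c01. Qed.
Let c1 : c <= 1. Proof. by have /andP[] := c01. Qed.
Let q01 : 0 < c / 2 <= 1. Proof. by have a := c0; have b := c1; apply/andP; split; lra. Qed.
Let z01 : 0 <= (0 : R) < 1. Proof. by rewrite lexx ltr01. Qed.

Let mlf_growth : exists2 C, 0 <= C &
  forall x, 0 < x -> `|mlf c l x| <= C * x `^ (c / 2 - 1).
Proof.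
have [C C0 h] := mlf_power_bound c01.
exists (C / Num.sqrt l); first by rewrite divr_ge0 ?sqrtr_ge0.
by move=> x x0; exact: h.
Qed.

Let cm x : 0 < x -> {for x, continuous (mlf c l)}. Proof. exact: mlf_cont. Qed.

Lemma conv_mlf_integ p t : 0 <= p < 1 -> integ `]0, t[ (fun x => (t - x) `^ (- p) * mlf c l x).
Proof. by have [C C0 h] := mlf_growth => p01; apply: (conv_integ cm h q01). Qed.

Lemma conv_mlf_cont p t : 0 <= p < 1 -> 0 < t -> {for t, continuous (conv p (mlf c l))}.
Proof. by have [C C0 h] := mlf_growth => p01; apply: (conv_cont cm C0 h q01). Qed.

Lemma mlf_integ t : integ `]0, t[ (mlf c l).
Proof.
apply: integ_ext (conv_mlf_integ t z01) => // x _.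
by rewrite oppr0 powRr0 mul1r.
Qed.

(** This is [E_(c,1) (- l t^c)], the fractional integral of order [c - 1] of [mlf]. Defined through
    the primitive, it has its derivative and its limit at 0 at once; [conv_mlf] justifies the
    identification. *)
Definition mlj t := 1 - l * \int[mu]_(x in `]0, t[) mlf c l x.

Let conv0 t : conv 0 (mlf c l) t = \int[mu]_(x in `]0, t[) mlf c l x.
Proof. by apply: eq_Rint => x _; rewrite oppr0 powRr0 mul1r. Qed.

Lemma laplace_conv_mlf p s : 0 <= p < 1 -> 0 < s ->
  integ I0 (fun t => expR (- (s * t)) * conv p (mlf c l) t) /\
  \int[mu]_(t in I0) (expR (- (s * t)) * conv p (mlf c l) t) =
  Gamma (1 - p) * s `^ (p - 1) * (s `^ c + l)^-1.
Proof.
move=> p01 s0; have p1 : p < 1 by have /andP[] := p01.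
have [i1 e1] := laplace_pow p1 s0.
have i2 := mlf_laplace_integ c01 l0 s0.
have [i3 e3] := laplace_conv i1 i2 (fun t _ => conv_mlf_integ t p01).
by split; [exact: i3|rewrite e3 e1 mlf_laplace].
Qed.

Lemma Gamma1 : Gamma (1 : R) = 1.
Proof.
have := (Rint_expN (@ltr01 R)).2; rewrite invr1 => h; rewrite -[RHS]h.
by apply: eq_Rint => x /I0P x0; rewrite subrr powRr0 !mul1r.
Qed.

(** Both sides are continuous and have the Laplace transform [Gamma (1 - c) s^(c-1) / (s^c + l)];
    [lerch] applies to the difference. *)
Lemma conv_mlf t : c < 1 -> 0 < t -> conv c (mlf c l) t = Gamma (1 - c) * mlj t.
Proof.
move=> c1' t0; have cc : 0 <= c < 1 by rewrite (ltW c0).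
pose h t := conv c (mlf c l) t - Gamma (1 - c) * (1 - l * conv 0 (mlf c l) t).
suff : h t = 0 by rewrite /h /mlj conv0 => /eqP; rewrite subr_eq0 => /eqP.
have ih s : 0 < s -> integ I0 (fun t => expR (- (s * t)) * h t) /\
    \int[mu]_(t in I0) (expR (- (s * t)) * h t) = 0.
  move=> s0.
  have [i1 e1] := laplace_conv_mlf cc s0.
  have [i2 e2] := laplace_conv_mlf z01 s0.
  have [i3 e3] := Rint_expN s0.
  have i4 := integZ (- Gamma (1 - c)) (measurable_itv _) i3.
  have i5 := integZ (Gamma (1 - c) * l) (measurable_itv _) i2.
  have i6 := integD (measurable_itv _) i1 i4.
  have E t' : I0 t' -> (expR (- (s * t')) * conv c (mlf c l) t' +
      (- Gamma (1 - c)) * expR (- (s * t'))) +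
      (Gamma (1 - c) * l) * (expR (- (s * t')) * conv 0 (mlf c l) t') =
      expR (- (s * t')) * h t'.
    rewrite /h; move: (conv c _ _) (conv 0 _ _) (expR _) (Gamma _) => ? ? ? ? _; ring.
  have i7 := integD (measurable_itv _) i6 i5.
  split; first exact: (integ_ext (measurable_itv _) E i7).
  rewrite -(eq_Rint E) (RintegralD (mR (measurable_itv _)) i6 i5).
  rewrite (RintegralD (mR (measurable_itv _)) i1 i4).
  rewrite (RintZ _ (measurable_itv _) i3) (RintZ _ (measurable_itv _) i2) [X in X + _ + _]e1 e2 e3.
  rewrite subr0 Gamma1 sub0r mul1r powR_inv1 ?(ltW s0)//.
  rewrite powRB ?powRr1 ?(ltW s0)//; last by rewrite (gt_eqF s0) implybT.
  have : 0 < s `^ c by rewrite powR_gt0.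
  move: (s `^ c) (Gamma (1 - c)) => a G a0; field.
  by rewrite !gt_eqF// addr_gt0.
apply: (lerch (h := h) (s := 1) _ (ih 1 ltr01).1 _ t0).
  move=> x x0; apply: continuousB; first exact: conv_mlf_cont.
  apply: continuousM; first exact: cst_continuous.
  apply: continuousB; first exact: cst_continuous.
  by apply: continuousM; [exact: cst_continuous|exact: conv_mlf_cont].
by move=> n; apply: (ih _ _).2; rewrite ltr_pwDl.
Qed.

Lemma mlj_derive t : 0 < t -> is_derive t 1 mlj (- l * mlf c l t).
Proof.
move=> t0.
have t1 : t < t + 1 by rewrite ltrDl.
have i1 : integ `]0, t + 1] (mlf c l).
  apply: (integS _ _ _ (mlf_integ (t + 2))) => //.
  move=> x; rewrite /= !in_itv/= => /andP[-> /le_lt_trans->//].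
  by rewrite ltrD2l ltr1n.
have [dF eF] := @continuous_FTC1 R (mlf c l) (BRight 0) t (t + 1) t1 i1 t0 (cm t0).
have d1 : is_derive t 1 (fun x => \int[mu]_(t in `]0, x]) mlf c l t) (mlf c l t).
  by apply: (DeriveDef dF); rewrite -derive1E; exact: eF.
have E : mlj = (fun x => 1 - l * \int[mu]_(t in `]0, x]) mlf c l t).
  apply/funext => x; by rewrite /mlj (Rintegral_itv_bndo_bndc (mlf_integ x)).
by rewrite E; apply: der_eq (derB (der_cst 1 t) (derZ l d1)) _; rewrite sub0r mulNr.
Qed.

Lemma mlj_cvg0 : mlj t @[t --> 0^'+] --> (1 : R).
Proof.
have [C C0 h] := mlf_growth.
suff : 1 - l * (\int[mu]_(x in `]0, t[) mlf c l x) @[t --> 0^'+] --> 1 - l * 0 by rewrite mulr0 subr0.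
apply: cvgB; first exact: cvg_cst.
apply: cvgM; first exact: cvg_cst.
pose B := C * (\int[mu]_(y in `]0, 1[) ((1 - y) `^ (- 0) * y `^ (c / 2 - 1))).
apply: norm_cvg0.
apply: (@squeeze_cvgr _ _ _ _ (cst 0) (fun t => B * t `^ (c / 2))); last 2 first.
- exact: cvg_cst.
- suff : B * t `^ (c / 2) @[t --> 0^'+] --> B * 0 by rewrite mulr0.
  apply: cvgM; first exact: cvg_cst.
  by apply: powR_cvg0; rewrite divr_gt0.
near=> t; have t0 : 0 < t by [].
rewrite normr_ge0/= -conv0 (le_trans (conv_bound cm h q01 z01 t0))//.
by rewrite subr0.
Unshelve. all: by end_near. Qed.

End mittag_leffler.

(** Both sides have the Laplace transform [1 / (s + l)]. *)
Lemma mlf1 l t : 0 < l -> 0 < t -> mlf 1 l t = expR (- (l * t)).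
Proof.
move=> l0 t0; have c01 : 0 < (1 : R) <= 1 by rewrite ltr01 lexx.
pose h t := mlf 1 l t - expR (- (l * t)).
suff : h t = 0 by move/eqP; rewrite subr_eq0 => /eqP.
have ih s : 0 < s -> integ I0 (fun t => expR (- (s * t)) * h t) /\
    \int[mu]_(t in I0) (expR (- (s * t)) * h t) = 0.
  move=> s0; have i1 := mlf_laplace_integ c01 l0 s0.
  have [i2 e2] := Rint_expN (addr_gt0 s0 l0).
  have E t' : expR (- (s * t')) * mlf 1 l t' - expR (- ((s + l) * t')) =
     expR (- (s * t')) * h t'.
    by rewrite /h mulrBr -expRD; congr (_ - expR _); ring.
  split; first by apply: integ_ext (integB (measurable_itv _) i1 i2) => // t' _; exact: E.
  rewrite -(eq_Rint (fun t' _ => E t')) RintegralB// e2 mlf_laplace//.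
  by rewrite powRr1 ?(ltW s0)// subrr.
apply: (lerch (h := h) (s := 1) _ (ih 1 ltr01).1 _ t0).
  move=> x x0; apply: continuousB; first exact: mlf_cont.
  exact: cont_expN.
by move=> n; apply: (ih _ _).2; rewrite ltr_pwDl.
Qed.

End convolution.

(** * The maximum principle *)

Section maximum_principle.
Context {R : realType}.
Notation mu := (@lebesgue_measure R).
Notation I0 := (`](0 : R), +oo[%classic).
Implicit Types (r a b k p q t u v x y m s c l : R) (w f g : R -> R).

Lemma is_derive_ge0_le f (df : R -> R) a b : a <= b ->
  (forall x, a <= x <= b -> is_derive x 1 f (df x)) ->
  (forall x, a <= x <= b -> 0 <= df x) -> f a <= f b.
Proof.
rewrite le_eqVlt => /predU1P[->//|ab] fd d0.
have [c [/andP[ac cb] e]] := mvt ab fd.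
by rewrite -subr_ge0 e mulr_ge0 ?subr_ge0 ?(ltW ab)// d0// !ltW.
Qed.

(* At a positive maximum [ts] of [J], the function
   [F x = (ts - x)^(-rho) (J ts - J x) + int_0^x (ts - z)^(-rho) J'(z) dz]
   is nondecreasing, and its limits at [0] and [ts] force [J ts <= J0]. *)
Lemma caputo_max (rho lam T G J0 : R) (w J : R -> R) :
  0 < rho < 1 -> 0 < lam -> 0 < G ->
  (forall t, 0 < t < T -> is_derive t 1 J (- lam * w t)) ->
  (forall t, 0 < t < T -> {for t, continuous w}) ->
  (forall t, 0 < t < T -> integ `]0, t[ (fun x => (t - x) `^ (- rho) * w x)) ->
  (forall t, 0 < t < T -> conv rho w t = G * J t) ->
  J x @[x --> 0^'+] --> J0 -> forall t, 0 < t < T -> J t <= Num.max J0 0.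
Proof.
move=> /andP[r0 r1] l0 G0 dJ cw iw eJ J00 t1 /andP[t10 t1T].
rewrite leNgt; apply/negP => t1M.
set M := Num.max J0 0 in t1M.
have J0M : J0 <= M by rewrite le_max lexx.
have M0 : 0 <= M by rewrite le_max lexx orbT.
(* Close to 0 the values of [J] stay below [J t1], so the maximum over []0, t1]] is attained on the
   compact interval [[e / 2, t1]]. *)
have [e [e0 et1 eJ1]] : exists e, [/\ 0 < e, e <= t1 & forall x, 0 < x < e -> J x < J t1].
  have n0 : 0 < J t1 - M by rewrite subr_gt0.
  move/cvgrPdist_lt : J00 => /(_ _ n0)[e /= e0 he].
  exists (Num.min e t1); rewrite lt_min e0 t10; split => //; first exact: min_ler.
  move=> x /andP[x0]; rewrite lt_min => /andP[xe _].
  have := he x _ x0; rewrite /ball_/= sub0r normrN gtr0_norm// => /(_ xe).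
  rewrite ltr_distlC => /andP[_]; lra.
have cJ x : 0 < x < T -> {for x, continuous J} by move=> /dJ /is_derive_continuous.
have e20 : 0 < e / 2 by rewrite divr_gt0.
have et : e / 2 <= t1 by lra.
have cJ1 : {within `[e / 2, t1], continuous J}.
  apply: continuous_in_subspaceT => x; rewrite inE /= in_itv/= => /andP[h1 h2].
  by apply: cJ; rewrite (lt_le_trans e20 h1) (le_lt_trans h2 t1T).
have [ts tsI tsmax] := EVT_max et cJ1.
move: tsI; rewrite in_itv/= => /andP[h1 h2].
have ts0 : 0 < ts by apply: lt_le_trans h1.
have tsT : ts < T by apply: le_lt_trans t1T.
have tsI : 0 < ts < T by rewrite ts0.
have t1ts : J t1 <= J ts by apply: tsmax; rewrite in_itv/= et lexx.
have mx x : 0 < x <= ts -> J x <= J ts.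
  move=> /andP[x0 xts]; have [xe|xe] := ltP x (e / 2).
    by apply: (le_trans _ t1ts); apply/ltW/eJ1; rewrite x0; lra.
  by apply: tsmax; rewrite in_itv/= xe (le_trans xts h2).
have Jts0 : 0 < J ts by apply: lt_le_trans t1ts; apply: le_lt_trans t1M.
pose h x := (ts - x) `^ (- rho) * w x.
pose h0 := h \_ `]0, ts[.
have ih : integ setT h0 by apply: integ_restrict => //; exact: iw.
have ihc : integ `[0, ts] h0 by apply: integS ih.
have h0E x : 0 < x < ts -> h0 x = h x.
  by move=> xI; rewrite /h0 patchE ifT// inE /= in_itv.
have der_pow x a : x < ts -> is_derive x 1 (fun x => (ts - x) `^ a) (- (a * (ts - x) `^ (a - 1))).
  move=> xt; have d0 : 0 < ts - x by rewrite subr_gt0.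
  apply: der_eq (@der_comp _ (fun y => y `^ a) (fun x => ts - x) x _ _ (powR_derive a d0) (derB (der_cst ts x) (der_id x))) _.
  by rewrite sub0r mulrN1.
have ch x : 0 < x < ts -> {for x, continuous h}.
  move=> /andP[x0 xt]; apply: continuousM.
    exact: is_derive_continuous (der_pow x (- rho) xt).
  by apply: cw; rewrite x0 (lt_trans xt tsT).
have ch0 x : 0 < x < ts -> {for x, continuous h0}.
  move=> xI; apply/cvgrPdist_le => /= d d0.
  have /cvgrPdist_le/(_ _ d0) := ch x xI => /= hc.
  rewrite (h0E _ xI); near=> z; rewrite h0E; first by near: z.
  near: z; move: xI => /andP[x0 xt].
  by apply: filterS2 (lt_nbhsr x0) (lt_nbhsl xt) => z -> ->.
pose H x := \int[mu]_(z in `[0, x]) h0 z.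
have dH x : 0 < x < ts -> is_derive x 1 H (h x).
  move=> xI; have /andP[x0 xt] := xI.
  have [dF eF] := @continuous_FTC1_closed R h0 0 x ts xt ihc x0 (ch0 x xI).
  by apply: (DeriveDef dF); rewrite -derive1E -(h0E _ xI); exact: eF.
(* In the derivative of [F] the two terms containing [w] cancel because [J' = - lam w]; what remains
   is [dF], nonnegative by maximality of [J ts]. *)
pose F x := (ts - x) `^ (- rho) * (J ts - J x) - lam * H x.
pose dF x := rho * (ts - x) `^ (- rho - 1) * (J ts - J x).
have dFx x : 0 < x < ts -> is_derive x 1 F (dF x).
  move=> xI; have /andP[x0 xt] := xI.
  have xT : 0 < x < T by rewrite x0 (lt_trans xt tsT).
  apply: der_eq (derB (derM (der_pow x (- rho) xt) (derB (der_cst (J ts) x) (dJ x xT))) (derZ lam (dH x xI))) _.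
  rewrite /dF /h; ring.
have Fmono a b : 0 < a -> a <= b -> b < ts -> F a <= F b.
  move=> a0 ab bt; apply: (is_derive_ge0_le ab (df := dF)) => x /andP[ax xb].
    by apply: dFx; rewrite (lt_le_trans a0 ax) (le_lt_trans xb bt).
  rewrite /dF mulr_ge0 ?subr_ge0//.
    by rewrite mulr_ge0 ?powR_ge0// ltW.
  by apply: mx; rewrite (lt_le_trans a0 ax) ltW ?(le_lt_trans xb bt).
have F0 : F x @[x --> 0^'+] --> ts `^ (- rho) * (J ts - J0) - lam * 0.
  apply: cvgB.
    apply: cvgM.
      rewrite -[X in _ --> X `^ _](subr0 ts); apply: cvg_at_right_filter.
      exact: (is_derive_continuous (der_pow 0 (- rho) ts0)).
    by apply: cvgB => //; exact: cvg_cst.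
  apply: cvgM; first exact: cvg_cst.
  apply: cvg_at_right_filter.
  exact: (@parameterized_integral_cvg_left R 0 ts h0 ts0 ihc).
have F1 : F x @[x --> ts^'-] --> 0 - lam * (G * J ts).
  apply: cvgB.
    (* By the mean value theorem [J ts - J x] is at most a constant times [ts - x], which reduces
       the singular factor to [(ts - x)^(1 - rho)]. *)
    have [K [d [d0 K0 hK]]] : exists K d, [/\ 0 < d, 0 < K & forall x, ts - d < x < ts ->
        `|(ts - x) `^ (- rho) * (J ts - J x)| <= K * (ts - x) `^ (1 - rho)].
      have := cw ts tsI => /cvgrPdist_lt/(_ _ ltr01)[d /= d0 hd].
      exists (lam * (`|w ts| + 1)), (Num.min d ts).
      split; first by rewrite lt_min d0.
        by rewrite mulr_gt0// ltr_wpDl.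
      move=> x; rewrite ltrBlDr -ltrBlDl lt_min => /andP[/andP[xd xts] xt].
      have x0 : 0 < x by clear - xts xt; lra.
      have [|y [/andP[xy yt] ->]] := @mvt R J (fun t => - lam * w t) _ _ xt.
        move=> z /andP[xz zt]; apply: dJ; rewrite (lt_le_trans x0 xz).
        exact: le_lt_trans tsT.
      have wy : `|w y| <= `|w ts| + 1.
        have := hd y; rewrite /ball_/= gtr0_norm ?subr_gt0// => /(_ _)/ltW h3.
        have {}h3 : `|w ts - w y| <= 1 by apply: h3; clear - xd xy; lra.
        rewrite -lerBlDl; apply: le_trans h3; rewrite distrC; exact: lerB_dist.
      have tx : 0 < ts - x by rewrite subr_gt0.
      rewrite (@powRD _ (ts - x) 1 (- rho)) ?(gt_eqF tx) ?implybT// powRr1 ?(ltW tx)//.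
      rewrite !normrM normrN (gtr0_norm l0) (gtr0_norm tx) (ger0_norm (powR_ge0 _ _)).
      rewrite [leLHS](_ : _ = lam * ((ts - x) * (ts - x) `^ (- rho)) * `|w y|); last by ring.
      rewrite [leRHS](_ : _ = lam * ((ts - x) * (ts - x) `^ (- rho)) * (`|w ts| + 1)); last by ring.
      by rewrite ler_wpM2l// !mulr_ge0 ?powR_ge0 ?(ltW l0) ?(ltW tx).
    have r1' : 0 < 1 - rho by rewrite subr_gt0.
    apply/cvgrPdist_lt => /= b b0.
    have /cvgrPdist_lt/(_ _ (divr_gt0 b0 K0))[d' /= d'0 hd'] := powR_cvg0 r1'.
    near=> x; have xt : x < ts by near: x; exact: nbhs_left_lt.
    have xd : ts - d < x by near: x; apply: nbhs_left_gt; rewrite ltrBlDr ltrDl.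
    have xd' : ts - d' < x by near: x; apply: nbhs_left_gt; rewrite ltrBlDr ltrDl.
    rewrite sub0r normrN (le_lt_trans (hK x _)) ?xd// mulrC -ltr_pdivlMr//.
    have := hd' (ts - x); rewrite /ball_/= !sub0r !normrN gtr0_norm ?subr_gt0// => h3.
    rewrite -[ltLHS]ger0_norm ?powR_ge0//; apply: h3 => //.
    by rewrite ltrBlDr -ltrBlDl.
  apply: cvgM; first exact: cvg_cst.
  have := @parameterized_integral_cvg_at_left R 0 ts h0 ts0 ihc.
  rewrite /parameterized_integral.
  rewrite [X in _ --> X](_ : _ = G * J ts)//.
  rewrite -eJ// /conv [RHS]Rint_restrict [LHS]Rint_restrict.
  apply: eq_Rint => x _; rewrite patchE; case: ifPn => // xn; rewrite -/h0 /h0 patchE ifN//.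
  apply: contra xn; rewrite !inE /= !in_itv/= => /andP[? ?]; apply/andP; split; exact: ltW.
(* Monotonicity of [F] passes to its two limits. The left side is positive since [J ts > J0], the
   right side negative since [J ts > 0]. *)
have : ts `^ (- rho) * (J ts - J0) - lam * 0 <= 0 - lam * (G * J ts).
  rewrite leNgt; apply/negP => lt01.
  have [lm ml] := midf_lt lt01.
  set m := (_ / 2) in lm ml.
  have /cvgr_gt/(_ _ ml) g0 := F0.
  have /cvgr_lt/(_ _ lm) g1 := F1.
  near (0 : R)^'+ => a; near ts^'- => b.
  have ab : F a <= F b.
    apply: Fmono; [by []|apply: (@le_trans _ _ (ts / 2)); apply: ltW|by []].
      by near: a; apply: nbhs_right_lt; rewrite divr_gt0.
    by near: b; apply: nbhs_left_gt; rewrite ltr_pdivrMr// ltr_pMr// ltr1n.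
  have Fa : m < F a by near: a.
  have Fb : F b < m by near: b.
  by have := lt_trans (lt_le_trans Fa ab) Fb; rewrite ltxx.
have : 0 < ts `^ (- rho) * (J ts - J0).
  by rewrite mulr_gt0 ?powR_gt0// subr_gt0 (le_lt_trans J0M)// (lt_le_trans t1M).
have : 0 < lam * (G * J ts) by rewrite !mulr_gt0.
clear; lra.
Unshelve. all: by end_near. Qed.

(** From [(1 - z) ln x <= x] the Gamma integrand is at least [e^(-2x)], whose integral is
    [1 / 2]. *)
Lemma Gamma_gt0 (z : R) : 0 < z <= 1 -> 0 < Gamma z.
Proof.
move=> /andP[z0 z1].
have z1' : -1 < z - 1 by rewrite ltrBrDr addNr.
have h := integ_pexp z1' (@ltr01 R).
have [i2 e2] := Rint_expN (@ltr0n R 2).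
have : 0 < \int[mu]_(x in I0) expR (- (2 * x)) by rewrite e2 invr_gt0.
move=> h2; apply: (lt_le_trans h2).
have -> : Gamma z = \int[mu]_(x in I0) (x `^ (z - 1) * expR (- (1 * x))).
  by apply: eq_Rint => x _; rewrite mul1r.
apply: (le_Rintegral _ i2 h) => // x /I0P x0.
rewrite (_ : - (2 * x) = - x - 1 * x); last by ring.
rewrite expRD ler_wpM2r ?expR_ge0// /powR gt_eqF// ler_expR.
rewrite -lerN2 opprK -mulNr opprB.
have lx : ln x <= x - 1 by have := @le_ln1Dx R (x - 1); rewrite [1 + _]addrC subrK; apply; lra.
have [l0|l0] := leP (ln x) 0.
  by rewrite (@le_trans _ _ 0) ?(ltW x0)// mulr_ge0_le0// subr_ge0.
by rewrite (@le_trans _ _ (ln x))//; [rewrite ler_piMl ?(ltW l0)//; lra|lra].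
Qed.

(** The maximum principle for [J] and for [- J]. Applied to a difference of solutions, where
    [J0 = 0], it gives uniqueness. *)
Lemma caputo_unique (rho lam T G J0 : R) (w J : R -> R) :
  0 < rho < 1 -> 0 < lam -> 0 < G ->
  (forall t, 0 < t < T -> is_derive t 1 J (- lam * w t)) ->
  (forall t, 0 < t < T -> {for t, continuous w}) ->
  (forall t, 0 < t < T -> integ `]0, t[ (fun x => (t - x) `^ (- rho) * w x)) ->
  (forall t, 0 < t < T -> conv rho w t = G * J t) ->
  J x @[x --> 0^'+] --> J0 -> forall t, 0 < t < T -> `|J t| <= `|J0|.
Proof.
move=> r01 l0 G0 dJ cw iw eJ J00 t tT.
have h1 := caputo_max r01 l0 G0 dJ cw iw eJ J00 tT.
have h2 : - J t <= Num.max (- J0) 0.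
  apply: (@caputo_max rho lam T G (- J0) (fun x => - w x) (fun x => - J x) r01 l0 G0 _ _ _ _ _ _ tT).
  - by move=> x xT; apply: der_eq (derN (dJ x xT)) _; ring.
  - by move=> x xT; apply: continuousN; exact: cw.
  - move=> x xT; apply: integ_ext (integN _ (iw x xT)) => // y _; ring.
  - move=> x xT; rewrite mulrN -eJ// /conv -mulN1r -RintZ//; last exact: iw.
    by apply: eq_Rint => y _; ring.
  - exact: cvgN.
have m1 : Num.max J0 0 <= `|J0| by rewrite ge_max ler_norm normr_ge0.
have m2 : Num.max (- J0) 0 <= `|J0| by rewrite ge_max -normrN ler_norm normr_ge0.
by rewrite ler_norml lerNl (le_trans h1 m1) (le_trans h2 m2).
Qed.

Lemma derive0_const (J : R -> R) (J0 : R) (T : R) :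
  (forall t, 0 < t < T -> is_derive t 1 J 0) ->
  J x @[x --> 0^'+] --> J0 -> forall t, 0 < t < T -> J t = J0.
Proof.
move=> dJ cJ t /andP[t0 tT].
apply: (@cvg_unique _ _ (J x @[x --> 0^'+])) => //.
apply: cvg_near_cst; near=> x.
have xt : x < t by near: x; exact: nbhs_right_lt.
have x0 : 0 < x by [].
have [|y [_ e]] := @mvt _ J (fun _ => 0) _ _ xt.
  by move=> y /andP[xy yt]; apply: dJ; rewrite (lt_le_trans x0 xy) (le_lt_trans yt tT).
by apply/eqP; rewrite eq_sym -subr_eq0 e mul0r.
Unshelve. all: by end_near. Qed.

Lemma mlj1 l t : 0 < l -> 0 < t -> mlj 1 l t = mlf 1 l t.
Proof.
move=> l0 t0; have c01 : 0 < (1 : R) <= 1 by rewrite ltr01 lexx.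
rewrite mlf1//; apply/eqP; rewrite -subr_eq0; apply/eqP.
apply: (@derive0_const (fun t => mlj 1 l t - expR (- (l * t))) 0 (t + 1)).
- move=> x /andP[x0 _].
  by apply: der_eq (derB (mlj_derive c01 l0 x0) (der_expN l x)) _; rewrite mlf1// subrr.
- suff : mlj 1 l x - expR (- (l * x)) @[x --> 0^'+] --> (1 : R) - 1 by rewrite subrr.
  apply: cvgB; first exact: mlj_cvg0.
  have := @cont_expN R l 0 => /cvg_at_right_filter; by rewrite mulr0 oppr0 expR0.
- by apply/andP; split=> //; rewrite ltrDl.
Qed.

(** Uniform in [l]: [mlj] is therefore a bounded multiplier for every datum, and its limit at 0 can
    be taken in the Hilbert space. Order 1 is separate because there [mlj] is an exponential. *)
Lemma mlj_le1 c l t : 0 < c <= 1 -> 0 < l -> 0 < t -> `|mlj c l t| <= 1.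
Proof.
move=> c01 l0 t0; have /andP[c0] := c01; rewrite le_eqVlt => /predU1P[->|c1].
  by rewrite mlj1// mlf1// gtr0_norm ?expR_gt0// -expR0 ler_expR oppr_le0 mulr_ge0 ?ltW.
rewrite -[leRHS]normr1.
apply: (@caputo_unique c l (t + 1) (Gamma (1 - c)) 1 (mlf c l) (mlj c l) _ l0).
- by rewrite c0.
- by apply: Gamma_gt0; rewrite subr_gt0 c1 gerBl ltW.
- by move=> x /andP[x0 _]; exact: mlj_derive.
- by move=> x /andP[x0 _]; exact: mlf_cont.
- by move=> x /andP[x0 _]; apply: conv_mlf_integ => //; rewrite (ltW c0).
- by move=> x /andP[x0 _]; exact: conv_mlf.
- exact: mlj_cvg0.
- by apply/andP; split=> //; rewrite ltrDl.
Qed.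

End maximum_principle.

(** * Dependence on the order *)

Section order_dependence.
Context {R : realType}.
Notation mu := (@lebesgue_measure R).
Notation I0 := (`](0 : R), +oo[%classic).
Notation th := (@th R).
Notation dd := (@dd R).
Notation kap := (@kap R).
Implicit Types (r a b c d k l p q t u v x y m s L : R).

(* [psi r * expR (- k r)] is integrable and dominates the derivative in [c] of
   [r^c expR (- k r)] for all [c] in [[0, 1]]. *)
Definition psi r : R := r `^ (- 2^-1) * (1 + r) ^+ 4.

Lemma integ_psi k : 0 < k -> integ I0 (fun r => psi r * expR (- (k * r))).
Proof.
move=> k0; have k20 : 0 < k / 2 by rewrite divr_gt0.
have [K K0 hK] := expR_decay 4 k20.
have hp : (-1 : R) < - 2^-1 by rewrite ltrN2 invf_lt1// ltr1n.
apply: (integ_le _ _ (integZ (K * expR (k / 2)) _ (integ_pexp hp k20))) => //.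
  apply: continuous_measurable_0y => r r0; apply: continuousM; last exact: cont_expN.
  apply: continuousM; first exact: powR_cont.
  have d1 := derD (der_cst 1 r) (der_id r).
  exact: is_derive_continuous (derM d1 (derM d1 (derM d1 d1))).
move=> r /I0P r0; have r1 : 0 <= 1 + r by rewrite addr_ge0// ltW.
rewrite /psi ger0_norm; last by rewrite !mulr_ge0 ?powR_ge0 ?exprn_ge0 ?expR_ge0.
have -> : expR (- (k * r)) = expR (- (k / 2 * (1 + r))) * expR (k / 2) * expR (- (k / 2 * r)).
  by rewrite -!expRD; congr expR; field.
rewrite [leLHS](_ : _ = (1 + r) ^+ 4 * expR (- (k / 2 * (1 + r))) *
  (expR (k / 2) * (r `^ (- 2^-1) * expR (- (k / 2 * r))))); last by ring.
by rewrite -[leRHS]mulrA ler_wpM2r ?hK// !mulr_ge0 ?powR_ge0 ?expR_ge0.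
Qed.

Lemma ln_le_subr1 x : 0 < x -> ln x <= x - 1.
Proof.
by move=> x0; have := @le_ln1Dx R (x - 1); rewrite [1 + _]addrC subrK; apply; lra.
Qed.

(** For [r < 1] put [u = r^(-1/2)]: then [ln r = - 2 ln u] and [ln u <= u - 1]. For [r >= 1] use
    [ln r <= r - 1]. *)
Lemma norm_ln_le r : 0 < r -> `|ln r| + 1 <= 2 * (r `^ (- 2^-1) * (1 + r) ^+ 2).
Proof.
move=> r0; pose u := r `^ (- 2^-1).
have u0 : 0 < u by rewrite powR_gt0.
have [r1|r1] := leP 1 r.
  have ur : r^-1 <= u.
    rewrite -powR_inv1 ?(ltW r0)// /u; apply: ler_powR => //.
    by rewrite lerN2 invf_le1// ler1n.
  rewrite ger0_norm ?ln_ge0//; apply: (@le_trans _ _ r); first by have := ln_le_subr1 r0; lra.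
  apply: (@le_trans _ _ (2 * (r^-1 * (1 + r) ^+ 2))).
    rewrite -(@ler_pM2l _ r)// [leRHS](_ : _ = 2 * (1 + r) ^+ 2); last by field; rewrite gt_eqF.
    by nra.
  by rewrite ler_pM2l// ler_wpM2r// sqr_ge0.
have ur : 1 <= u by rewrite -(powRr0 r) ger_powR ?r0 ?(ltW r1)// oppr_le0 invr_ge0.
have e : ln r = - 2 * ln u by rewrite /u ln_powR; field.
rewrite e mulNr normrN ger0_norm ?mulr_ge0 ?ln_ge0//.
have := ln_le_subr1 u0 => h.
apply: (@le_trans _ _ (2 * (u * 1))); first by lra.
by rewrite ler_pM2l// ler_pM2l// exprn_ege1// lerDl ltW.
Qed.

Lemma powR_le1D r p : 0 < r -> 0 <= p <= 1 -> r `^ p <= 1 + r.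
Proof.
move=> r0 /andP[p0 p1]; have [r1|r1] := leP 1 r.
  by apply: (le_trans (ler1_powR r1 p1)); rewrite lerDr.
apply: (@le_trans _ _ 1); last by rewrite lerDl ltW.
by rewrite -[leRHS](powRr0 r) ger_powR// r0 ltW.
Qed.

Lemma expR_diff_le a b : `|expR a - expR b| <= `|a - b| * (expR a + expR b).
Proof.
wlog ab : a b / a <= b => [h|].
  case/orP: (le_total a b) => ab; first exact: h.
  by rewrite distrC [`|a - b|]distrC [expR a + _]addrC; exact: h.
rewrite distrC [`|a - b|]distrC !ger0_norm ?subr_ge0 ?ler_expR//.
apply: (@le_trans _ _ ((b - a) * expR b)); last first.
  by rewrite ler_wpM2l ?subr_ge0// lerDr expR_ge0.
have -> : expR a = expR (a - b) * expR b by rewrite -expRD subrK.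
rewrite -{1}(mul1r (expR b)) -mulrBl ler_wpM2r ?expR_ge0//.
by have := expR_ge1Dx (a - b); lra.
Qed.

Lemma powR_diff_le r p q : 0 < r ->
  `|r `^ p - r `^ q| <= `|p - q| * `|ln r| * (r `^ p + r `^ q).
Proof.
move=> r0; rewrite /powR gt_eqF//.
by rewrite (le_trans (expR_diff_le _ _))// -mulrBl normrM.
Qed.

(** The order acts on the modulus through [ln r] and on the phase through [th]; both changes carry
    the factor [|p - q|]. *)
Lemma cpow_diff_le r p q : 0 < r ->
  cabs (cpow p r th - cpow q r th) <= `|p - q| * (`|ln r| + 2 * th) * (r `^ p + r `^ q).
Proof.
move=> r0.
have -> : cpow p r th - cpow q r th = (r `^ p - r `^ q)%:C * cis (p * th) +
    (r `^ q)%:C * (cis (p * th) - cis (q * th)).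
  by rewrite /cpow rmorphB/=; ring.
apply: (le_trans (cabsD _ _)); rewrite !cabsM cabs_cis mulr1 !cabs_real.
have h1 := powR_diff_le p q r0.
have h2 := cis_lip (p * th) (q * th).
rewrite -mulrBl normrM (gtr0_norm (@th_gt0 R)) in h2.
rewrite (ger0_norm (powR_ge0 _ _)).
rewrite [leRHS](_ : _ = `|p - q| * `|ln r| * (r `^ p + r `^ q) +
  `|p - q| * (2 * th) * (r `^ p + r `^ q)); last by ring.
rewrite lerD//.
apply: (@le_trans _ _ (r `^ q * (2 * (`|p - q| * th)))); first by rewrite ler_wpM2l ?powR_ge0.
rewrite [leLHS](_ : _ = `|p - q| * (2 * th) * r `^ q); last by ring.
apply: ler_wpM2l; last by rewrite lerDr powR_ge0.
by rewrite mulr_ge0// mulr_ge0// (ltW (@th_gt0 R)).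
Qed.

(** This is [Gamma (c + 1)], the factor beside [sin (pi c)] in the leading coefficient. *)
Definition gint c : R := \int[mu]_(r in I0) (r `^ c * expR (- r)).

Lemma integ_gint c : 0 <= c -> integ I0 (fun r => r `^ c * expR (- r)).
Proof.
move=> c0; have c1 : -1 < c by apply: lt_le_trans c0; rewrite oppr_lt0.
by apply: integ_ext (integ_pexp c1 (@ltr01 R)) => // r _; rewrite mul1r.
Qed.

(** Below, [r^c] is compared with [1 - e^(-r)]; above, [r^c <= 1 + r <= 2 e^(r/2)]. The use made of
    it is uniformity in [c]. *)
Lemma gint_itv c : 0 <= c <= 1 -> 2^-1 <= gint c <= 4.
Proof.
move=> c01; have /andP[c0 c1] := c01; apply/andP; split.
  have [i1 e1] := Rint_expN (@ltr01 R); have [i2 e2] := Rint_expN (@ltr0n R 2).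
  have -> : 2^-1 = \int[mu]_(r in I0) (expR (- (1 * r)) - expR (- (2 * r))).
    by rewrite (RintegralB (mR (measurable_itv _)) i1 i2) e1 e2; field.
  apply: (le_Rintegral _ (integB (measurable_itv _) i1 i2) (integ_gint c0)) => // r /I0P r0.
  have -> : - (2 * r) = - r - r by ring.
  rewrite mul1r expRD -{1}(mul1r (expR _)) -mulrBl ler_wpM2r ?expR_ge0//.
  have := expR_ge1Dx (- r) => h.
  have [r1|r1] := leP 1 r.
    by rewrite (@le_trans _ _ 1) ?lerBlDr ?lerDl ?expR_ge0// -(powRr0 r) ler_powR.
  apply: (@le_trans _ _ r); first by clear - h; lra.
  by apply: ger1_powR => //; rewrite r0 ltW.
have h2 : (0 : R) < 2^-1 by rewrite invr_gt0.
have [i1 e1] := Rint_expN h2.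
have -> : 4 = \int[mu]_(r in I0) (2 * expR (- (2^-1 * r))).
  by rewrite (RintZ _ (measurable_itv _) i1) e1; field.
apply: (le_Rintegral _ (integ_gint c0) (integZ 2 (measurable_itv _) i1)) => // r /I0P r0.
have -> : - (2^-1 * r) = r / 2 - r by field.
rewrite expRD mulrA ler_wpM2r ?expR_ge0// (le_trans (powR_le1D r0 c01))//.
by have := expR_ge1Dx (r / 2); lra.
Qed.

(** A Lipschitz constant of [gint] on [[0, 1]], by [gint_lip]. *)
Definition gintK : R := \int[mu]_(r in I0) (4 * (psi r * expR (- (1 * r)))).

Lemma psi_ge r p q : 0 < r -> 0 <= p <= 1 -> 0 <= q <= 1 ->
  (`|ln r| + 1) * (r `^ p + r `^ q) <= 4 * psi r.
Proof.
move=> r0 p01 q01.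
have h1 := norm_ln_le r0; have h2 := powR_le1D r0 p01; have h3 := powR_le1D r0 q01.
have a1 : 0 <= `|ln r| + 1 by rewrite addr_ge0.
have a2 : 0 <= r `^ p + r `^ q by rewrite addr_ge0 ?powR_ge0.
have a3 : r `^ p + r `^ q <= 2 * (1 + r) by lra.
have a4 := le_trans a2 a3.
apply: (@le_trans _ _ (2 * (r `^ (- 2^-1) * (1 + r) ^+ 2) * (2 * (1 + r)))).
  exact: ler_pM.
rewrite /psi [leLHS](_ : _ = 4 * (r `^ (- 2^-1) * (1 + r) ^+ 3)); last by ring.
rewrite ler_pM2l// ler_wpM2l ?powR_ge0// ler_weXn2l// lerDl ltW//.
Qed.

Lemma psi_ge2 r p q : 0 < r -> 0 <= p <= 1 -> 0 <= q <= 1 ->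
  (`|ln r| + 1) * (r `^ p + r `^ q) ^+ 2 <= 8 * psi r.
Proof.
move=> r0 p01 q01.
have h1 := norm_ln_le r0; have h2 := powR_le1D r0 p01; have h3 := powR_le1D r0 q01.
have a1 : 0 <= `|ln r| + 1 by rewrite addr_ge0.
have a2 : 0 <= r `^ p + r `^ q by rewrite addr_ge0 ?powR_ge0.
have a3 : r `^ p + r `^ q <= 2 * (1 + r) by lra.
have a4 := le_trans a2 a3.
apply: (@le_trans _ _ (2 * (r `^ (- 2^-1) * (1 + r) ^+ 2) * (2 * (1 + r)) ^+ 2)).
  by apply: ler_pM => //; rewrite ?sqr_ge0// lerXn2r ?nnegrE.
by rewrite /psi le_eqVlt; apply/orP; left; apply/eqP; ring.
Qed.

Lemma gint_lip p q : 0 <= p <= 1 -> 0 <= q <= 1 ->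
  `|gint p - gint q| <= `|p - q| * gintK.
Proof.
move=> p01 q01; have /andP[p0 p1] := p01; have /andP[q0 q1] := q01.
have ip := integ_gint p0; have iq := integ_gint q0.
have i1 := integZ 4 (measurable_itv _) (integ_psi (@ltr01 R)).
rewrite /gint -(RintegralB (mR (measurable_itv _)) ip iq) /gintK -(RintZ _ (measurable_itv _) i1).
apply: norm_Rint_le => //.
- exact: integ_measurable (integB (measurable_itv _) ip iq).
- exact: integZ.
- move=> r /I0P r0; rewrite -mulrBl normrM (gtr0_norm (expR_gt0 _)) mul1r !mulrA.
  rewrite ler_wpM2r ?expR_ge0// (le_trans (powR_diff_le p q r0))// -!mulrA ler_wpM2l//.
  apply: le_trans (psi_ge r0 p01 q01).
  by rewrite ler_wpM2r ?addr_ge0 ?powR_ge0// lerDl.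
Qed.

Lemma gintK_ge0 : 0 <= gintK.
Proof.
apply: Rintegral_ge0 => r /I0P r0.
by rewrite !mulr_ge0 ?expR_ge0 ?powR_ge0 ?exprn_ge0// addr_ge0// ltW.
Qed.

(** The kernel of the second term in [1 / (z^c + l) = 1 / l - z^c / l^2 + ...]. The first term does
    not depend on the order and drops out of differences. *)
Definition mrq c t r : R := complex.Im (cis th * cexp t r th * cpow c r th).

Lemma cpowM c t r : 0 < t -> 0 < r -> cpow c (t * r) th = (t `^ c)%:C * cpow c r th.
Proof.
move=> t0 r0; rewrite /cpow powRM ?(ltW t0) ?(ltW r0)// rmorphM/=; ring.
Qed.

Lemma cexpM t r : cexp 1 (t * r) th = cexp t r th :> R[i].
Proof. by rewrite /cexp !mul1r. Qed.

(** The scaling [r -> t r] of [gamma_ray]: the origin of [t^(-c-1)] and of the sine in the main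
    term. *)
Lemma mrq_integral c t : 0 <= c <= 1 -> 0 < t ->
  integ I0 (mrq c t) /\
  \int[mu]_(r in I0) mrq c t r = - (t `^ (- c - 1) * (sin (pi * c) * gint c)).
Proof.
move=> c01 t0; have [i1 e1] := gamma_ray c01; have [i2 e2] := I0_scale t0 i1.
have tc : 0 < t `^ c by rewrite powR_gt0.
have E r : I0 r -> t `^ (- c) * complex.Im (cis th * cexp 1 (t * r) th * cpow c (t * r) th) = mrq c t r.
  move=> /I0P r0; rewrite -ImZ /mrq cexpM cpowM//; congr complex.Im.
  rewrite [LHS](_ : _ = ((t `^ (- c))%:C * (t `^ c)%:C) * (cis th * cexp t r th * cpow c r th)); last by ring.
  by rewrite -rmorphM/= powRN mulVf ?gt_eqF// mul1r.
have i3 := integZ (t `^ (- c)) (measurable_itv _) i2.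
split; first exact: (integ_ext (measurable_itv _) E i3).
rewrite -(eq_Rint E) (RintZ _ (measurable_itv _) i2).
move: e2; rewrite e1 -/(gint c) => e2.
rewrite -powR_mulV//; move: (sin _) (gint c) (Rintegral _ _ _) (t `^ _) e2 => S G X P e2.
have -> : X = - S * G / t by rewrite e2; field; rewrite gt_eqF.
by field; rewrite gt_eqF.
Qed.

(* What is left of [mlq p - mlq q] once
   [((z^p + l) (z^q + l))^-1] is replaced by [l^-2]. *)
Definition rrem p q l t r : R := complex.Im (cis th * cexp t r th *
  (cpow q r th - cpow p r th) *
  (((cpow p r th + l%:C) * (cpow q r th + l%:C))^-1 - (l ^- 2)%:C)).

Lemma mlq_diff p q l t r : 0 < p <= 1 -> 0 < q <= 1 -> 0 < l -> 0 <= r ->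
  mlq p l t r - mlq q l t r = l ^- 2 * (mrq q t r - mrq p t r) + rrem p q l t r.
Proof.
move=> p01 q01 l0 r0.
have np := den_neq0 p01 l0 r0; have nq := den_neq0 q01 l0 r0.
rewrite /mlq /mrq /rrem -!(ImN, ImD) -ImZ -ImD; congr complex.Im.
move: (cis th * cexp t r th) (cpow p r th) (cpow q r th) (l%:C) (l ^- 2)%:C np nq => z a b k m np nq.
by field; rewrite nq.
Qed.

Lemma mlq_diff_le p q l t r : 0 < p <= 1 -> 0 < q <= 1 -> 0 < l -> 0 < r ->
  `|mlq p l t r - mlq q l t r| <=
  `|p - q| * ((1 + 2 * th) * 4 / (dd * l) ^+ 2) * (psi r * expR (- (kap * t * r))).
Proof.
move=> p01 q01 l0 r0; have r0' := ltW r0.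
have np := den_neq0 p01 l0 r0'; have nq := den_neq0 q01 l0 r0'.
have -> : mlq p l t r - mlq q l t r = complex.Im (cis th * cexp t r th *
   ((cpow q r th - cpow p r th) * ((cpow p r th + l%:C)^-1 * (cpow q r th + l%:C)^-1))).
  rewrite /mlq -ImN -ImD; congr complex.Im.
  move: (cis th * cexp t r th) (cpow p r th) (cpow q r th) (l%:C) np nq => z a b k np nq.
  by field; rewrite nq.
apply: (le_trans (Im_le_cabs _)); rewrite cabsM (cabsM (cis th)) cabs_cis mul1r cexp_th.
rewrite (cabsM (_ - _)) (cabsM (_^-1)).
have h1 := cpow_diff_le q p r0; rewrite distrC in h1.
have dl : 0 < dd * l by rewrite mulr_gt0 ?dd_gt0.
have hl c : 0 < c <= 1 -> cabs (cpow c r th + l%:C)^-1 <= (dd * l)^-1.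
  move=> c01; apply: (le_trans (cabs_denV c01 l0 r0')).
  rewrite lef_pV2 ?posrE ?den_gt0//.
  by rewrite ler_wpM2l ?(ltW (@dd_gt0 R))// lerDr powR_ge0.
have h2 := hl _ p01; have h3 := hl _ q01.
have pp : 0 <= p <= 1 by have /andP[/ltW-> ->] := p01.
have qq : 0 <= q <= 1 by have /andP[/ltW-> ->] := q01.
have h4 : cabs (cpow q r th - cpow p r th) <= `|p - q| * ((1 + 2 * th) * (4 * psi r)).
  apply: (le_trans h1); rewrite -mulrA ler_wpM2l//.
  apply: (@le_trans _ _ ((1 + 2 * th) * ((`|ln r| + 1) * (r `^ p + r `^ q)))).
    rewrite [leRHS]mulrA [r `^ q + _]addrC ler_wpM2r ?addr_ge0 ?powR_ge0//.
    have := @th_gt0 R; have := normr_ge0 (ln r); nra.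
  by rewrite ler_wpM2l ?psi_ge// addr_ge0// mulr_ge0// ltW// th_gt0.
apply: (@le_trans _ _ (expR (- (kap * t * r)) * (`|p - q| * ((1 + 2 * th) * (4 * psi r)) * ((dd * l)^-1 * (dd * l)^-1)))).
  rewrite ler_wpM2l ?expR_ge0//; apply: ler_pM => //; rewrite ?mulr_ge0 ?cabs_ge0//.
  by apply: ler_pM; rewrite ?cabs_ge0.
rewrite le_eqVlt; apply/orP; left; apply/eqP.
by move: (th) (psi r) (expR _) (dd * l) dl => ? a b d d0; field; rewrite gt_eqF.
Qed.

(** At a fixed time, but with one constant for all [l >= l1]: this carries continuity in the order
    over from the scalar functions to [W]. *)
Lemma mlf_lip_order l1 t : 0 < l1 -> 0 < t -> exists2 C, 0 <= C &
  forall l p q, l1 <= l -> 0 < p <= 1 -> 0 < q <= 1 ->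
  `|mlf p l t - mlf q l t| <= C * `|p - q|.
Proof.
move=> l10 t0; have kt := kap_t_gt0 t0; have i1 := integ_psi kt.
pose I := \int[mu]_(r in I0) (psi r * expR (- (kap * t * r))).
have I_ge0 : 0 <= I.
  apply: Rintegral_ge0 => r /I0P r0.
  by rewrite !mulr_ge0 ?expR_ge0 ?powR_ge0 ?exprn_ge0// addr_ge0// ltW.
pose C l := (1 + 2 * th) * 4 / (dd * l) ^+ 2.
have C0 l : 0 <= C l.
  rewrite divr_ge0 ?sqr_ge0// mulr_ge0// addr_ge0// mulr_ge0//; exact/ltW/th_gt0.
exists (pi^-1 * (C l1 * I)); first by rewrite mulr_ge0 ?invr_ge0 ?pi_ge0// mulr_ge0 ?C0.
move=> l p q l1l p01 q01; have l0 : 0 < l by apply: lt_le_trans l1l.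
have ip := mlq_integ p01 l0 t0; have iq := mlq_integ q01 l0 t0.
rewrite /mlf -mulrBr -(RintegralB (mR (measurable_itv _)) ip iq).
rewrite normrM gtr0_norm ?invr_gt0 ?pi_gt0// -mulrA ler_pM2l ?invr_gt0 ?pi_gt0//.
have h : `|\int[mu]_(r in I0) (mlq p l t r - mlq q l t r)| <= `|p - q| * C l * I.
  rewrite /I -(RintZ _ (measurable_itv _) i1); apply: norm_Rint_le => //.
  - exact: integ_measurable (integB (measurable_itv _) ip iq).
  - exact: integZ.
  - by move=> r /I0P r0; exact: mlq_diff_le.
apply: (@le_trans _ _ (`|p - q| * C l1 * I)); last first.
  by rewrite le_eqVlt; apply/orP; left; apply/eqP; ring.
apply: (le_trans h); apply: ler_wpM2r => //; apply: ler_wpM2l => //.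
rewrite /C ler_wpM2l//; first by rewrite mulr_ge0// addr_ge0// mulr_ge0//; exact/ltW/th_gt0.
have dl : 0 < dd * l by rewrite mulr_gt0 ?dd_gt0.
have dl1 : 0 < dd * l1 by rewrite mulr_gt0 ?dd_gt0.
rewrite lef_pV2 ?posrE ?exprn_gt0// lerXn2r ?nnegrE ?(ltW dl) ?(ltW dl1)//.
by rewrite ler_pM2l ?dd_gt0.
Qed.

Definition remK : R := \int[mu]_(r in I0) (16 / dd ^+ 2 * (psi r * expR (- (kap * r)))).

Lemma remK_ge0 : 0 <= remK.
Proof.
apply: Rintegral_ge0 => r /I0P r0.
rewrite mulr_ge0 ?divr_ge0 ?sqr_ge0// mulr_ge0 ?expR_ge0//.
by rewrite /psi mulr_ge0 ?powR_ge0// exprn_ge0// addr_ge0// ltW.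
Qed.

Lemma bracket_le p q l r : 0 < p <= 1 -> 0 < q <= 1 -> 0 < l -> 0 <= r ->
  cabs (((cpow p r th + l%:C) * (cpow q r th + l%:C))^-1 - (l ^- 2)%:C) <=
  (r `^ p + r `^ q) / (dd ^+ 2 * l ^+ 3).
Proof.
move=> p01 q01 l0 r0; have d0 := @dd_gt0 R.
have np := den_neq0 p01 l0 r0; have nq := den_neq0 q01 l0 r0.
have lC : l%:C != 0 :> R[i] by rewrite (inj_eq (@complexI R)) gt_eqF.
(* Each summand of this splitting has one power of [z] and three factors of size [1 / l], whence
   [l^3] in the denominator of the bound. *)
have -> : ((cpow p r th + l%:C) * (cpow q r th + l%:C))^-1 - (l ^- 2)%:C =
    - ((l^-1)%:C * (cpow p r th * ((cpow p r th + l%:C)^-1 * (cpow q r th + l%:C)^-1)) +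
     (l ^- 2)%:C * (cpow q r th * (cpow q r th + l%:C)^-1)).
  rewrite !fmorphV/= rmorphXn/=.
  move: (cpow p r th) (cpow q r th) (l%:C) np nq lC => a b k np nq k0.
  by field; rewrite ?np ?nq ?k0.
have dl : 0 < dd * l by rewrite mulr_gt0.
have hl c : 0 < c <= 1 -> cabs (cpow c r th + l%:C)^-1 <= (dd * l)^-1.
  move=> c01; apply: (le_trans (cabs_denV c01 l0 r0)).
  rewrite lef_pV2 ?posrE ?den_gt0//.
  by rewrite ler_wpM2l ?(ltW d0)// lerDr powR_ge0.
rewrite cabsN (le_trans (cabsD _ _))// (cabsM (l^-1)%:C) (cabsM (l ^- 2)%:C) !cabs_real.
rewrite (cabsM (cpow p r th)) (cabsM (cpow q r th)) (cabsM (_^-1)) !cabs_cpow.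
rewrite !ger0_norm ?invr_ge0 ?sqr_ge0 ?(ltW l0)//.
apply: (@le_trans _ _ (l^-1 * (r `^ p * ((dd * l)^-1 * (dd * l)^-1)) + l ^- 2 * (r `^ q * (dd * l)^-1))).
  apply: lerD; rewrite ler_wpM2l ?invr_ge0 ?sqr_ge0 ?(ltW l0)// ler_wpM2l ?powR_ge0// ?hl//.
  by apply: ler_pM; rewrite ?cabs_ge0// hl.
have d1 := @dd_le1 R; have rq : 0 <= r `^ q by rewrite powR_ge0.
rewrite mulrDl lerD//.
  by rewrite le_eqVlt; apply/orP; left; apply/eqP; field; rewrite !gt_eqF.
rewrite [leLHS](_ : _ = r `^ q / (dd * l ^+ 3)); last by field; rewrite !gt_eqF.
rewrite ler_wpM2l// lef_pV2 ?posrE ?mulr_gt0 ?exprn_gt0//.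
by rewrite ler_wpM2r ?exprn_ge0 ?(ltW l0)// expr2 ler_piMl// ltW.
Qed.

(** At [r = s / t] the difference of powers and the bracket contribute [t^(-p)] each, and [ln r]
    contributes [ln t]. The remainder thus gains a factor [t^(-p)] over the main term, at the price
    of a logarithm, and keeps [q - p]. *)
Lemma rrem_bound p q l t s : 0 < p <= 1 -> p <= q <= 1 -> 0 < l -> 1 <= t -> 0 < s ->
  `|rrem p q l t (t^-1 * s)| <= (q - p) * (1 + 2 * th + ln t) * t `^ (- (2 * p)) / l ^+ 3 *
    (16 / dd ^+ 2 * (psi s * expR (- (kap * s)))).
Proof.
move=> p01 pq l0 t1 s0; have t0 : 0 < t by apply: lt_le_trans t1.
have /andP[p0 p1] := p01; have /andP[pq' q1] := pq.
have q0 : 0 < q by apply: lt_le_trans pq'.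
have q01 : 0 < q <= 1 by rewrite q0.
set r := t^-1 * s; have r0 : 0 < r by rewrite mulr_gt0 ?invr_gt0.
have d0 := @dd_gt0 R; have h0 := @th_gt0 R; have L0 : 0 <= ln t by rewrite ln_ge0.
have h1 := cpow_diff_le q p r0; have h2 := bracket_le p01 q01 l0 (ltW r0).
rewrite ger0_norm ?subr_ge0// in h1.
pose X := s `^ p + s `^ q; have X0 : 0 <= X by rewrite addr_ge0 ?powR_ge0.
have hX : r `^ p + r `^ q <= t `^ (- p) * X.
  rewrite /r !powRM ?invr_ge0 ?(ltW t0) ?(ltW s0)// -!powR_inv1 ?(ltW t0)// -!powRrM !mulN1r.
  rewrite mulrDr lerD2l ler_wpM2r ?powR_ge0// ler_powR// lerN2//.
have lnr : `|ln r| + 2 * th <= (1 + 2 * th + ln t) * (`|ln s| + 1).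
  have : `|ln r| <= `|ln s| + ln t.
    rewrite /r lnM ?posrE ?invr_gt0// lnV ?posrE// addrC.
    by rewrite (le_trans (ler_normB _ _))// (ger0_norm L0).
  have := normr_ge0 (ln s); move: (ln t) L0 => L L0; nra.
have Xp : 0 <= t `^ (- p) * X by rewrite mulr_ge0 ?powR_ge0.
have rX : 0 <= r `^ p + r `^ q by rewrite addr_ge0 ?powR_ge0.
rewrite /rrem (le_trans (Im_le_cabs _))//.
rewrite cabsM (cabsM (_ * _) (_ - _)) (cabsM (cis th)) cabs_cis mul1r cexp_th.
have -> : kap * t * r = kap * s by rewrite /r mulrA mulfK ?gt_eqF.
have dl3 : 0 < dd ^+ 2 * l ^+ 3 by rewrite mulr_gt0 ?exprn_gt0.
apply: (@le_trans _ _ (expR (- (kap * s)) * ((q - p) * ((1 + 2 * th + ln t) * (`|ln s| + 1)) * (t `^ (- p) * X)) *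
   ((t `^ (- p) * X) / (dd ^+ 2 * l ^+ 3)))).
  apply: ler_pM; rewrite ?cabs_ge0// ?mulr_ge0 ?expR_ge0 ?cabs_ge0//.
    rewrite ler_wpM2l ?expR_ge0// (le_trans h1)// [r `^ q + _]addrC.
    apply: ler_pM => //; first by rewrite mulr_ge0 ?subr_ge0// addr_ge0// mulr_ge0// ltW.
    by rewrite ler_wpM2l// subr_ge0.
  by rewrite (le_trans h2)// ler_wpM2r// invr_ge0 ltW.
have e : t `^ (- (2 * p)) = t `^ (- p) * t `^ (- p).
  rewrite -powRD; last by rewrite (gt_eqF t0) implybT.
  by congr (_ `^ _); ring.
have h3 := psi_ge2 s0 (p := p) (q := q).
have {}h3 : (`|ln s| + 1) * X ^+ 2 <= 8 * psi s by apply: h3; [rewrite ltW|rewrite ltW].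
rewrite e [leLHS](_ : _ = (q - p) * (1 + 2 * th + ln t) * (t `^ (- p) * t `^ (- p)) / l ^+ 3 *
   (expR (- (kap * s)) / dd ^+ 2) * ((`|ln s| + 1) * X ^+ 2)); last first.
  move: (th) (expR _) (ln t) (`|ln s|) (t `^ _) (dd) d0 => ? ? ? ? ? d d0'.
  by field; rewrite !gt_eqF.
rewrite [leRHS](_ : _ = (q - p) * (1 + 2 * th + ln t) * (t `^ (- p) * t `^ (- p)) / l ^+ 3 *
   (expR (- (kap * s)) / dd ^+ 2) * (16 * psi s)); last first.
  move: (th) (expR _) (ln t) (psi s) (t `^ _) (dd) d0 => ? ? ? ? ? d d0'.
  by field; rewrite !gt_eqF.
apply: ler_wpM2l.
  have a1 : 0 <= 1 + 2 * th + ln t by rewrite addr_ge0// addr_ge0// mulr_ge0// ltW.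
  rewrite !mulr_ge0 ?subr_ge0 ?powR_ge0 ?expR_ge0 ?invr_ge0 ?exprn_ge0 ?(ltW l0) ?(ltW d0)//.
apply: (le_trans h3); rewrite ler_wpM2r//; last by clear; lra.
by rewrite /psi mulr_ge0 ?powR_ge0// exprn_ge0// addr_ge0// ltW.
Qed.

End order_dependence.

(** * Strict monotonicity in the order at large times *)

Section order_monotonicity.
Context {R : realType}.
Notation mu := (@lebesgue_measure R).
Notation I0 := (`](0 : R), +oo[%classic).
Notation th := (@th R).
Notation dd := (@dd R).
Notation kap := (@kap R).
Implicit Types (r a b c d k l p q t u v x y m s L : R).

(** The remainder is integrable as a difference of integrable kernels; the substitution [r = s / t]
    gives the final factor [1 / t]. *)
Lemma rrem_integral p q l t : 0 < p <= 1 -> p <= q <= 1 -> 0 < l -> 1 <= t ->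
  integ I0 (rrem p q l t) /\
  `|\int[mu]_(r in I0) rrem p q l t r| <=
    (q - p) * (1 + 2 * th + ln t) * t `^ (- (2 * p)) / l ^+ 3 * remK / t.
Proof.
move=> p01 pq l0 t1; have t0 : 0 < t by apply: lt_le_trans t1.
have /andP[p0 p1] := p01; have /andP[pq' q1] := pq.
have q01 : 0 < q <= 1 by rewrite (lt_le_trans p0 pq').
have pp : 0 <= p <= 1 by rewrite (ltW p0).
have qq : 0 <= q <= 1 by rewrite (ltW (lt_le_trans p0 pq')).
have mI := measurable_itv (`](0 : R), +oo[ : interval R).
have i1 := integB mI (mlq_integ p01 l0 t0) (mlq_integ q01 l0 t0).
have i2 := integZ (l ^- 2) mI (integB mI (mrq_integral qq t0).1 (mrq_integral pp t0).1).
have E r : I0 r -> (mlq p l t r - mlq q l t r) - l ^- 2 * (mrq q t r - mrq p t r) = rrem p q l t r.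
  by move=> /I0P r0; rewrite mlq_diff ?(ltW r0)// addrC addKr.
have ir : integ I0 (rrem p q l t) := integ_ext mI E (integB mI i1 i2).
split=> //; have ti : 0 < t^-1 by rewrite invr_gt0.
have [i3 ->] := I0_scale ti ir.
have i4 := integZ (16 / dd ^+ 2) mI (integ_psi (@kap_gt0 R)).
rewrite normrM (gtr0_norm ti) mulrC ler_pM2r// /remK -(RintZ _ mI i4).
apply: norm_Rint_le => //; first exact: integ_measurable i3.
- exact: integZ.
- by move=> s /I0P s0; exact: rrem_bound.
Qed.

Lemma mlf_diff p q l t : 0 < p <= 1 -> p <= q <= 1 -> 0 < l -> 1 <= t ->
  pi * (mlf p l t - mlf q l t) =
  l ^- 2 * (t `^ (- p - 1) * (sin (pi * p) * gint p) - t `^ (- q - 1) * (sin (pi * q) * gint q)) +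
  \int[mu]_(r in I0) rrem p q l t r.
Proof.
move=> p01 pq l0 t1; have t0 : 0 < t by apply: lt_le_trans t1.
have /andP[p0 p1] := p01; have /andP[pq' q1] := pq.
have q01 : 0 < q <= 1 by rewrite (lt_le_trans p0 pq').
have pp : 0 <= p <= 1 by rewrite (ltW p0).
have qq : 0 <= q <= 1 by rewrite (ltW (lt_le_trans p0 pq')).
have mI := measurable_itv (`](0 : R), +oo[ : interval R).
have [ir _] := rrem_integral p01 pq l0 t1.
have [ip ep] := mrq_integral pp t0; have [iq eq] := mrq_integral qq t0.
have jp := mlq_integ p01 l0 t0; have jq := mlq_integ q01 l0 t0.
have pn : (pi : R) != 0 by rewrite gt_eqF ?pi_gt0.
rewrite mulrBr /mlf !mulVKf//.
rewrite -(RintegralB (mR mI) jp jq).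
have i2 := integZ (l ^- 2) mI (integB mI iq ip).
rewrite -[X in _ = X + _](_ : l ^- 2 * \int[mu]_(r in I0) (mrq q t r - mrq p t r) = _); last first.
  by rewrite (RintegralB (mR mI) iq ip) ep eq opprK [in LHS]addrC.
rewrite -(RintZ _ mI (integB mI iq ip)) -(RintegralD (mR mI) i2 ir).
by apply: eq_Rint => r /I0P r0; rewrite mlq_diff ?(ltW r0).
Qed.

(** From [expR x >= 1 + x] and [(1 + x) (1 - x / 2) >= 1] on [[0, 1]]. *)
Lemma expN_le_half x : 0 <= x <= 1 -> expR (- x) <= 1 - x / 2.
Proof.
move=> /andP[x0 x1]; have h := expR_ge1Dx x.
have e0 := expR_gt0 x; rewrite expRN -div1r ler_pdivrMr//.
by nra.
Qed.

(** For orders above [3 / 4] the angle [pi c] lies in [[th, pi]], where minus the cosine is at least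
    [kap]; the mean value theorem concludes. *)
Lemma sin_drop p q : 3 / 4 <= p -> p <= q -> q <= 1 ->
  pi * kap * (q - p) <= sin (pi * p) - sin (pi * q).
Proof.
move=> p34; rewrite le_eqVlt => /predU1P[->|pq] q1; first by rewrite !subrr mulr0.
have pi0 := @pi_gt0 R.
have [x|c [/andP[pc cq] e]] := @mvt R (fun x => sin (pi * x)) (fun x => pi * cos (pi * x)) _ _ pq.
  move=> _; apply: der_eq (@der_comp _ (@sin R) _ _ _ _ (is_derive_sin _) (derZ pi (der_id x))) _.
  by ring.
rewrite -[leRHS]opprB e -mulNr ler_wpM2r ?subr_ge0 ?(ltW pq)// -mulrN ler_pM2l//.
rewrite /kap lerN2; apply: cos_decr; first exact/ltW/th_gt0.
  have -> : th = 3 / 4 * pi by []; rewrite mulrC ler_pM2l//; apply: (le_trans p34); exact: ltW.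
by rewrite -[leRHS]mulr1 ler_pM2l// (le_trans (ltW cq)).
Qed.

Lemma sin_lower a : 0 < a < 1 -> exists2 s, 0 < s & forall x, a <= x <= 7 / 8 -> s <= sin (pi * x).
Proof.
move=> /andP[a0 a1]; have pi0 := @pi_gt0 R.
have [a78|a78] := ltP (7 / 8) a.
  by exists 1 => // x /andP[h1 h2]; have := lt_le_trans a78 (le_trans h1 h2); rewrite ltxx.
have cs : {within `[a, 7 / 8], continuous (fun x : R => sin (pi * x))}.
  apply: continuous_in_subspaceT => x _.
  exact: is_derive_continuous (@der_comp _ (@sin R) _ _ _ _ (is_derive_sin _) (derZ pi (der_id x))).
have [c cI hc] := EVT_min a78 cs; move: cI; rewrite in_itv/= => /andP[c1 c2].
exists (sin (pi * c)) => [|x xI]; last by apply: hc; rewrite in_itv.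
apply: sin_gt0_pi; rewrite (mulr_gt0 pi0 (lt_le_trans a0 c1))/=.
by rewrite -[ltRHS]mulr1 ltr_pM2l//; apply: (le_lt_trans c2); lra.
Qed.

(** Here [P] is [pi], [k] is [kap], [K] the Lipschitz constant of [gint], [d] the gap, [E] the
    exponential; primes mark the larger order. The quantity equals
    [g (S - S') + (g - g') S' + g' S' (1 - E)]. In the first case the drop of the sine gives the
    result, and the last term, at least [S' d L / 4], pays for [K d S']. In the second case
    [S' >= s] and the last term pays for everything. The threshold on [L] is the sum of the two
    requirements. *)
Lemma main_term_algebra (P k K s L d g g' S S' E : R) :
  0 < P -> 0 < k -> 0 <= K -> 0 < s -> 0 <= d -> 1 <= L ->
  4 * K + 4 * (4 * P + K + P * k / 2) / s <= L ->
  2^-1 <= g -> g <= 4 -> 2^-1 <= g' -> - (d * K) <= g - g' ->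
  0 <= S' -> S' <= 1 -> d * L / 2 <= 1 - E ->
  P * k * d <= S - S' \/ s <= S' /\ `|S - S'| <= P * d ->
  P * k / 2 * d <= S * g - E * (S' * g').
Proof.
move=> P0 k0 K0 s0 d0 L1 hL g1 g2 g'1 gg S'0 S'1 hE hS.
have X0 : 0 <= 4 * P + K + P * k / 2.
  by rewrite addr_ge0 ?(ltW (divr_gt0 (mulr_gt0 P0 k0) _))// addr_ge0// mulr_ge0// ltW.
have -> : S * g - E * (S' * g') = g * (S - S') + (g - g') * S' + g' * S' * (1 - E) by ring.
have dL0 : 0 <= d * L / 2 by rewrite divr_ge0// mulr_ge0// (le_trans ler01).
have t3 : 2^-1 * S' * (d * L / 2) <= g' * S' * (1 - E).
  by apply: ler_pM => //; rewrite ?mulr_ge0// ler_wpM2r.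
have t2 : - (d * K) * S' <= (g - g') * S' by rewrite ler_wpM2r.
case: hS => [h|[hS h]].
  have t1 : 2^-1 * (P * k * d) <= g * (S - S').
    by apply: ler_pM => //; rewrite !mulr_ge0 ?(ltW P0) ?(ltW k0).
  have KL : 4 * K <= L.
    by apply: le_trans hL; rewrite lerDl divr_ge0 ?(ltW s0)// mulr_ge0.
  have t4 : 0 <= (d * S') * (L - 4 * K) by rewrite mulr_ge0 ?mulr_ge0// subr_ge0.
  move: t1 t2 t3 t4; clear; lra.
have t1 : - (4 * (P * d)) <= g * (S - S').
  have : `|g * (S - S')| <= 4 * (P * d).
    have g0 : 0 <= g by apply: le_trans g1; rewrite invr_ge0.
    by rewrite normrM ger0_norm//; apply: ler_pM.
  by rewrite ler_norml => /andP[].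
have t2' : - (d * K) <= - (d * K) * S' by rewrite mulNr lerN2 ler_piMr// mulr_ge0.
have KL : 4 * (4 * P + K + P * k / 2) <= s * L.
  by rewrite [leRHS]mulrC -ler_pdivrMr//; apply: le_trans hL; rewrite lerDr mulr_ge0.
have t3' : 2^-1 * s * (d * L / 2) <= 2^-1 * S' * (d * L / 2).
  by rewrite ler_wpM2r// ler_pM2l ?invr_gt0.
have t4 : 0 <= d * (s * L - 4 * (4 * P + K + P * k / 2)) by rewrite mulr_ge0// subr_ge0.
move: t1 t2 t2' t3 t3' t4; clear; lra.
Qed.

(* For gaps [d <= L^-1], [expR (- (d L)) <= 1 - d L / 2] outweighs the variation
   of [sin (pi p) Gamma (p + 1)] away from [p = 1], where [sin] itself decreases. *)
Lemma main_term_lower a : 0 < a < 1 -> exists L0, forall L p q, L0 <= L -> 1 <= L ->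
  a <= p -> p <= q -> q <= 1 -> q - p <= 8^-1 -> (q - p) * L <= 1 ->
  pi * kap / 2 * (q - p) <=
  sin (pi * p) * gint p - expR (- ((q - p) * L)) * (sin (pi * q) * gint q).
Proof.
move=> a01; have /andP[a0 a1] := a01; have [s s0 hs] := sin_lower a01.
have pi0 := @pi_gt0 R; have k0 := @kap_gt0 R; have K0 := @gintK_ge0 R.
exists (4 * gintK + 4 * (4 * pi + gintK + pi * kap / 2) / s) => L p q hL L1 ap pq q1 d8 dL.
have p0 : 0 < p by apply: lt_le_trans ap.
have p01 : 0 <= p <= 1 by rewrite (ltW p0) (le_trans pq).
have q01 : 0 <= q <= 1 by rewrite (le_trans (ltW p0) pq).
have /andP[gp1 gp2] := gint_itv p01; have /andP[gq1 gq2] := gint_itv q01.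
have d0 : 0 <= q - p by rewrite subr_ge0.
have hG := gint_lip p01 q01.
rewrite distrC [`|p - q|]distrC [`|q - p|]ger0_norm// distrC ler_norml in hG.
have /andP[hG1 _] := hG.
apply: (main_term_algebra pi0 k0 K0 s0 d0 L1 hL gp1 gp2 gq1 hG1).
- by apply: sin_ge0_pi; rewrite mulr_ge0 ?(ltW pi0) ?(le_trans (ltW p0) pq)//= ler_piMr// ltW.
- exact: sin_le1.
- have := @expN_le_half ((q - p) * L); rewrite dL andbT mulr_ge0// ?(le_trans ler01 L1)// => /(_ isT).
  by rewrite lerBrDl -lerBrDr.
(* Either both orders lie where the sine decreases, or [q <= 7 / 8] because the gap is at most
   [1 / 8], and the sine at [q] is bounded below. *)
have [p34|p34] := leP (3 / 4) p; [left; exact: sin_drop|right; split].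
  apply: hs; rewrite (le_trans ap pq)/=; move: d8 p34; clear; lra.
rewrite (le_trans (sin_lip _ _))// -mulrBr normrM (gtr0_norm pi0) distrC.
by rewrite ger0_norm.
Qed.

Lemma sqr_le_expR x : 0 <= x -> x ^+ 2 / 4 <= expR x.
Proof.
move=> x0; have h := expR_ge1Dx (x / 2).
have -> : expR x = expR (x / 2) ^+ 2 by rewrite expr2 -expRD; congr expR; field.
rewrite [leLHS](_ : _ = (x / 2) ^+ 2); last by field.
rewrite lerXn2r ?nnegrE ?expR_ge0 ?divr_ge0//; apply: le_trans h; lra.
Qed.

(** The admissible gap [e] shrinks with [t] but is the same for all [l], [p] and [q]; this allows
    the chaining in [mlf_decr]. *)
Lemma mlf_decr_step a l1 : 0 < a < 1 -> 0 < l1 -> exists T0, 1 <= T0 /\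
  forall t, T0 <= t -> exists2 e, 0 < e & forall l p q, l1 <= l ->
  a <= p -> p < q -> q <= 1 -> q - p <= e -> mlf q l t < mlf p l t.
Proof.
move=> a01 l10; have /andP[a0 a1] := a01; have [L0 hL0] := main_term_lower a01.
have pi0 := @pi_gt0 R; have k0 := @kap_gt0 R; have th0 := @th_gt0 R; have K0 := @remK_ge0 R.
pose c0 := pi * kap / 2.
have c00 : 0 < c0 by rewrite divr_gt0// mulr_gt0.
(* Beyond this value of [ln t] the remainder is smaller than the main term: with [L = ln t], compare
   [(2 + 2 th) L remK] with [c0 l1 (a L)^2 / 4]. *)
pose Q := 4 * (2 + 2 * th) * remK / (c0 * l1 * a ^+ 2).
have ca : 0 < c0 * l1 * a ^+ 2 by rewrite mulr_gt0 ?exprn_gt0// mulr_gt0.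
have Q0 : 0 <= Q by rewrite divr_ge0 ?(ltW ca)// !mulr_ge0// addr_ge0// mulr_ge0// ltW.
(* Dominates [L0], 1 and [Q] together; the threshold time is then [expR Lm]. *)
pose Lm := Num.max L0 0 + 1 + Q.
have mx0 : 0 <= Num.max L0 0 by rewrite le_max lexx orbT.
have mxL : L0 <= Num.max L0 0 by rewrite le_max lexx.
exists (expR Lm); split; first by rewrite -expR0 ler_expR /Lm; lra.
move=> t tT; have t0 : 0 < t by apply: lt_le_trans tT; exact: expR_gt0.
pose L := ln t; have hL : Lm <= L by rewrite /L -(expRK Lm) ler_ln ?posrE ?expR_gt0.
have L1 : 1 <= L by rewrite /Lm in hL; lra.
have LL0 : L0 <= L by rewrite /Lm in hL; lra.
have LQ : Q < L by rewrite /Lm in hL; lra.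
have Lp : 0 < L by apply: lt_le_trans L1.
have t1 : 1 <= t by apply: le_trans tT; rewrite -expR0 ler_expR /Lm; lra.
have powE x : t `^ x = expR (x * L) by rewrite /powR gt_eqF.
(* The two restrictions on the gap in [main_term_lower]. *)
exists (Num.min 8^-1 L^-1); first by rewrite lt_min !invr_gt0 Lp ltr0n.
move=> l p q l1l ap pq q1; rewrite le_min => /andP[d8 dL].
have l0 : 0 < l by apply: lt_le_trans l1l.
have p0 : 0 < p by apply: lt_le_trans ap.
have p01 : 0 < p <= 1 by rewrite p0 (le_trans (ltW pq)).
have pq1 : p <= q <= 1 by rewrite (ltW pq).
have d0 : 0 < q - p by rewrite subr_gt0.
have dL1 : (q - p) * L <= 1 by rewrite -ler_pdivlMr// mul1r.
have h := hL0 L p q LL0 L1 ap (ltW pq) q1 d8 dL1.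
have [_ hr] := rrem_integral p01 pq1 l0 t1.
rewrite -subr_gt0 -(pmulr_rgt0 _ pi0) mlf_diff//.
move: h hr; set A := _ * gint p; set B := _ * gint q; set Rm := Rintegral _ _ _ => h hr.
have eq1 : t `^ (- q - 1) = t `^ (- p - 1) * expR (- ((q - p) * L)).
  by rewrite !powE -expRD; congr expR; ring.
have -> : t `^ (- p - 1) * A - t `^ (- q - 1) * B = t `^ (- p - 1) * (A - expR (- ((q - p) * L)) * B).
  by rewrite eq1; ring.
have tp : t `^ (- p - 1) = t `^ (- (2 * p)) / t * t `^ p.
  rewrite -powR_mulV//.
  by rewrite !powE mulrAC -!expRD; congr (expR _ / _); ring.
set Z := t `^ (- (2 * p)) in tp hr *.
have Z0 : 0 < Z by rewrite powR_gt0.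
rewrite -/L in hr.
have {}hr : - ((q - p) * (1 + 2 * th + L) * Z / l ^+ 3 * remK / t) <= Rm by move: hr; rewrite ler_norml => /andP[].
(* Remainder against main term after the common factors are removed: [t^p = e^(p L)] is at least
   [(a L)^2 / 4], which outgrows the linear factor in [L]. *)
have kk : (1 + 2 * th + L) * remK < c0 * l * t `^ p.
  have h1 : a ^+ 2 * L ^+ 2 / 4 <= t `^ p.
    rewrite -exprMn; apply: (le_trans (sqr_le_expR _)); first by rewrite mulr_ge0 ?(ltW a0) ?(ltW Lp).
    by rewrite powE ler_expR ler_pM2r.
  apply: (@le_lt_trans _ _ ((2 + 2 * th) * L * remK)).
    apply: ler_wpM2r => //.
    have : 0 <= th * (L - 1) by rewrite mulr_ge0 ?subr_ge0 ?(ltW th0).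
    by move: L1; clear; move: (th) => y; lra.
  apply: (@lt_le_trans _ _ (c0 * l1 * (a ^+ 2 * L ^+ 2 / 4))).
    move: LQ; rewrite /Q ltr_pdivrMr// => LQ.
    rewrite [ltLHS](_ : _ = L / 4 * (4 * (2 + 2 * th) * remK)); last by field.
    rewrite [ltRHS](_ : _ = L / 4 * (L * (c0 * l1 * a ^+ 2))); last by field.
    by rewrite ltr_pM2l// divr_gt0.
  apply: ler_pM => //; first exact/ltW/(mulr_gt0 c00 l10).
    by rewrite divr_ge0// mulr_ge0 ?sqr_ge0.
  by rewrite ler_pM2l.
have main : (q - p) * Z / l ^+ 3 / t * (c0 * l * t `^ p) <=
    l ^- 2 * (t `^ (- p - 1) * (A - expR (- ((q - p) * L)) * B)).
  rewrite tp [leLHS](_ : _ = l ^- 2 * (Z / t * t `^ p * (c0 * (q - p)))); last first.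
    by field; rewrite !gt_eqF.
  rewrite ler_wpM2l ?invr_ge0 ?sqr_ge0// ler_wpM2l// mulr_ge0 ?powR_ge0//.
  by rewrite divr_ge0 ?(ltW Z0) ?(ltW t0).
have : (q - p) * Z / l ^+ 3 / t * ((1 + 2 * th + L) * remK) < (q - p) * Z / l ^+ 3 / t * (c0 * l * t `^ p).
  by rewrite ltr_pM2l// divr_gt0// divr_gt0 ?exprn_gt0// mulr_gt0.
have -> : (q - p) * Z / l ^+ 3 / t * ((1 + 2 * th + L) * remK) =
    (q - p) * (1 + 2 * th + L) * Z / l ^+ 3 * remK / t by ring.
move: main hr; move: (_ / t * (c0 * l * _)) (_ * remK / t) (l ^- 2 * _) => ? ? ?; clear; lra.
Qed.

(** Walk from [p] to [q] in steps of length [e]; the induction is on the number of steps. *)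
Lemma mlf_decr a l1 : 0 < a < 1 -> 0 < l1 -> exists T0, 1 <= T0 /\
  forall t l p q, T0 <= t -> l1 <= l ->
  a <= p -> p < q -> q <= 1 -> mlf q l t < mlf p l t.
Proof.
move=> a01 l10; have [T0 [T1 hT]] := mlf_decr_step a01 l10.
exists T0; split=> // t l p q Tt l1l ap pq q1; have [e e0 he] := hT _ Tt.
have [n] : exists n : nat, q - p <= n.+1%:R * e.
  have h0 : 0 <= (q - p) / e by rewrite divr_ge0 ?subr_ge0 ?ltW.
  exists (Num.bound ((q - p) / e)); rewrite -ler_pdivrMr//.
  by rewrite (le_trans (ltW (archi_boundP h0)))// ler_nat.
elim: n p ap pq => [|n IH] p ap pq hn.
  by apply: he => //; rewrite mul1r in hn.
have [h|h] := leP (q - p) e; first exact: he.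
apply: (@lt_trans _ _ (mlf (p + e) l t)).
  apply: IH.
  - by rewrite (le_trans ap)// lerDl ltW.
  - by rewrite -ltrBrDl.
  - by move: hn; rewrite [n.+2%:R]mulrS mulrDl mul1r; lra.
apply: he => //; first by rewrite ltrDl.
  by rewrite (le_trans _ q1)// -lerBrDl ltW.
by rewrite addrAC subrr add0r.
Qed.

End order_monotonicity.

(** * Hilbert space and eigenfunction expansion *)

Section scalars_facts.
Context {R : realType} {s : scalar_kind}.
Implicit Types (a b : R) (z w : scalars R s).

Lemma real_partD z w : real_part (z + w) = real_part z + real_part w.
Proof. by case: s z w => //= z w; rewrite raddfD. Qed.

Lemma real_partN z : real_part (- z) = - real_part z.
Proof. by case: s z => //= z; rewrite raddfN. Qed.

Lemma real_partZ a z : real_part (of_real s a * z) = a * real_part z.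
Proof. by case: s z => //= -[x y] /=; rewrite mul0r subr0. Qed.

Lemma real_part_of_real a : real_part (of_real s a) = a.
Proof. by case: s. Qed.

Lemma real_part_conj z : real_part (conjugate z) = real_part z.
Proof. by case: s z => //= -[]. Qed.

Lemma conj_of_real a : conjugate (of_real s a) = of_real s a.
Proof. by case: s => //=; rewrite oppr0. Qed.

Lemma of_realD a b : of_real s (a + b) = of_real s a + of_real s b.
Proof. by case: s => //=; rewrite rmorphD. Qed.

Lemma of_realN a : of_real s (- a) = - of_real s a.
Proof. by case: s => //=; rewrite rmorphN. Qed.

Lemma of_realM a b : of_real s (a * b) = of_real s a * of_real s b.
Proof. by case: s => //=; rewrite rmorphM. Qed.

Lemma of_real0 : of_real s (0 : R) = 0.
Proof. by case: s. Qed.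

Lemma of_real1 : of_real s (1 : R) = 1.
Proof. by case: s. Qed.

Lemma norm_of_real a : `|of_real s a| = of_real s `|a|.
Proof. by case: s => //=; rewrite normc_def /= expr0n addr0 sqrtr_sqr. Qed.

Lemma of_real_le a b : (of_real s a <= of_real s b) = (a <= b).
Proof. by case: s => //=; rewrite lecR. Qed.

Lemma of_real_lt a b : (of_real s a < of_real s b) = (a < b).
Proof. by case: s => //=; rewrite ltcR. Qed.

(** In [R[i]] the relation [0 <= z] contains that [z] is real. *)
Lemma ge0_of_real z : 0 <= z -> z = of_real s (real_part z).
Proof.
by case: s z => //= -[x y]; rewrite lecE /= => /andP[/eqP-> _].
Qed.

Lemma real_part_ge0 z : 0 <= z -> 0 <= real_part z.
Proof. by move=> /[dup] /ge0_of_real -> ; rewrite -of_real0 of_real_le real_part_of_real. Qed.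

Lemma real_part_gt0 z : 0 < z -> 0 < real_part z.
Proof.
by move=> /[dup] /ltW/ge0_of_real ->; rewrite -of_real0 of_real_lt real_part_of_real.
Qed.

Lemma real_part_conjM z : real_part (conjugate z * z) = 0 -> z = 0.
Proof.
case: s z => [z|[x y]] /=; first by move/eqP; rewrite mulf_eq0 orbb => /eqP.
rewrite mulNr opprK => h; have [-> ->] : x = 0 /\ y = 0; last by [].
by move: h; rewrite -!expr2 => /eqP; rewrite paddr_eq0 ?sqr_ge0// !sqrf_eq0 => /andP[/eqP-> /eqP->].
Qed.

End scalars_facts.

(** * The underlying real scalar product and norm *)

Section inner_product.
Context {R : realType} {s : scalar_kind} {H : normedModType (scalars R s)}.
Variable (dot : {dot H for @conjugate R s}).
Hypothesis hdot : scalar_product_of_norm dot.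
Implicit Types (a b : R) (x y z : H).

(** The real part is a real bilinear form with the same norm, which treats real and complex scalars
    alike; [rip_adjoint] recovers the full product where it is needed. *)
Definition rip x y : R := real_part (dot x y).

Lemma rscaleD a b x : rscale (a + b) x = rscale a x + rscale b x.
Proof. by rewrite /rscale of_realD scalerDl. Qed.
Lemma rscaleDr a x y : rscale a (x + y) = rscale a x + rscale a y.
Proof. by rewrite /rscale scalerDr. Qed.
Lemma rscaleM a b x : rscale (a * b) x = rscale a (rscale b x).
Proof. by rewrite /rscale of_realM scalerA. Qed.
Lemma rscale0 x : rscale 0 x = 0.
Proof. by rewrite /rscale of_real0 scale0r. Qed.
Lemma rscaler0 a : rscale a (0 : H) = 0.
Proof. by rewrite /rscale scaler0. Qed.
Lemma rscale1 x : rscale 1 x = x.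
Proof. by rewrite /rscale of_real1 scale1r. Qed.
Lemma rscaleN a x : rscale (- a) x = - rscale a x.
Proof. by rewrite /rscale of_realN scaleNr. Qed.
Lemma rscalerN a x : rscale a (- x) = - rscale a x.
Proof. by rewrite /rscale scalerN. Qed.
Lemma rscaleB a b x : rscale (a - b) x = rscale a x - rscale b x.
Proof. by rewrite rscaleD rscaleN. Qed.
Lemma rscaleBr a x y : rscale a (x - y) = rscale a x - rscale a y.
Proof. by rewrite rscaleDr rscalerN. Qed.

Lemma dotDl x y z : dot (x + y) z = dot x z + dot y z.
Proof. exact: linearDl. Qed.
Lemma dotZl (a : scalars R s) x z : dot (a *: x) z = a * dot x z.
Proof. exact: linearZl_LR. Qed.
Lemma dotZr (a : scalars R s) x z : dot x (a *: z) = conjugate a * dot x z.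
Proof. exact: linearZr_LR. Qed.
Lemma dotC x y : dot x y = conjugate (dot y x).
Proof. by rewrite [LHS]hermitian_subproof expr0 mul1r. Qed.

Lemma ripC x y : rip x y = rip y x.
Proof. by rewrite /rip dotC real_part_conj. Qed.
Lemma ripDl x y z : rip (x + y) z = rip x z + rip y z.
Proof. by rewrite /rip dotDl real_partD. Qed.
Lemma ripDr x y z : rip x (y + z) = rip x y + rip x z.
Proof. by rewrite ripC ripDl !(ripC x). Qed.
Lemma ripZl a x y : rip (rscale a x) y = a * rip x y.
Proof. by rewrite /rip dotZl real_partZ. Qed.
Lemma ripZr a x y : rip x (rscale a y) = a * rip x y.
Proof. by rewrite ripC ripZl ripC. Qed.
Lemma ripNl x y : rip (- x) y = - rip x y.
Proof. by rewrite -[x in LHS]rscale1 -rscaleN ripZl mulN1r. Qed.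
Lemma ripNr x y : rip x (- y) = - rip x y.
Proof. by rewrite ripC ripNl ripC. Qed.
Lemma ripBl x y z : rip (x - y) z = rip x z - rip y z.
Proof. by rewrite ripDl ripNl. Qed.
Lemma ripBr x y z : rip x (y - z) = rip x y - rip x z.
Proof. by rewrite ripDr ripNr. Qed.
Lemma rip0l y : rip 0 y = 0.
Proof. by rewrite -(rscale0 0) ripZl mul0r. Qed.
Lemma rip0r y : rip y 0 = 0.
Proof. by rewrite ripC rip0l. Qed.

Lemma normE x : `|x| = of_real s (rnorm x).
Proof. exact: ge0_of_real. Qed.

Lemma rnorm_ge0 x : 0 <= rnorm x.
Proof. exact: real_part_ge0. Qed.

Lemma rip_norm x : rip x x = rnorm x ^+ 2.
Proof. by rewrite /rip hdot normE expr2 -of_realM real_part_of_real. Qed.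

Lemma rnormD x y : rnorm (x + y) <= rnorm x + rnorm y.
Proof. by have := ler_normD x y; rewrite !normE -of_realD of_real_le. Qed.

Lemma rnormN x : rnorm (- x) = rnorm x.
Proof. by rewrite /rnorm normrN. Qed.

Lemma rnormB x y : rnorm (x - y) = rnorm (y - x).
Proof. by rewrite -rnormN opprB. Qed.

Lemma rnorm0 : rnorm (0 : H) = 0.
Proof. by rewrite /rnorm normr0 -of_real0 real_part_of_real. Qed.

Lemma rnorm0_eq0 x : rnorm x = 0 -> x = 0.
Proof. by move=> h; apply/normr0_eq0; rewrite normE h of_real0. Qed.

Lemma rnormZ a x : rnorm (rscale a x) = `|a| * rnorm x.
Proof.
by rewrite /rnorm /rscale normrZ norm_of_real real_partZ.
Qed.

(** Cauchy-Schwarz, from the nonnegative quadratic polynomial in [t] evaluated at its minimum. *)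
Lemma rip_le x y : `|rip x y| <= rnorm x * rnorm y.
Proof.
have q t : 0 <= rnorm x ^+ 2 + 2 * t * rip x y + t ^+ 2 * rnorm y ^+ 2.
  have := rip_norm (x + rscale t y).
  rewrite ripDl !ripDr !ripZl !ripZr (ripC y x) !rip_norm => h.
  rewrite [X in 0 <= X](_ : _ = rnorm (x + rscale t y) ^+ 2) ?sqr_ge0//.
  by rewrite -h; ring.
have [y0|y0] := eqVneq (rnorm y) 0.
  by rewrite y0 mulr0 (rnorm0_eq0 y0) rip0r normr0.
rewrite -(ler_pXn2r (n := 2)) ?nnegrE ?mulr_ge0 ?rnorm_ge0//.
rewrite real_normK ?num_real// exprMn.
have yp : 0 < rnorm y ^+ 2 by rewrite exprn_gt0// lt_neqAle eq_sym y0 rnorm_ge0.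
have := q (- rip x y / rnorm y ^+ 2).
rewrite [X in 0 <= X](_ : _ = (rnorm x ^+ 2 * rnorm y ^+ 2 - rip x y ^+ 2) / rnorm y ^+ 2); last by field.
by rewrite pmulr_lge0 ?invr_gt0// subr_ge0.
Qed.

(** The radii of balls in [H] are scalars, possibly complex; this reduces convergence to real
    numbers. *)
Lemma cvg_rnorm (T : Type) (F : set_system T) {FF : Filter F} (f : T -> H) (l : H) :
  (f x @[x --> F] --> l) <-> (rnorm (f x - l) @[x --> F] --> (0 : R)).
Proof.
split=> [/cvgrPdist_lt h|/cvgrPdist_lt h]; apply/cvgrPdist_lt => e e0.
  have e0' : 0 < of_real s e by rewrite -of_real0 of_real_lt.
  move: (h _ e0'); apply: filterS => x.
  by rewrite normE of_real_lt sub0r normrN ger0_norm ?rnorm_ge0// rnormB.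
have := h _ (real_part_gt0 e0); apply: filterS => x.
rewrite sub0r normrN ger0_norm ?rnorm_ge0// => h2.
by rewrite (ge0_of_real (ltW e0)) normE of_real_lt rnormB.
Qed.

Lemma cvg_rip (T : Type) (F : set_system T) {FF : Filter F} (f : T -> H) (l y : H) :
  f x @[x --> F] --> l -> rip (f x) y @[x --> F] --> rip l y.
Proof.
move=> /cvg_rnorm/cvgrPdist_lt h; apply/cvgrPdist_lt => e e0.
have n0 : 0 < rnorm y + 1 by rewrite ltr_wpDl ?rnorm_ge0.
move: (h _ (divr_gt0 e0 n0)); apply: filterS => x.
rewrite sub0r normrN ger0_norm ?rnorm_ge0// ltr_pdivlMr// => h2.
rewrite distrC -ripBl (le_lt_trans (rip_le _ _))//; apply: le_lt_trans h2.
by rewrite ler_wpM2l ?rnorm_ge0// lerDl.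
Qed.

Lemma cvg_rnorm_cvg (T : Type) (F : set_system T) {FF : Filter F} (f : T -> H) (l : H) :
  f x @[x --> F] --> l -> rnorm (f x) @[x --> F] --> rnorm l.
Proof.
move=> /cvg_rnorm/cvgrPdist_lt h; apply/cvgrPdist_lt => e e0.
move: (h _ e0); apply: filterS => x.
rewrite sub0r normrN ger0_norm ?rnorm_ge0//; apply: le_lt_trans.
have h1 := rnormD (f x - l) l; have h2 := rnormD (l - f x) (f x).
rewrite !subrK in h1 h2; rewrite (rnormB l) in h2.
by rewrite ler_norml; apply/andP; split; lra.
Qed.

Lemma dense_rnorm (S : set H) x e : dense S -> 0 < e -> exists2 y, S y & rnorm (x - y) < e.
Proof.
move=> dS e0; have e0' : 0 < of_real s e by rewrite -of_real0 of_real_lt.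
have [||y [By Sy]] := dS (ball x (of_real s e)).
- by exists x; exact: ballxx.
- exact: ball_open.
by exists y => //; move: By; rewrite -ball_normE /ball_ /= normE of_real_lt.
Qed.

End inner_product.

(** * Eigenfunction expansion and bounded functions of the operator *)

Section eigen_expansion.
Context {R : realType} {s : scalar_kind} {H : completeNormedModType (scalars R s)}.
Variable (dot : {dot H for @conjugate R s}).
Hypothesis hdot : scalar_product_of_norm dot.
Variables (D : set H) (A : H -> H) (v : nat -> H) (lam : nat -> R).
Hypothesis (hA : selfadjoint dot D A) (hv : eigensystem dot D A v lam).
Implicit Types (a b : R) (x y z : H) (c : nat -> R).
Notation rip := (rip dot).

Lemma lam_ge0 k : lam 0%N <= lam k. Proof. exact: (es_nondecreasing hv). Qed.
Lemma lam_gt0 k : 0 < lam k. Proof. exact: lt_le_trans (es_pos hv) (lam_ge0 k). Qed.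

(** The component along [v k] kept as a vector: real multipliers then act through [rscale], whatever
    the field of scalars. *)
Definition prj k x : H := dot x (v k) *: v k.

Lemma prjD k x y : prj k (x + y) = prj k x + prj k y.
Proof. by rewrite /prj dotDl scalerDl. Qed.

Lemma prjZ k a x : prj k (rscale a x) = rscale a (prj k x).
Proof. by rewrite /prj dotZl -scalerA. Qed.

Lemma prj0 k : prj k 0 = 0.
Proof. by rewrite -[X in prj k X](rscale0 0) prjZ rscale0. Qed.

Lemma prjN k x : prj k (- x) = - prj k x.
Proof. by rewrite -[x in LHS]rscale1 -rscaleN prjZ rscaleN rscale1. Qed.

Lemma prjB k x y : prj k (x - y) = prj k x - prj k y.
Proof. by rewrite prjD prjN. Qed.

Lemma rip_prj k x y : rip (prj k x) y = rip x (prj k y).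
Proof. by rewrite /rip /prj dotZl dotZr -(dotC dot) mulrC. Qed.

Lemma prj_prj j k x : prj k (prj j x) = if j == k then prj k x else 0.
Proof.
rewrite /prj dotZl (es_orthonormal hv); case: eqP => [->|_]; first by rewrite mulr1.
by rewrite mulr0 scale0r.
Qed.

Lemma rip_prj_eq0 k x y : prj k x = 0 -> rip x (prj k y) = 0.
Proof. by move=> h; rewrite -rip_prj h rip0l. Qed.

(** Such an [x] is orthogonal to the span of the [v k]. An element of the span closer to [x] than
    [rnorm x] would contradict Cauchy-Schwarz. *)
Lemma prj_complete x : (forall k, prj k x = 0) -> x = 0.
Proof.
move=> h.
have h1 k : dot x (v k) = 0.
  have : dot (prj k x) (v k) = 0 by rewrite h linear0l.
  by rewrite /prj dotZl (es_orthonormal hv) eqxx mulr1.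
have h2 n (c : nat -> scalars R s) : rip x (\sum_(k < n) c k *: v k) = 0.
  elim: n => [|n IH]; first by rewrite big_ord0 rip0r.
  by rewrite big_ord_recr/= ripDr IH add0r /rip dotZr h1 mulr0 -of_real0 real_part_of_real.
apply: (rnorm0_eq0); apply/eqP; rewrite eq_le rnorm_ge0 andbT leNgt; apply/negP => x0.
have [y [n [c ->]] hy] := dense_rnorm x (es_complete hv) x0.
have := rip_le hdot x (x - \sum_(k < n) c k *: v k).
rewrite ripBr h2 subr0 rip_norm// ger0_norm ?sqr_ge0// expr2 ler_pM2l//.
by rewrite leNgt hy.
Qed.

Lemma prj_inj x y : (forall k, prj k x = prj k y) -> x = y.
Proof.
move=> h; apply/eqP; rewrite -subr_eq0; apply/eqP; apply: prj_complete => k.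
by rewrite prjB h subrr.
Qed.

Definition psum c n x : H := \sum_(k < n) rscale (c k) (prj k x).

Lemma psumS c n x : psum c n.+1 x = psum c n x + rscale (c n) (prj n x).
Proof. exact: big_ord_recr. Qed.

Lemma prj_psum c n x j : prj j (psum c n x) = if (j < n)%N then rscale (c j) (prj j x) else 0.
Proof.
elim: n => [|n IH]; first by rewrite /psum big_ord0 prj0.
rewrite psumS prjD IH prjZ prj_prj ltnS; case: ltngtP => [jn|nj|->].
- by rewrite rscaler0 addr0.
- by rewrite rscaler0 addr0.
- by rewrite add0r.
Qed.

Lemma rnorm_psum c n x : rnorm (psum c n x) ^+ 2 = \sum_(k < n) c k ^+ 2 * rnorm (prj k x) ^+ 2.
Proof.
elim: n => [|n IH]; first by rewrite /psum !big_ord0 rnorm0 expr0n.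
rewrite big_ord_recr/= -IH psumS -!(rip_norm hdot) ripDl !ripDr ripZl !ripZr.
rewrite (ripC dot (prj n x) (psum _ _ _)) rip_prj_eq0; last by rewrite prj_psum ltnn.
by rewrite !ripZl !mulr0 add0r addr0; ring.
Qed.

Lemma rip_psum1 n x : rip x (psum (fun _ => 1) n x) = \sum_(k < n) rnorm (prj k x) ^+ 2.
Proof.
elim: n => [|n IH]; first by rewrite /psum !big_ord0 rip0r.
rewrite big_ord_recr/= -IH psumS ripDr rscale1 -(rip_norm hdot) rip_prj prj_prj eqxx.
by rewrite -rip_prj.
Qed.

Definition energy n x : R := \sum_(k < n) rnorm (prj k x) ^+ 2.

Lemma energy_psum n x : energy n x = rnorm (psum (fun _ => 1) n x) ^+ 2.
Proof. by rewrite rnorm_psum; apply: eq_bigr => k _; rewrite expr1n mul1r. Qed.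

(** Expand the square of the norm of [x] minus its partial sum. *)
Lemma bessel n x : energy n x <= rnorm x ^+ 2.
Proof.
have := rip_norm hdot (x - psum (fun _ => 1) n x).
rewrite ripBl !ripBr !(rip_norm hdot) -energy_psum (ripC dot _ x) rip_psum1 -/(energy n x) => h.
by rewrite -subr_ge0; move: (sqr_ge0 (rnorm (x - psum (fun _ => 1) n x))); rewrite -h; lra.
Qed.

Lemma energy_nd x : nondecreasing_seq (energy ^~ x).
Proof.
apply/nondecreasing_seqP => n; rewrite /energy big_ord_recr/= lerDl sqr_ge0 //.
Qed.

Lemma energy_cvg x : cvgn (energy ^~ x).
Proof.
apply: nondecreasing_is_cvgn; first exact: energy_nd.
by exists (rnorm x ^+ 2) => _ [n _ <-]; exact: bessel.
Qed.

Lemma rnorm_prj_le k x : rnorm (prj k x) <= rnorm x.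
Proof.
rewrite -(ler_pXn2r (n := 2)) ?nnegrE ?rnorm_ge0//.
apply: le_trans (bessel k.+1 x); rewrite /energy big_ord_recr/= lerDr.
by apply: sumr_ge0 => i _; rewrite sqr_ge0.
Qed.

Lemma psum_diff c m n x : (n <= m)%N ->
  psum c m x - psum c n x = psum (fun k => if (n <= k)%N then c k else 0) m x.
Proof.
move=> nm; apply: prj_inj => k; rewrite prjB !prj_psum.
have [kn|nk] := ltnP k n.
  by rewrite (leq_trans kn nm) subrr rscale0.
by rewrite subr0.
Qed.

Lemma psum_diff_le c B m n x : (forall k, `|c k| <= B) -> (n <= m)%N ->
  rnorm (psum c m x - psum c n x) ^+ 2 <= B ^+ 2 * (energy m x - energy n x).
Proof.
move=> cB nm; have B0 : 0 <= B by apply: le_trans (cB 0%N).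
rewrite psum_diff// rnorm_psum /energy.
have -> : \sum_(k < m) rnorm (prj k x) ^+ 2 - \sum_(k < n) rnorm (prj k x) ^+ 2 =
    \sum_(k < m | (n <= k)%N) rnorm (prj k x) ^+ 2.
  rewrite -!(big_mkord xpredT (fun k => rnorm (prj k x) ^+ 2)) (big_cat_nat _ nm)//= addrAC subrr add0r.
  by rewrite (@big_nat_widenl _ _ _ n 0 m xpredT)//= big_mkord.
rewrite [leRHS]mulr_sumr [leRHS]big_mkcond/=; apply: ler_sum => k _.
case: ifP => nk; last by rewrite expr0n mul0r.
by rewrite ler_wpM2r ?sqr_ge0// -real_normK ?num_real// lerXn2r ?nnegrE.
Qed.

Lemma cauchy_rnorm (u : nat -> H) :
  (forall e, 0 < e -> exists N, forall n, (N <= n)%N -> rnorm (u n - u N) < e) -> cvgn u.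
Proof.
move=> h; apply: cauchy_cvg; apply: cauchy_exP => e e0.
have [N hN] := h _ (real_part_gt0 e0); exists (u N); exists N => //= n Nn.
rewrite -ball_normE /ball_ /= normE (ge0_of_real (ltW e0)) of_real_lt rnormB.
exact: hN.
Qed.

(** The partial sums are Cauchy: their increments are at most [B] times those of the convergent
    energy, in squared norm. *)
Lemma psum_cvg c B x : (forall k, `|c k| <= B) -> cvgn (fun n => psum c n x).
Proof.
move=> cB; have B0 : 0 <= B by apply: le_trans (cB 0%N).
apply: cauchy_rnorm => e e0.
have B1 : 0 < B ^+ 2 + 1 by rewrite ltr_wpDl ?sqr_ge0.
have e1 : 0 < e ^+ 2 / (B ^+ 2 + 1) by rewrite divr_gt0 ?exprn_gt0.
have := @energy_cvg x => /cvgrPdist_lt/(_ _ e1)[N _ hN].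
exists N => n nN; have := hN N (leqnn N) => /=.
have l1 := nondecreasing_cvgn_le (energy_nd x) (@energy_cvg x).
rewrite ger0_norm ?subr_ge0 ?l1// => h.
have {}h : (energy n x - energy N x) * (B ^+ 2 + 1) < e ^+ 2.
  rewrite -ltr_pdivlMr//; apply: le_lt_trans h; rewrite lerD2r; exact: l1.
rewrite -(ltr_pXn2r (n := 2)) ?nnegrE ?rnorm_ge0 ?(ltW e0)//.
apply: le_lt_trans h; apply: le_trans (psum_diff_le x cB nN) _.
by rewrite mulrC ler_wpM2l ?subr_ge0 ?energy_nd// lerDl.
Qed.

(** Says that [z] is the image of [x] under the diagonal operator with entries [c k]. As a relation
    it needs no convergence condition, and [mult_uniq] makes it functional in [x]. *)
Definition mult c x z := forall k, prj k z = rscale (c k) (prj k x).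

Lemma psum_lim c x z : psum c n x @[n --> \oo] --> z -> mult c x z.
Proof.
move=> /cvg_rnorm/cvgrPdist_lt h k; apply/eqP; rewrite -subr_eq0; apply/eqP.
apply: rnorm0_eq0; apply/eqP; rewrite eq_le rnorm_ge0 andbT leNgt; apply/negP => e0.
have [N _ hN] := h _ e0.
have := hN (maxn N k.+1) (leq_maxl _ _).
rewrite /= sub0r normrN ger0_norm ?rnorm_ge0// rnormB ltNge => /negP; apply.
apply: le_trans (rnorm_prj_le k _).
by rewrite prjB prj_psum leq_maxr.
Qed.

Lemma mult_exists c B x : (forall k, `|c k| <= B) -> exists z, mult c x z.
Proof.
by move=> cB; exists (limn (fun n => psum c n x)); apply: psum_lim; exact: psum_cvg cB.
Qed.

Lemma mult_uniq c x z z' : mult c x z -> mult c x z' -> z = z'.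
Proof. by move=> h h'; apply: prj_inj => k; rewrite h h'. Qed.

Lemma mult1 x : mult (fun _ => 1) x x.
Proof. by move=> k; rewrite rscale1. Qed.

Lemma mult_sub c c' x z z' : mult c x z -> mult c' x z' ->
  mult (fun k => c k - c' k) x (z - z').
Proof. by move=> h h' k; rewrite prjB h h' rscaleB. Qed.

Lemma mult_scale a c x z : mult c x z -> mult (fun k => a * c k) x (rscale a z).
Proof. by move=> h k; rewrite prjZ h rscaleM. Qed.

Lemma psum1_cvg x : psum (fun _ => 1) n x @[n --> \oo] --> x.
Proof.
have c1 : forall k : nat, `|(1 : R)| <= 1 by move=> _; rewrite normr1.
have := @psum_cvg _ _ x c1 => /[dup] /psum_lim h.
have e := mult_uniq (mult1 x) h => hc.
by rewrite [X in _ --> X]e; exact: hc.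
Qed.

Lemma parseval x : energy n x @[n --> \oo] --> rnorm x ^+ 2.
Proof.
rewrite (_ : energy ^~ x = (fun n => rnorm (psum (fun _ => 1) n x) ^+ 2)); last first.
  by apply/funext => n; exact: energy_psum.
have h : rnorm (psum (fun _ => 1) n x) @[n --> \oo] --> rnorm x.
  by apply: cvg_rnorm_cvg; exact: psum1_cvg.
exact: (cvgM h h).
Qed.

Lemma energy_mult c x z n : mult c x z ->
  energy n z = \sum_(k < n) c k ^+ 2 * rnorm (prj k x) ^+ 2.
Proof.
by move=> h; apply: eq_bigr => k _; rewrite h rnormZ exprMn real_normK ?num_real.
Qed.

Lemma rnorm_sqr_le x C : (forall n, energy n x <= C) -> rnorm x ^+ 2 <= C.
Proof.
move=> h; have e : limn (energy ^~ x) = rnorm x ^+ 2 by apply: cvg_lim => //; exact: parseval.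
rewrite -e; apply: limr_le; first exact: energy_cvg.
by apply: nearW => n; exact: h.
Qed.

Lemma mult_bound c B x z : (forall k, `|c k| <= B) -> mult c x z -> rnorm z <= B * rnorm x.
Proof.
move=> cB h; have B0 : 0 <= B by apply: le_trans (cB 0%N).
rewrite -(ler_pXn2r (n := 2)) ?nnegrE ?mulr_ge0 ?rnorm_ge0// exprMn.
apply: rnorm_sqr_le => n; rewrite (energy_mult n h).
apply: (@le_trans _ _ (B ^+ 2 * energy n x)); last by rewrite ler_wpM2l ?sqr_ge0 ?bessel.
rewrite /energy mulr_sumr; apply: ler_sum => k _.
by rewrite ler_wpM2r ?sqr_ge0// -real_normK ?num_real// lerXn2r ?nnegrE.
Qed.

Lemma saA0 : A 0 = 0.
Proof.
have := sa_linear hA 1 (sa_dom0 hA) (sa_dom0 hA).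
by rewrite !scale1r addr0 => /eqP; rewrite -subr_eq0 opprD addrA subrr sub0r oppr_eq0 => /eqP.
Qed.

Lemma saDZ (a : scalars R s) x : D x -> D (a *: x).
Proof. by move=> Dx; have := sa_domP hA a Dx (sa_dom0 hA); rewrite addr0. Qed.

Lemma saAZ (a : scalars R s) x : D x -> A (a *: x) = a *: A x.
Proof. by move=> Dx; have := sa_linear hA a Dx (sa_dom0 hA); rewrite !addr0 saA0 addr0. Qed.

Lemma prj_A k x : D x -> prj k (A x) = rscale (lam k) (prj k x).
Proof.
move=> Dx; have [_ h] := sa_adjoint hA (v k) (A (v k)).
rewrite /prj h//; last by split=> //; exact: (es_dom hv).
by rewrite (es_eigen hv) /rscale dotZr conj_of_real scalerA.
Qed.

(** Upgrades real parts to the full product: testing with [conjugate w *: x], where [w] is the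
    defect at [x], gives a zero real part for [conjugate w * w], hence [w = 0]. *)
Lemma rip_adjoint y z : (forall x, D x -> rip (A x) y = rip x z) -> D y /\ z = A y.
Proof.
move=> h; apply/(sa_adjoint hA) => x Dx; apply/eqP; rewrite -subr_eq0; apply/eqP.
set w := _ - _; apply: real_part_conjM.
have := h (conjugate w *: x) (saDZ _ Dx).
rewrite saAZ// /rip !dotZl => /eqP; rewrite -subr_eq0 -real_partN -real_partD => /eqP.
by rewrite -mulrN -mulrDr.
Qed.

Lemma rip_psum_cvg x z : rip x (psum (fun _ => 1) n z) @[n --> \oo] --> rip x z.
Proof.
rewrite ripC (_ : (fun n => rip x _) = (fun n => rip (psum (fun _ => 1) n z) x)).
  by apply: cvg_rip => //; exact: psum1_cvg.
by apply/funext => n; rewrite ripC.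
Qed.

(** Self-adjointness replaces a closedness argument: for [y] in the domain, [A y] against a partial
    sum of [z] equals [y] against the corresponding partial sum of [w], and the limit says that [z]
    lies in the domain of the adjoint. *)
Lemma A_mult c x z w : mult c x z -> mult (fun k => lam k * c k) x w -> D z /\ A z = w.
Proof.
move=> hz hw; suff [Dz ->] : D z /\ w = A z by [].
apply: rip_adjoint => y Dy.
apply: (@cvg_unique _ _ (rip (A y) (psum (fun _ => 1) n z) @[n --> \oo])) => //.
  exact: rip_psum_cvg.
suff E n : rip (A y) (psum (fun _ => 1) n z) = rip y (psum (fun _ => 1) n w).
  rewrite /= (_ : (fun n => rip (A y) (psum _ n z)) = (fun n => rip y (psum (fun _ => 1) n w))).
    exact: rip_psum_cvg.
  exact/funext.
elim: n => [|n IH]; first by rewrite /psum !big_ord0 !rip0r.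
rewrite !psumS !ripDr IH !rscale1; congr (_ + _).
rewrite -rip_prj prj_A// hw rscaleM -hz !ripZl ripZr; congr (_ * _).
by rewrite rip_prj.
Qed.

End eigen_expansion.

(** * The Bochner integral *)

Section bochner.
Context {R : realType} {s : scalar_kind} {H : completeNormedModType (scalars R s)}.
Variable (dot : {dot H for @conjugate R s}).
Hypothesis hdot : scalar_product_of_norm dot.
Notation mu := (@lebesgue_measure R).
Notation rip := (rip dot).
Implicit Types (a b t x : R) (y z : H) (f : R -> H) (D : set R).

Definition simple_on D (g : seq (set R * H)) := forall p : set R * H, p \in g ->
  [/\ measurable p.1, p.1 `<=` D & (mu p.1 < +oo)%E].

Lemma simple_evalE p (g : seq (set R * H)) x :
  simple_eval (p :: g) x = rscale (\1_(p.1) x) p.2 + simple_eval g x.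
Proof. by rewrite /simple_eval big_cons. Qed.

Lemma simple_rip D g y : measurable D -> simple_on D g ->
  integ D (fun x => rip (simple_eval g x) y) /\
  \int[mu]_(x in D) rip (simple_eval g x) y = rip (simple_integral g) y.
Proof.
move=> mD; elim: g => [|p g IH] hg.
  have E : (fun x => rip (simple_eval [::] x) y) = (fun _ => 0).
    by apply/funext => x; rewrite /simple_eval big_nil rip0l.
  rewrite E Rint0 /simple_integral big_nil rip0l; split=> //.
  exact: integrable0.
have [mp pD fp] := hg p (mem_head _ _).
have [|i1 e1] := IH; first by move=> q qg; apply: hg; rewrite inE qg orbT.
have i2 := integZ (rip p.2 y) mD (integ_indic mD mp fp).
have E x : rip (simple_eval (p :: g) x) y = rip p.2 y * \1_(p.1) x + rip (simple_eval g x) y.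
  by rewrite simple_evalE ripDl ripZl mulrC.
rewrite (_ : (fun x => rip _ y) = (fun x => rip p.2 y * \1_(p.1) x + rip (simple_eval g x) y)); last exact/funext.
split; first exact: integD.
rewrite (RintegralD (mR mD) i2 i1) e1 (RintZ _ mD (integ_indic mD mp fp)) Rint_indic//.
by rewrite setIidl// /simple_integral big_cons ripDl ripZl mulrC.
Qed.

(** Pairing with [y] commutes with the integral of simple functions, and the error is at most
    [rnorm y] times the integral of [rnorm (f - simple_eval (g n))]. It turns strong integrals into
    scalar ones. *)
Lemma bochner_weak D f y z : measurable D -> is_bochner_integral D f z ->
  measurable_fun D (fun x => rip (f x) y) ->
  integ D (fun x => rip (f x) y) /\ \int[mu]_(x in D) rip (f x) y = rip z y.
Proof.
move=> mD [g [hg mg cg cz]] mf.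
pose a n := \int[mu]_(x in D) rnorm (f x - simple_eval (g n) x).
have [fa ca] := (fine_cvgP _ _).1 cg.
have {}ca : a n @[n --> \oo] --> 0 by exact: ca.
have ia n : ((\int[mu]_(x in D) (rnorm (f x - simple_eval (g n) x))%:E)%E \is a fin_num) ->
    integ D (fun x => rnorm (f x - simple_eval (g n) x)).
  move=> h; apply: ge0_integ => //; first by move=> x _; exact: rnorm_ge0.
  by rewrite ltey_eq h.
have bd n x : `|rip (f x) y - rip (simple_eval (g n) x) y| <=
    rnorm y * rnorm (f x - simple_eval (g n) x).
  by rewrite -ripBl mulrC; exact: rip_le.
have iw : integ D (fun x => rip (f x) y).
  have [N _ hN] := fa; have := ia N (hN N (leqnn N)) => iN.
  have i1 := (simple_rip y mD (hg N)).1.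
  apply: (integ_le mD mf (integD mD (integZ (rnorm y) mD iN) (integ_norm mD i1))) => x Dx.
  by rewrite -lerBlDr (le_trans (lerB_dist _ _)).
split=> //.
apply: (@cvg_unique _ _ (rip (simple_integral (g n)) y @[n --> \oo])) => //; last first.
  by apply: cvg_rip.
apply/cvgrPdist_lt => e e0.
have n0 : 0 < rnorm y + 1 by rewrite ltr_wpDl ?rnorm_ge0.
have /cvgrPdist_lt/(_ _ (divr_gt0 e0 n0)) h := ca.
near=> n.
have fn : ((\int[mu]_(x in D) (rnorm (f x - simple_eval (g n) x))%:E)%E \is a fin_num) by near: n.
have i1 := simple_rip y mD (hg n).
rewrite -i1.2 -(RintegralB (mR mD) iw i1.1).
have h2 : `|\int[mu]_(x in D) (rip (f x) y - rip (simple_eval (g n) x) y)| <= rnorm y * a n.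
  rewrite /a -(RintZ _ mD (ia n fn)); apply: norm_Rint_le => //.
  - exact: integ_measurable (integB mD iw i1.1).
  - by apply: integZ => //; exact: ia.
apply: (le_lt_trans h2).
have : `|0 - a n| < e / (rnorm y + 1) by near: n.
have a0 : 0 <= a n by apply: Rintegral_ge0 => x _; exact: rnorm_ge0.
rewrite sub0r normrN ger0_norm// ltr_pdivlMr//; apply: le_lt_trans.
by rewrite mulrC ler_wpM2l// lerDl.
Unshelve. all: by end_near. Qed.

(* A cell contributes a constant only where [f] oscillates by at most 1, so that
   the errors are dominated by [rnorm (f x) + 1]. *)
Section approximation.
Variables (f : R -> H) (t : R).
Hypotheses (t0 : 0 < t) (cf : forall x, 0 < x < t -> {for x, continuous f})
  (fi : integ `]0, t[ (fun x => rnorm (f x))).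

Let h n : R := t / n.+1%:R.
Let h0 n : 0 < h n. Proof. by rewrite divr_gt0. Qed.
Let E n i : set R := `]0, t[ `&` `[i%:R * h n, i.+1%:R * h n[.
Let c n i : R := (i%:R + 2^-1) * h n.
Let X n i : H := if `[< forall x, E n i x -> rnorm (f x - f (c n i)) <= 1 >] then f (c n i) else 0.
Let g n : seq (set R * H) := [seq (E n i, X n i) | i <- iota 0 n.+1].
Let idx n x := Num.truncn (x / h n).

Let g_simple n : simple_on `]0, t[ (g n).
Proof.
move=> p /mapP[i _ ->] /=; split; first exact: measurableI.
  by move=> x [].
apply: le_lt_trans (itv_finite 0 t false true); apply: le_measure.
- by rewrite inE; apply: mR; exact: measurableI.
- by rewrite inE; apply: mR.
- by move=> x [].
Qed.

Let idxP n x : 0 < x < t -> (idx n x < n.+1)%N /\ E n (idx n x) x.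
Proof.
move=> /andP[x0 xt]; have xh : 0 <= x / h n by rewrite divr_ge0 ?ltW.
have /andP[h1 h2] := truncn_itv xh.
rewrite ler_pdivlMr// in h1; rewrite ltr_pdivrMr// in h2.
split; last by split; rewrite /= in_itv/= ?x0 ?xt// h1 h2.
rewrite -(ltr_nat R) -(ltr_pM2r (h0 n)) (le_lt_trans h1)//.
by rewrite /h mulrC divfK// pnatr_eq0.
Qed.

Let E_disj n i j x : E n i x -> E n j x -> i = j.
Proof.
have aux k l : E n k x -> E n l x -> (k <= l)%N.
  move=> [_ /=]; rewrite in_itv/= => /andP[h1 _] [_ /=]; rewrite in_itv/= => /andP[_ h2].
  by have := le_lt_trans h1 h2; rewrite ltr_pM2r// ltr_nat ltnS.
by move=> hi hj; apply/eqP; rewrite eqn_leq !aux.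
Qed.

Let g_eval n x : 0 < x < t -> simple_eval (g n) x = X n (idx n x).
Proof.
move=> x0t; have [xn xE] := idxP n x0t.
have xm : idx n x \in iota 0 n.+1 by rewrite mem_iota.
rewrite /simple_eval big_map (bigD1_seq (idx n x) xm (iota_uniq _ _)) [(_, _).1]/= [(_, _).2]/=.
rewrite indicE mem_set// rscale1 big1 => [|i ni]; first exact: addr0.
rewrite indicE memNset ?rscale0// => Ei; move: ni.
by rewrite (E_disj Ei xE) eqxx.
Qed.

Let r n x := rnorm (f x - simple_eval (g n) x).

Let cr y x : 0 < x < t -> {for x, continuous (fun x => rnorm (f x - y))}.
Proof.
move=> x0t; apply: cvg_rnorm_cvg; apply: cvgB; first exact: cf.
exact: cvg_cst.
Qed.

Let mr n : measurable_fun `]0, t[ (r n).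
Proof.
apply: (@eq_measurable_fun _ _ _ _ _ (fun x => \sum_(i <- iota 0 n.+1) \1_(E n i) x * rnorm (f x - X n i))).
  move=> x; rewrite inE /= in_itv/= => x0t; have [xn xE] := idxP n x0t.
  have xm : idx n x \in iota 0 n.+1 by rewrite mem_iota.
  rewrite /r g_eval// (bigD1_seq (idx n x) xm (iota_uniq _ _)).
  rewrite indicE mem_set// mul1r big1 => [|i ni]; first exact: addr0.
  rewrite indicE memNset ?mul0r// => Ei; move: ni.
  by rewrite (E_disj Ei xE) eqxx.
apply: (measurable_sum _ (h := fun i x => \1_(E n i) x * rnorm (f x - X n i))) => i; apply: measurable_funM.
  by apply: measurable_indic; exact: measurableI.
apply: open_continuous_measurable_fun; first exact: interval_open.
by move=> x; rewrite inE /= in_itv/=; exact: cr.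
Qed.

Let cE n i : (i < n.+1)%N -> E n i (c n i).
Proof.
move=> ni; have hn := h0 n; split; rewrite /= in_itv/= /c.
  rewrite mulr_gt0 ?ltr_wpDl ?invr_gt0//=.
  have -> : t = n.+1%:R * h n by rewrite /h mulrC divfK// pnatr_eq0.
  rewrite ltr_pM2r//; have : i%:R <= n%:R :> R by rewrite ler_nat.
  by rewrite -[n.+1%:R]natr1; lra.
by rewrite ler_pM2r// ltr_pM2r// lerDl invr_ge0 ler0n/= -[i.+1%:R]natr1 ltrD2l invf_lt1// ltr1n.
Qed.

Let r_le n x : 0 < x < t -> `|r n x| <= rnorm (f x) + 1.
Proof.
move=> x0t; have [xn xE] := idxP n x0t; rewrite /r ger0_norm ?rnorm_ge0// g_eval// /X.
case: asboolP => [hX|_]; first by rewrite (le_trans (hX _ xE))// lerDr rnorm_ge0.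
by rewrite subr0 lerDl.
Qed.

Let r_cvg x : 0 < x < t -> r n x @[n --> \oo] --> 0.
Proof.
move=> x0t; apply/cvgrPdist_lt => e e0.
(* Two deviations of size [e'] add up to at most 1, so on fine meshes the cell of [x] passes the
   oscillation test; a single one stays below [e]. *)
pose e' := Num.min e 1 / 2.
have e'0 : 0 < e' by rewrite divr_gt0// lt_min e0 ltr01.
have /cvg_rnorm/cvgrPdist_lt/(_ _ e'0)[d /= d0 hd] := cf x0t.
have dE n : h n < d -> forall x', E n (idx n x) x' -> rnorm (f x' - f x) < e'.
  move=> hn x' [_ /=]; rewrite in_itv/= => /andP[h1 h2].
  have [_ [_ /=]] := idxP n x0t; rewrite in_itv/= => /andP[h3 h4].
  have xx' : `|x - x'| < d.
    move: h1 h2 h3 h4 hn; rewrite -[(idx n x).+1%:R]natr1 mulrDl mul1r => *.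
    by rewrite ltr_norml; apply/andP; split; lra.
  by have := hd x' xx'; rewrite sub0r normrN ger0_norm ?rnorm_ge0.
exists (Num.bound (t / d)) => // n /= nN.
have hn : h n < d.
  rewrite /h ltr_pdivrMr// mulrC -ltr_pdivrMr//.
  have td : 0 <= t / d by rewrite divr_ge0 ?ltW.
  by rewrite (lt_trans (archi_boundP td))// ltr_nat ltnS.
have [xn xE] := idxP n x0t.
rewrite sub0r normrN ger0_norm ?rnorm_ge0// /r g_eval// /X.
have hc := dE n hn _ (cE xn).
have e'1 : e' + e' <= 1 by rewrite -splitr min_ler.
have e'e : e' < e.
  by rewrite /e' ltr_pdivrMr// (le_lt_trans (min_lel _ _))// ltr_pMr// ltr1n.
case: asboolP => [_|[]]; first by rewrite rnormB (lt_trans hc).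
move=> x' x'E; have := dE n hn _ x'E => hx'.
rewrite (_ : f x' - f (c n (idx n x)) = (f x' - f x) - (f (c n (idx n x)) - f x)); last first.
  by rewrite opprB addrA subrK.
apply: (le_trans (rnormD _ _)); rewrite rnormN; lra.
Qed.

Lemma bochner_exists : exists z, is_bochner_integral `]0, t[ f z.
Proof.
have mI := measurable_itv (`]0, t[ : interval R).
have i1 : integ `]0, t[ (fun _ : R => (1 : R)) by exact: Rint_cst0t.
have ig := integD mI fi i1.
have bI x : `]0, t[%classic x -> 0 < x < t by rewrite /= in_itv.
have ir n : integ `]0, t[ (r n).
  by apply: (integ_le mI (mr n) ig) => x /bI; exact: r_le.
have [_] := dominated_cvg_Rint mI mr ig (fun n x hx => r_le n (bI x hx))
  (fun x hx => r_cvg (bI x hx)).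
rewrite Rint0; set a := fun n : nat => Rintegral _ _ _ => ca.
have a0 n : 0 <= a n by apply: Rintegral_ge0 => x _; exact: rnorm_ge0.
(* The norm of the difference [w] is obtained by pairing with [w] itself, which turns it into a
   scalar integral. *)
have dif n m : rnorm (simple_integral (g n) - simple_integral (g m)) <= a n + a m.
  set w := simple_integral _ - _.
  have [w0|w0] := eqVneq (rnorm w) 0; first by rewrite w0 addr_ge0.
  have wp : 0 < rnorm w by rewrite lt_neqAle eq_sym w0 rnorm_ge0.
  rewrite -(ler_pM2l wp) -expr2 -(rip_norm hdot) {1}/w ripBl.
  have [j1 e1] := simple_rip w mI (@g_simple n); have [j2 e2] := simple_rip w mI (@g_simple m).
  rewrite -e1 -e2 -(RintegralB (mR mI) j1 j2) -(RintegralD (mR mI) (ir n) (ir m)).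
  rewrite -(RintZ _ mI (integD mI (ir n) (ir m))) (le_trans (ler_norm _))//.
  apply: norm_Rint_le => //.
  - exact: integ_measurable (integB mI j1 j2).
  - by apply: integZ => //; exact: integD.
  - move=> x _; rewrite -ripBl mulrC (le_trans (rip_le hdot _ _))// ler_wpM2r ?rnorm_ge0//.
    rewrite (_ : simple_eval (g n) x - _ = (f x - simple_eval (g m) x) - (f x - simple_eval (g n) x)); last first.
      by rewrite opprB [RHS]addrC addrA subrK.
    by rewrite (le_trans (rnormD _ _))// rnormN addrC.
have /cvg_ex[z cz] : cvgn (fun n => simple_integral (g n)).
  apply: cauchy_rnorm => e e0.
  have e20 : 0 < e / 2 by rewrite divr_gt0.
  have /cvgrPdist_lt/(_ _ e20)[N _ hN] := ca.
  exists N => n Nn; apply: (le_lt_trans (dif n N)).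
  have := hN n Nn; have := hN N (leqnn N); rewrite /= !sub0r !normrN !ger0_norm//; lra.
exists z, g; split.
- exact: g_simple.
- exact: mr.
- rewrite (_ : (fun n => _) = (fun n => (a n)%:E)).
    by apply: cvg_EFin => //; exact: nearW.
  apply/funext => n; rewrite /a /Rintegral fineK//.
  by apply: integrable_fin_num => //; exact: ir.
- exact: cz.
Qed.

End approximation.
End bochner.

(** * The forward problem *)

Section existence.
Context {R : realType} {s : scalar_kind} {H : completeNormedModType (scalars R s)}.
Variable (dot : {dot H for @conjugate R s}).
Hypothesis hdot : scalar_product_of_norm dot.
Variables (D : set H) (A : H -> H) (v : nat -> H) (lam : nat -> R).
Hypothesis (hA : selfadjoint dot D A) (hv : eigensystem dot D A v lam).
Implicit Types (a b t x r rho T : R) (y z phi : H) (c : nat -> R).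
Notation mu := (@lebesgue_measure R).
Notation rip := (rip dot).
Notation prj := (prj dot v).
Notation psum := (psum dot v).
Notation mult := (mult dot v).

Lemma mult_ext c c' y z : (forall k, c k = c' k) -> mult c y z -> mult c' y z.
Proof. by move=> cc h k; rewrite h cc. Qed.

Lemma prj_eq k y z : (forall h : H, rip (prj k y) h = rip (prj k z) h) -> prj k y = prj k z.
Proof.
move=> h; apply/eqP; rewrite -subr_eq0; apply/eqP; apply: rnorm0_eq0.
apply/eqP; rewrite -sqrf_eq0 -(rip_norm hdot) ripBl h subrr//.
Qed.

Lemma psum_cvg0 (T : Type) (F : set_system T) {FF : Filter F} (c : T -> nat -> R) N phi :
  (forall k, c t k @[t --> F] --> 0) -> rnorm (psum (c t) N phi) @[t --> F] --> 0.
Proof.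
move=> h; elim: N => [|N IH].
  by under eq_cvg do rewrite /psum big_ord0 rnorm0; exact: cvg_cst.
have g0 : rnorm (psum (c t) N phi) + `|c t N| * rnorm phi @[t --> F] --> (0 : R).
  suff : rnorm (psum (c t) N phi) + `|c t N| * rnorm phi @[t --> F] --> (0 : R) + 0 * rnorm phi.
    by rewrite mul0r addr0.
  apply: cvgD => //; apply: cvgM; last exact: cvg_cst.
  by rewrite -[X in _ --> X](@normr0 R R); apply: cvg_norm; exact: h.
apply: (@squeeze_cvgr _ _ _ _ (cst 0) _ _ _ _ _ g0); last exact: cvg_cst.
apply: nearW => t; rewrite rnorm_ge0 psumS (le_trans (rnormD _ _))// lerD2l rnormZ.
by rewrite ler_wpM2l//; exact: (rnorm_prj_le hdot hv).
Qed.

(** Uniformly bounded multipliers that tend to 0 entrywise tend to 0 strongly: the tail of [phi] is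
    small by boundedness, the finite part by the entrywise limits. *)
Lemma mult_cvg0 (T : Type) (F : set_system T) {FF : Filter F} (c : T -> nat -> R) B
    (Z : T -> H) phi : (\forall t \near F, mult (c t) phi (Z t) /\ forall k, `|c t k| <= B) ->
  (forall k, c t k @[t --> F] --> 0) -> rnorm (Z t) @[t --> F] --> 0.
Proof.
move=> hZ hc; apply/cvgrPdist_lt => e e0.
have B0 : 0 < `|B| + 1 by rewrite ltr_wpDl.
have e1 : 0 < e / 2 / (`|B| + 1) by rewrite !divr_gt0.
have /cvg_rnorm/cvgrPdist_lt/(_ _ e1)[N _ hN] := @psum1_cvg _ _ _ _ hdot _ _ _ _ hv phi.
have {hN} := hN N (leqnn N); rewrite /= sub0r normrN ger0_norm ?rnorm_ge0// => hN.
have e2 : 0 < e / 2 by rewrite divr_gt0.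
have : rnorm (psum (c t) N phi) @[t --> F] --> (0 : R) by exact: psum_cvg0.
move=> /cvgrPdist_lt/(_ _ e2) h1.
near=> t; have [mZ cB] : mult (c t) phi (Z t) /\ forall k, `|c t k| <= B by near: t.
have : `|0 - rnorm (psum (c t) N phi)| < e / 2 by near: t.
rewrite !sub0r !normrN !ger0_norm ?rnorm_ge0// => h2.
have h3 : mult (c t) (phi - psum (fun _ => 1) N phi) (Z t - psum (c t) N phi).
  move=> k; rewrite !(prjB) mZ !(prj_psum hv); case: ifP => _.
    by rewrite rscale1 !subrr rscaler0.
  by rewrite !subr0.
have h4 := mult_bound hdot hv cB h3.
have h5 : rnorm (Z t - psum (c t) N phi) <= e / 2.
  apply: (le_trans h4); rewrite rnormB.
  apply: (@le_trans _ _ ((`|B| + 1) * rnorm (psum (fun _ => 1) N phi - phi))).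
    by rewrite ler_wpM2r ?rnorm_ge0// (le_trans (ler_norm _))// lerDl.
  by rewrite mulrC -ler_pdivlMr// ltW.
have := rnormD (Z t - psum (c t) N phi) (psum (c t) N phi); rewrite subrK; lra.
Unshelve. all: by end_near. Qed.

Lemma lip_continuous (F : R -> H) K : 0 <= K ->
  (forall t t', 0 < t -> 0 < t' -> rnorm (F t - F t') <= K * (`|t - t'| / Num.min t t' ^+ 2)) ->
  forall t, 0 < t -> {for t, continuous F}.
Proof.
move=> K0 h t t0; apply/cvg_rnorm/cvgrPdist_lt => /= e e0.
pose C := K + 1; have C0 : 0 < C by rewrite ltr_wpDl.
have t20 : 0 < t / 2 by rewrite divr_gt0.
have q0 : 0 < C / (t / 2) ^+ 2 by rewrite divr_gt0// exprn_gt0.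
exists (Num.min (t / 2) (e / (C / (t / 2) ^+ 2))) => /=.
  by rewrite lt_min t20 divr_gt0.
move=> t'; rewrite /ball_/= lt_min => /andP[h1 h2].
have t't : t / 2 < t' by move: h1; rewrite ltr_norml => /andP[_]; lra.
have t'0 : 0 < t' by apply: lt_trans t't.
rewrite sub0r normrN ger0_norm ?rnorm_ge0// rnormB (le_lt_trans (h t t' t0 t'0))//.
have hm : t / 2 <= Num.min t t' by rewrite le_min (ltW t't) andbT; lra.
have m0 : 0 < Num.min t t' by rewrite lt_min t0.
move: h2; rewrite ltr_pdivlMr//; apply: le_lt_trans.
rewrite mulrCA ler_wpM2l//; apply: ler_pM => //; first by rewrite invr_ge0 sqr_ge0.
  by rewrite lerDl.
rewrite lef_pV2 ?posrE ?exprn_gt0//.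
by rewrite lerXn2r ?nnegrE ?(ltW t20) ?(ltW m0).
Qed.

Lemma mult_lip_continuous (c : R -> nat -> R) (F : R -> H) K phi : 0 <= K ->
  (forall t, 0 < t -> mult (c t) phi (F t)) ->
  (forall t t' k, 0 < t -> 0 < t' ->
     `|c t k - c t' k| <= K * (`|t - t'| / Num.min t t' ^+ 2)) ->
  forall t, 0 < t -> {for t, continuous F}.
Proof.
move=> K0 mF hc; apply: (@lip_continuous F (K * rnorm phi)).
  by rewrite mulr_ge0 ?rnorm_ge0.
move=> t t' t0 t'0; rewrite mulrAC.
apply: (mult_bound hdot hv _ (mult_sub (mF t t0) (mF t' t'0))) => k.
exact: hc.
Qed.

Lemma cont_near_eq (F G : R -> H) t : (\forall x \near t, F x = G x) ->
  {for t, continuous F} -> {for t, continuous G}.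
Proof.
move=> FG cF; have e := nbhs_singleton FG; rewrite /prop_for /continuous_at -e.
by apply: cvg_trans cF; apply: near_eq_cvg.
Qed.

Lemma rscale_continuous (a : R -> R) (F : R -> H) t : {for t, continuous a} ->
  {for t, continuous F} -> {for t, continuous (fun x => rscale (a x) (F x))}.
Proof.
move=> ca cF; apply/cvg_rnorm.
have g0 : `|a x - a t| * rnorm (F x) + `|a t| * rnorm (F x - F t) @[x --> t] --> (0 : R).
  suff : `|a x - a t| * rnorm (F x) + `|a t| * rnorm (F x - F t) @[x --> t] -->
      `|a t - a t| * rnorm (F t) + `|a t| * 0.
    by rewrite subrr normr0 mul0r mulr0 addr0.
  apply: cvgD; apply: cvgM.
  - by apply: cvg_norm; apply: cvgB => //; exact: cvg_cst.
  - exact: cvg_rnorm_cvg.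
  - exact: cvg_cst.
  - exact/cvg_rnorm.
apply: (@squeeze_cvgr _ _ _ _ (cst 0) _ _ _ _ _ g0); last exact: cvg_cst.
apply: nearW => x; rewrite rnorm_ge0/=.
have -> : rscale (a x) (F x) - rscale (a t) (F t) =
    rscale (a x - a t) (F x) + rscale (a t) (F x - F t).
  by rewrite rscaleB rscaleBr addrA subrK.
by rewrite (le_trans (rnormD _ _))// !rnormZ.
Qed.

Lemma cvg_within_dnbhs (V : topologicalType) (f : R -> V) (E : set R) (l : V) t :
  f r @[r --> t] --> l -> f r @[r --> within E t^'] --> l.
Proof.
move=> h P /h hP; change (nbhs t (fun r => r != t -> E r -> P (f r))).
have hP' : nbhs t (f @^-1` P) := hP.
by apply: filterS hP' => r Pr _ _.
Qed.

Section solution.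
Variables (rho T : R) (phi : H).
Hypotheses (r01 : 0 < rho <= 1).

Let r0 : 0 < rho. Proof. by have /andP[] := r01. Qed.
Let lp k : 0 < lam k. Proof. exact: lam_gt0 hv k. Qed.

Let Klip : R := 12 / (pi * @dd R * @kap R ^+ 2).
Let Kbd : R := (pi * @dd R * @kap R)^-1.

Let Klip_ge0 : 0 <= Klip.
Proof.
have k0 : 0 < pi * @dd R * @kap R ^+ 2.
  exact: (mulr_gt0 (mulr_gt0 (pi_gt0 R) (@dd_gt0 R)) (exprn_gt0 _ (@kap_gt0 R))).
by rewrite divr_ge0// ltW.
Qed.

Let lmlf t k : 0 < t -> `|lam k * mlf rho (lam k) t| <= Kbd / t.
Proof. by move=> t0; rewrite (normrM (lam k)) (gtr0_norm (lp k)); exact: mlf_bound. Qed.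

Let lmlf_lip t t' k : 0 < t -> 0 < t' ->
  `|lam k * mlf rho (lam k) t - lam k * mlf rho (lam k) t'| <=
  Klip * (`|t - t'| / Num.min t t' ^+ 2).
Proof. by move=> t0 t'0; rewrite -(mulrBr (lam k)) (normrM (lam k)) (gtr0_norm (lp k)); exact: mlf_lip. Qed.

Let mlf_le t k : 0 < t -> `|mlf rho (lam k) t| <= Kbd / t / lam 0%N.
Proof.
move=> t0; have h := lmlf k t0; rewrite ler_pdivlMr ?lp//.
apply: le_trans h; rewrite (normrM (lam k)) (gtr0_norm (lp k)) mulrC.
by rewrite ler_wpM2r//; exact: (lam_ge0 hv).
Qed.

Let mlf_lip0 t t' k : 0 < t -> 0 < t' ->
  `|mlf rho (lam k) t - mlf rho (lam k) t'| <=
  (Klip / lam 0%N) * (`|t - t'| / Num.min t t' ^+ 2).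
Proof.
move=> t0 t'0; rewrite mulrAC ler_pdivlMr ?lp//.
apply: le_trans (lmlf_lip k t0 t'0); rewrite -(mulrBr (lam k)) (normrM (lam k)) (gtr0_norm (lp k)) [leLHS]mulrC.
by rewrite ler_wpM2r//; exact: (lam_ge0 hv).
Qed.

(** The solution, its image under [A] and its fractional integral, each obtained from a multiplier
    bounded at every positive time; [choice] assembles the values into functions. *)
Lemma solution_coefs : exists u w J : R -> H, [/\
  forall t, 0 < t -> mult (fun k => mlf rho (lam k) t) phi (u t),
  forall t, 0 < t -> mult (fun k => lam k * mlf rho (lam k) t) phi (w t) &
  forall t, 0 < t -> mult (fun k => mlj rho (lam k) t) phi (J t)].
Proof.
have ex (c : R -> nat -> R) (B : R -> R) : (forall t k, 0 < t -> `|c t k| <= B t) ->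
    exists F : R -> H, forall t, 0 < t -> mult (c t) phi (F t).
  move=> cB; have [|F hF] := @choice R H (fun t z => 0 < t -> mult (c t) phi z); last by exists F.
  move=> t; have [t0|t0] := ltP 0 t; last by exists 0.
  by have [z hz] := mult_exists hdot hv phi (fun k => cB t k t0); exists z.
have [u hu] := ex (fun t k => mlf rho (lam k) t) _ (fun t k => @mlf_le t k).
have [w hw] := ex (fun t k => lam k * mlf rho (lam k) t) _ (fun t k => @lmlf t k).
have [J hJ] := ex (fun t k => mlj rho (lam k) t) (fun _ => 1) (fun t k => mlj_le1 r01 (lp k)).
by exists u, w, J.
Qed.

Variables (u w J : R -> H).
Hypotheses (hu : forall t, 0 < t -> mult (fun k => mlf rho (lam k) t) phi (u t))
  (hw : forall t, 0 < t -> mult (fun k => lam k * mlf rho (lam k) t) phi (w t))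
  (hJ : forall t, 0 < t -> mult (fun k => mlj rho (lam k) t) phi (J t)).

Let Au t : 0 < t -> D (u t) /\ A (u t) = w t.
Proof. by move=> t0; apply: (A_mult hdot hA hv (hu t0)); exact: hw. Qed.

Let cw t : 0 < t -> {for t, continuous w}.
Proof.
apply: (mult_lip_continuous Klip_ge0 hw) => a b k a0 b0; exact: lmlf_lip.
Qed.

Let cu t : 0 < t -> {for t, continuous u}.
Proof.
have K0 : 0 <= Klip / lam 0%N by rewrite divr_ge0 ?(ltW (lp 0%N)).
by apply: (mult_lip_continuous K0 hu) => a b k a0 b0; exact: mlf_lip0.
Qed.

(** By the mean value theorem each coefficient of the error of the difference quotient is a
    difference of two values of [lam k * mlf], which is Lipschitz in time uniformly in [k]. The
    limit therefore holds in norm. *)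
Let J_derivative : is_derivative_on T J (fun t => - w t).
Proof.
move=> t /andP[t0 tT]; apply/cvg_rnorm.
pose c (r : R) k := (r - t)^-1 * (mlj rho (lam k) r - mlj rho (lam k) t) - (- 1) * (lam k * mlf rho (lam k) t).
have t20 : 0 < t / 2 by rewrite divr_gt0.
have mc r : 0 < r -> mult (c r) phi (rscale (r - t)^-1 (J r - J t) - - w t).
  move=> r0'; apply: mult_sub; first exact: mult_scale (mult_sub (hJ r0') (hJ t0)).
  by rewrite -[w t]rscale1 -rscaleN; apply: mult_scale; exact: hw.
have bc r k : t / 2 < r -> r != t -> `|c r k| <= Klip / (t / 2) ^+ 2 * `|r - t|.
  move=> tr rt; have r0' : 0 < r by apply: lt_trans tr.
  have [x [hx ex]] : exists x, `|x - t| <= `|r - t| /\ t / 2 < x /\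
      mlj rho (lam k) r - mlj rho (lam k) t = - lam k * mlf rho (lam k) x * (r - t).
    have dj (y : R) : 0 < y -> is_derive y 1 (mlj rho (lam k)) (- lam k * mlf rho (lam k) y).
      by move=> y0; exact: mlj_derive.
    have [h|h] := ltP r t.
      have [y /andP[ry _]|x [/andP[rx xt] e]] := @mvt R (mlj rho (lam k)) (fun y : R => - lam k * mlf rho (lam k) y) _ _ h.
        by apply: dj; exact: lt_le_trans ry.
      exists x; split; last split.
      - by rewrite !ltr0_norm ?subr_lt0// lerN2 lerB// ltW.
      - exact: lt_trans rx.
      - by rewrite -opprB e -mulrN opprB.
    have {}h : t < r by rewrite lt_neqAle eq_sym rt.
    have [y /andP[ty _]|x [/andP[tx xr] e]] := @mvt R (mlj rho (lam k)) (fun y : R => - lam k * mlf rho (lam k) y) _ _ h.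
      by apply: dj; exact: lt_le_trans ty.
    exists x; split; last split => //.
    - by rewrite !gtr0_norm ?subr_gt0// lerB// ltW.
    - by apply: lt_trans tx; rewrite ltr_pdivrMr// ltr_pMr// ltr1n.
  have rt0 : r - t != 0 by rewrite subr_eq0.
  have [xt2 e] := ex.
  have -> : c r k = - (lam k * mlf rho (lam k) x - lam k * mlf rho (lam k) t).
    by rewrite /c e; field.
  have x0 : 0 < x by apply: lt_trans xt2.
  rewrite normrN (le_trans (lmlf_lip k x0 t0))// -mulrA ler_wpM2l// mulrC.
  have m0 : t / 2 <= Num.min x t.
    by rewrite le_min (ltW xt2) ler_pdivrMr// ler_pMr// ler1n.
  apply: ler_pM => //; first by rewrite invr_ge0 sqr_ge0.
  rewrite lef_pV2 ?posrE ?exprn_gt0//; last by apply: lt_le_trans m0.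
  by rewrite lerXn2r ?nnegrE ?(ltW t20)// (le_trans (ltW t20)).
pose B : R := Klip / (t / 2) ^+ 2 * rnorm phi.
have gB : B * `|r - t| @[r --> within `]0, T] t^'] --> 0.
  suff : B * `|r - t| @[r --> within `]0, T] t^'] --> B * `|t - t| by rewrite subrr normr0 mulr0.
  apply: cvg_within_dnbhs; apply: cvgM; first exact: cvg_cst.
  apply: cvg_norm; apply: cvgB; first exact: cvg_id.
  exact: cvg_cst.
apply: (@squeeze_cvgr _ _ _ _ (cst 0) _ _ _ _ _ gB); last exact: cvg_cst.
have nt : \forall r \near within `]0, T] t^', t / 2 < r /\ r != t.
  have t2t : t / 2 < t by rewrite ltr_pdivrMr// ltr_pMr// ltr1n.
  change (nbhs t (fun r => r != t -> (`]0, T]%classic : set R) r -> t / 2 < r /\ r != t)).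
  by apply: filterS (lt_nbhsr t2t) => r tr rt _.
apply: filterS nt => r [tr rt]; rewrite rnorm_ge0/=.
have r0' : 0 < r by apply: lt_trans tr.
apply: (le_trans (mult_bound hdot hv (fun k => bc r k tr rt) (mc r r0'))).
by rewrite /B mulrAC.
Qed.

Let J_initial : J t @[t --> 0^'+] --> phi.
Proof.
apply/cvg_rnorm.
apply: (@mult_cvg0 _ _ _ (fun t k => mlj rho (lam k) t - 1) 2 (fun t => J t - phi) phi).
  near=> t; have t0 : 0 < t by [].
  split; first exact: mult_sub (hJ t0) (mult1 dot v phi).
  move=> k; rewrite (le_trans (ler_normB _ _))// normr1.
  by have := mlj_le1 r01 (lp k) t0; lra.
move=> k; rewrite -[X in _ --> X](subrr (1 : R)); apply: cvgB; last exact: cvg_cst.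
exact: mlj_cvg0.
Unshelve. all: by end_near. Qed.

Let u_growth : exists2 C, 0 <= C & forall x, 0 < x -> `|rnorm (u x)| <= C * x `^ (rho / 2 - 1).
Proof.
have [C C0 hC] := mlf_power_bound r01.
exists (C / Num.sqrt (lam 0%N) * rnorm phi).
  by rewrite mulr_ge0 ?rnorm_ge0// divr_ge0 ?sqrtr_ge0.
move=> x x0; rewrite ger0_norm ?rnorm_ge0// mulrAC.
apply: (mult_bound hdot hv _ (hu x0)) => k.
apply: (le_trans (hC _ _ (lp k) x0)); rewrite ler_wpM2r ?powR_ge0// ler_wpM2l//.
rewrite lef_pV2 ?posrE ?sqrtr_gt0 ?lp// ler_wsqrtr//; exact: (lam_ge0 hv).
Qed.

(** The Bochner integral exists by continuity and the growth bound. Its components are computed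
    weakly and agree with those of [J t] by the scalar identity [conv_mlf]. *)
Let J_fractional t : rho < 1 -> 0 < t -> is_fractional_integral (rho - 1) u t (J t).
Proof.
move=> r1 t0; have [C C0 hC] := u_growth.
have q01 : 0 < rho / 2 <= 1 by have a := r0; apply/andP; split; lra.
have p01 : 0 <= rho < 1 by rewrite (ltW r0).
pose f x := rscale (((t - x) `^ (rho - 1 + 1))^-1) (u x).
have fE x : f x = rscale ((t - x) `^ (- rho)) (u x) by rewrite /f subrK powRN.
have cf x : 0 < x < t -> {for x, continuous f}.
  move=> /andP[x0 xt]; rewrite (_ : f = (fun x => rscale ((t - x) `^ (- rho)) (u x))); last exact/funext.
  apply: rscale_continuous; last exact: cu.
  have d0 : 0 < t - x by rewrite subr_gt0.
  have dp := @der_comp R (fun y : R => y `^ (- rho)) (fun x : R => t - x) x _ _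
    (powR_derive (- rho) d0) (derB (der_cst t x) (der_id x)).
  exact: (is_derive_continuous dp).
have cn x : 0 < x -> {for x, continuous (fun x => rnorm (u x))}.
  by move=> x0; apply: cvg_rnorm_cvg; exact: cu.
have fi : integ `]0, t[ (fun x => rnorm (f x)).
  apply: integ_ext (conv_integ cn hC q01 p01 t) => // x _.
  by rewrite fE rnormZ ger0_norm ?powR_ge0.
have [z hz] := bochner_exists hdot t0 cf fi.
have G0 : 0 < Gamma (1 - rho) by apply: Gamma_gt0; rewrite subr_gt0 r1 gerBl ltW.
exists z; first exact: hz.
have mz : mult (fun k => Gamma (1 - rho) * mlj rho (lam k) t) phi z.
  move=> k.
  have e : forall y : H, rip z (prj k y) = Gamma (1 - rho) * mlj rho (lam k) t * rip (prj k phi) y.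
    move=> y.
    have E x : 0 < x -> rip (f x) (prj k y) = rip (prj k phi) y * ((t - x) `^ (- rho) * mlf rho (lam k) x).
      by move=> x0; rewrite fE ripZl -rip_prj (hu x0) ripZl; ring.
    have mf : measurable_fun `]0, t[ (fun x => rip (f x) (prj k y)).
      apply: open_continuous_measurable_fun; first exact: interval_open.
      move=> x; rewrite inE /= in_itv/= => x0t.
      by apply: cvg_rip => //; exact: cf.
    have [_ <-] := bochner_weak hdot (measurable_itv _) hz mf.
    rewrite -conv_mlf// mulrC -RintZ//; last exact: conv_mlf_integ.
    by apply: eq_Rint => x /itv0P[x0 _]; exact: E.
  apply/eqP; rewrite -subr_eq0; apply/eqP; apply: rnorm0_eq0; apply/eqP.
  rewrite -sqrf_eq0 -(rip_norm hdot); set y := _ - _.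
  rewrite {1}/y ripBl rip_prj e ripZl subrr//.
have := mult_scale (Gamma (1 - rho))^-1 mz => h.
apply: (mult_uniq hdot hv (hJ t0)); rewrite opprB.
apply: mult_ext h => k; rewrite mulrA mulVf ?mul1r//; exact: lt0r_neq0.
Qed.

Lemma solution_exists : exists u', forward_solution D A T rho phi u' /\
  forall t, 0 < t -> mult (fun k => mlf rho (lam k) t) phi (u' t).
Proof.
(* The multiplier says nothing at time 0, while order 1 prescribes the value there. *)
pose u' t := if t == 0 then phi else u t.
have u'E t : 0 < t -> u' t = u t by move=> t0; rewrite /u' gt_eqF.
exists u'; split; last by move=> t t0; rewrite u'E//; exact: hu.
have low : is_lowered T rho u' J.
  move=> t /andP[t0 tT]; case: eqP => [r1|/eqP r1].
    rewrite u'E//; apply: (mult_uniq hdot hv _ (hu t0)).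
    by apply: mult_ext (hJ t0) => k; rewrite r1 mlj1.
  have r1' : rho < 1 by rewrite lt_neqAle r1; have /andP[] := r01.
  have [z [g [g1 g2 g3 g4]] e] := J_fractional r1' t0; exists z => //; exists g.
  have E n x : (`]0, t[%classic : set R) x ->
      rnorm (rscale (((t - x) `^ (rho - 1 + 1))^-1) (u x) - simple_eval (g n) x) =
      rnorm (rscale (((t - x) `^ (rho - 1 + 1))^-1) (u' x) - simple_eval (g n) x).
    by move=> /itv0P[x0 _]; rewrite u'E.
  split => //.
    by move=> n; apply: eq_measurable_fun (g2 n) => x; rewrite inE; exact: E.
  rewrite (_ : (fun n => _) = (fun n => (\int[mu]_(x in `]0%R, t[)
    (rnorm (rscale (((t - x) `^ (rho - 1 + 1))^-1) (u x) - simple_eval (g n) x)%R)%:E)%E))//.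
  apply/funext => n; apply: eq_integral => x; rewrite inE => xI.
  by rewrite E.
split; last first.
  by split; [exists J; [exact: low|exact: J_initial]|move=> _; rewrite /u' eqxx].
exists (fun t => - w t); first by exists J; [exact: low|exact: J_derivative].
have cAu t : 0 < t -> {for t, continuous (fun t => A (u' t))}.
  move=> t0; apply: (cont_near_eq _ (cw t0)).
  apply: filterS (lt_nbhsr t0) => x x0.
  by rewrite u'E// (Au x0).2.
split.
- apply: continuous_in_subspaceT => t; rewrite inE /= in_itv/= => /andP[t0 _].
  by apply: cvgN; exact: cw.
- by move=> t /andP[t0 _]; rewrite u'E//; exact: (Au t0).1.
- apply: continuous_in_subspaceT => t; rewrite inE /= in_itv/= => /andP[t0 _].
  exact: cAu.
- by move=> t /andP[t0 _]; rewrite u'E// (Au t0).2 addNr.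
Qed.

End solution.
End existence.

(** * Uniqueness for the forward problem *)

Section uniqueness.
Context {R : realType} {s : scalar_kind} {H : completeNormedModType (scalars R s)}.
Variable (dot : {dot H for @conjugate R s}).
Hypothesis hdot : scalar_product_of_norm dot.
Variables (D : set H) (A : H -> H) (v : nat -> H) (lam : nat -> R).
Hypothesis (hA : selfadjoint dot D A) (hv : eigensystem dot D A v lam).
Implicit Types (a b t x r rho T : R) (y z phi : H).
Notation mu := (@lebesgue_measure R).
Notation rip := (rip dot).
Notation prj := (prj dot v).
Notation mult := (mult dot v).

Lemma is_derive_quotient (f : R -> R) t l :
  (forall e, 0 < e -> exists2 d, 0 < d & forall r, r != t -> `|t - r| < d ->
    `|l - (r - t)^-1 * (f r - f t)| < e) -> is_derive t 1 f l.
Proof.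
move=> h.
have c : (fun h => h^-1 *: ((f \o shift t) (h *: 1) - f t)) @ 0^' --> l.
  apply/cvgrPdist_lt => e e0; have [d d0 hd] := h _ e0.
  exists d => //= h'; rewrite /ball_/= sub0r normrN => h'd h'0.
  have := hd (h' + t); rewrite addrK -[X in X != _]subr0 eq_sym -subr_eq0.
  rewrite /GRing.scale/= mulr1; apply.
    by rewrite subr0 opprD addrCA subrr addr0 oppr_eq0.
  by rewrite opprD addrCA subrr addr0 normrN.
apply: DeriveDef; first by apply/cvg_ex; exists l.
by rewrite /derive; exact: cvg_lim c.
Qed.

Lemma rip_continuous_on T (F : R -> H) y : {within `]0, T], continuous F} ->
  {within `]0, T], continuous (fun t => rip (F t) y)}.
Proof. by move=> cF t; apply: cvg_rip => //; exact: cF. Qed.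

Lemma within_interior (f : R -> R) T t : {within `]0, T], continuous f} -> 0 < t < T ->
  {for t, continuous f}.
Proof.
move=> cf tT; have oI : open (`]0, T[%classic : set R) by exact: interval_open.
have : {within `]0, T[, continuous f}.
  by apply: continuous_subspaceW cf => x; rewrite /= !in_itv/= => /andP[-> /ltW].
by rewrite continuous_open_subspace// => h; apply: h; rewrite inE /= in_itv.
Qed.

Lemma within_left (f : R -> R) T : 0 < T -> {within `]0, T], continuous f} ->
  f x @[x --> T^'-] --> f T.
Proof.
move=> T0 cf; have T2 : T / 2 < T by rewrite ltr_pdivrMr// ltr_pMr// ltr1n.
have : {within `[T / 2, T], continuous f}.
  apply: continuous_subspaceW cf => x; rewrite /= !in_itv/= => /andP[h ->].
  by rewrite andbT; apply: lt_le_trans h; rewrite divr_gt0.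
by move/(continuous_within_itvP _ T2) => [].
Qed.

Section scalar_component.
Variables (rho T : R) (phi y : H) (k : nat).
Hypotheses (T0 : 0 < T).

(** What a solution leaves after pairing with the [k]-th component of a test vector. The equations
    are kept on the open interval, where derivatives are two-sided; the left limit restores the end
    point [T]. Letting [y] vary recovers the whole projection from real parts. *)
Record component (w j : R -> R) : Prop := Component {
  cmp_derive : forall t, 0 < t < T -> is_derive t 1 j (- lam k * w t);
  cmp_cont : forall t, 0 < t < T -> {for t, continuous w};
  cmp_left : w x @[x --> T^'-] --> w T;
  cmp_init : j x @[x --> 0^'+] --> rip phi (prj k y);
  cmp_low1 : rho = 1 -> forall t, 0 < t < T -> j t = w t;
  cmp_low : rho != 1 -> forall t, 0 < t < T ->
    integ `]0, t[ (fun x => (t - x) `^ (- rho) * w x) /\ conv rho w t = Gamma (1 - rho) * j t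
}.

(** Continuity of [u] is not part of a solution; for the component it follows from that of [A u],
    because [w] is [1 / lam k] times the component of [A u]. *)
Lemma solution_component u : 0 < rho <= 1 -> forward_solution D A T rho phi u ->
  exists j, component (fun t => rip (u t) (prj k y)) j.
Proof.
move=> /andP[r0 rle1] [[g [J1 low1 dJ1] [cg Du cA eq]] [[J2 low2 J2phi] _]].
pose w t := rip (u t) (prj k y).
have lk := lam_gt0 hv k.
have wE t : 0 < t <= T -> rip (A (u t)) (prj k y) = lam k * w t.
  by move=> tT; rewrite -rip_prj (prj_A hA hv)// ?ripZl ?rip_prj//; exact: Du.
have wE2 t : 0 < t <= T -> w t = (lam k)^-1 * rip (A (u t)) (prj k y).
  by move=> tT; rewrite wE// mulKf// gt_eqF.
have cw : {within `]0, T], continuous w}.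
  have cAk : {within `]0, T], continuous (fun t => rip (A (u t)) (prj k y))}.
    exact: rip_continuous_on.
  have c1 : {within `]0, T], continuous (fun t => (lam k)^-1 * rip (A (u t)) (prj k y))}.
    by move=> t; apply: cvgM; [exact: cvg_cst|exact: cAk].
  apply: subspace_eq_continuous c1 => t; rewrite inE /= in_itv/= => tT.
  by rewrite /from_subspace /= wE2.
have mw t : 0 < t <= T -> measurable_fun `]0, t[
    (fun x => rip (rscale (((t - x) `^ (rho - 1 + 1))^-1) (u x)) (prj k y)).
  move=> /andP[t0 tT].
  rewrite (_ : (fun x => _) = (fun x => (t - x) `^ (- rho) * w x)); last first.
    by apply/funext => x; rewrite ripZl subrK powRN.
  apply: open_continuous_measurable_fun; first exact: interval_open.
  move=> x; rewrite inE /= in_itv/= => /andP[x0 xt].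
  suff : {for x, continuous (fun x => (t - x) `^ (- rho) * w x)} by [].
  apply: continuousM.
    have d0 : 0 < t - x by rewrite subr_gt0.
    have dp := @der_comp R (fun y : R => y `^ (- rho)) (fun x : R => t - x) x _ _
      (powR_derive (- rho) d0) (derB (der_cst t x) (der_id x)).
    exact: (is_derive_continuous dp).
  by apply: (within_interior cw); rewrite x0 (lt_le_trans xt).
have lowE J : is_lowered T rho u J -> rho != 1 -> forall t, 0 < t <= T ->
    integ `]0, t[ (fun x => (t - x) `^ (- rho) * w x) /\
    rip (J t) (prj k y) = (Gamma (1 - rho))^-1 * conv rho w t.
  move=> low r1 t tT; have := low t tT; rewrite (negbTE r1) => -[z hz ->].
  have [h1 h2] := bochner_weak hdot (measurable_itv _) hz (mw t tT).
  have E x : rip (rscale (((t - x) `^ (rho - 1 + 1))^-1) (u x)) (prj k y) = (t - x) `^ (- rho) * w x.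
    by rewrite ripZl subrK powRN.
  split; first by apply: integ_ext h1 => // x _; exact: E.
  by rewrite ripZl opprB -h2; congr (_ * _); apply: eq_Rint => x _; exact: E.
(* The derivative and the initial condition each provide their own fractional integral; they are
   matched through the weak formula. *)
have JJ t : 0 < t <= T -> rip (J1 t) (prj k y) = rip (J2 t) (prj k y).
  move=> tT; have [r1|r1] := eqVneq rho 1.
    by have := low1 t tT; have := low2 t tT; rewrite r1 eqxx => -> ->.
  by rewrite (lowE _ low1 r1 t tT).2 (lowE _ low2 r1 t tT).2.
exists (fun t => rip (J1 t) (prj k y)); split.
- move=> t tT; have /andP[t0 tT'] := tT; have tT1 : 0 < t <= T by rewrite t0 ltW.
  have : rip (rscale (x - t)^-1 (J1 x - J1 t)) (prj k y) @[x --> within `]0, T] t^'] --> rip (g t) (prj k y).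
    by apply: cvg_rip => //; exact: dJ1.
  have -> : rip (g t) (prj k y) = - lam k * w t.
    have := eq t tT1 => /eqP; rewrite addr_eq0 => /eqP ->.
    by rewrite ripNl wE// mulNr.
  move=> /cvgrPdist_lt h; apply: is_derive_quotient => e e0; have := h _ e0.
  move=> h1; have {h h1} : nbhs t (fun r => r != t -> (`]0, T]%classic : set R) r ->
     `|- lam k * w t - rip (rscale (r - t)^-1 (J1 r - J1 t)) (prj k y)| < e) := h1.
  move=> h1; have h2 := filterI h1 (filterI (lt_nbhsr t0) (lt_nbhsl tT')).
  have [d /= d0 hd] := h2; exists d => // r rt rd.
  have [h3 [rp rT]] := hd r rd.
  have := h3 rt; rewrite /= in_itv/= rp (ltW rT) => /(_ isT).
  by rewrite ripZl ripBl.
- by move=> t; exact: within_interior.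
- exact: within_left.
- have h : rip (J2 x) (prj k y) @[x --> 0^'+] --> rip phi (prj k y) by apply: cvg_rip.
  apply: cvg_trans h; apply: near_eq_cvg; near=> t; rewrite JJ//.
  by apply/andP; split => //; near: t; exact: nbhs_right_le.
- move=> r1 t /andP[t0 tT]; have := low1 t; rewrite r1 eqxx t0 (ltW tT) => /(_ isT) ->.
  by [].
- move=> r1 t /andP[t0 tT]; have [|h1 ->] := lowE _ low1 r1 t; first by rewrite t0 ltW.
  split=> //; rewrite mulVKf// gt_eqF// Gamma_gt0// subr_gt0 lt_neqAle r1 rle1.
  by rewrite gerBl ltW.
Unshelve. all: by end_near. Qed.

(** The difference has initial value 0, so its fractional integral vanishes by the maximum
    principle; then [- lam k * w], its derivative, vanishes as well. *)
Lemma component_unique w1 j1 w2 j2 : 0 < rho <= 1 -> component w1 j1 -> component w2 j2 ->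
  forall t, 0 < t <= T -> w1 t = w2 t.
Proof.
move=> r01 c1 c2; have lk := lam_gt0 hv k.
pose w t := w1 t - w2 t; pose j t := j1 t - j2 t.
have dj t : 0 < t < T -> is_derive t 1 j (- lam k * w t).
  move=> tT; apply: der_eq (derB (cmp_derive c1 tT) (cmp_derive c2 tT)) _.
  by rewrite /w; ring.
have cw t : 0 < t < T -> {for t, continuous w}.
  by move=> tT; apply: continuousB; [exact: (cmp_cont c1)|exact: (cmp_cont c2)].
have j0 : j x @[x --> 0^'+] --> (0 : R).
  suff : j x @[x --> 0^'+] --> rip phi (prj k y) - rip phi (prj k y) by rewrite subrr.
  by apply: cvgB; [exact: (cmp_init c1)|exact: (cmp_init c2)].
have jz t : 0 < t < T -> j t = 0.
  have [r1|r1] := eqVneq rho 1.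
    (* Order 1: the integrating factor [e^(lam t)] turns the equation into a zero derivative. *)
    move=> tT; have ew x : 0 < x < T -> is_derive x 1 (fun x => expR (- (- lam k * x)) * j x) 0.
      move=> xT; apply: der_eq (derM (der_expN (- lam k) x) (dj x xT)) _.
      by rewrite /j /w !(cmp_low1 c1)// !(cmp_low1 c2)//; ring.
    have : expR (- (- lam k * t)) * j t = 0.
      apply: (derive0_const ew) => //.
      suff : expR (- (- lam k * x)) * j x @[x --> 0^'+] --> expR (- (- lam k * 0)) * 0 by rewrite mulr0.
      apply: cvgM => //; apply: cvg_at_right_filter; exact: cont_expN.
    by move/eqP; rewrite mulf_eq0 gt_eqF ?expR_gt0//= => /eqP.
  have rl : 0 < rho < 1 by have /andP[-> h] := r01; rewrite lt_neqAle r1.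
  move=> tT; apply/normr0_eq0/eqP; rewrite eq_le normr_ge0 andbT -(@normr0 R R).
  apply: (caputo_unique (G := Gamma (1 - rho)) (w := w) (J := j) rl lk _ dj cw _ _ j0 tT).
  - by apply: Gamma_gt0; have /andP[a b] := rl; rewrite subr_gt0 b gerBl ltW.
  - move=> x xT; have i1 := (cmp_low c1 r1 xT).1; have i2 := (cmp_low c2 r1 xT).1.
    by apply: integ_ext (integB _ i1 i2) => // z _; rewrite -mulrBr.
  - move=> x xT; have [i1 e1] := cmp_low c1 r1 xT; have [i2 e2] := cmp_low c2 r1 xT.
    rewrite /j mulrBr -e1 -e2 /conv -(RintegralB (mR (measurable_itv _)) i1 i2).
    by apply: eq_Rint => z _; rewrite -mulrBr.
have wz t : 0 < t < T -> w t = 0.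
  move=> tT; have d0 : is_derive t 1 j 0.
    apply: (near_eq_is_derive _ (der_cst 0 t)); have /andP[t0 tT'] := tT.
    by apply: filterS2 (lt_nbhsr t0) (lt_nbhsl tT') => x x0 xT; rewrite jz// x0.
  have := @derive_val _ _ _ _ _ _ _ (dj t tT).
  rewrite (@derive_val _ _ _ _ _ _ _ d0).
  by move/esym/eqP; rewrite mulf_eq0 oppr_eq0 gt_eqF//= => /eqP.
(* At [t = T] equality is inherited from the left limits. *)
move=> t /andP[t0]; rewrite le_eqVlt => /predU1P[->|tT]; last first.
  by apply/eqP; rewrite -subr_eq0 -/(w t) wz// t0.
apply: (@cvg_unique _ _ (w1 x @[x --> T^'-])) => //; first exact: (cmp_left c1).
apply: cvg_trans (cmp_left c2); apply: near_eq_cvg; near=> x.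
apply/eqP; rewrite eq_sym -subr_eq0 -/(w x) wz//; apply/andP; split; last by [].
by near: x; exact: nbhs_left_gt.
Unshelve. all: by end_near. Qed.

End scalar_component.

Lemma forward_unique rho T phi u u' : 0 < rho <= 1 ->
  forward_solution D A T rho phi u -> forward_solution D A T rho phi u' ->
  forall t, 0 < t <= T -> u t = u' t.
Proof.
move=> r01 su su' t tT; have T0 : 0 < T by have /andP[h] := tT; exact: lt_le_trans.
apply: (prj_inj hdot hv) => k; apply: (prj_eq hdot) => y.
have [j c] := solution_component y k T0 r01 su; have [j' c'] := solution_component y k T0 r01 su'.
rewrite !rip_prj; exact: (component_unique T0 r01 c c' tT).
Qed.

End uniqueness.

Lemma lipschitz_within (R : realType) (f : R -> R) (a b C : R) : 0 <= C ->
  (forall x y, a <= x <= b -> a <= y <= b -> `|f x - f y| <= C * `|x - y|) ->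
  {within `[a, b], continuous f}.
Proof.
move=> C0 h; apply/subspace_continuousP => x; rewrite /= in_itv/= => xab.
apply/cvgrPdist_lt => e e0; have C1 : 0 < C + 1 by rewrite ltr_wpDl.
change (nbhs x (fun y => (`[a, b]%classic : set R) y -> `|f x - f y| < e)).
exists (e / (C + 1)); first exact: divr_gt0.
move=> y; rewrite /ball_/= ltr_pdivlMr// in_itv/= => hy yab.
rewrite (le_lt_trans (h x y xab yab))//; apply: le_lt_trans hy.
by rewrite mulrC ler_wpM2l// lerDl.
Qed.

(** * The inverse problem *)

Section inverse_problem.
Context {R : realType} {s : scalar_kind} {H : completeNormedModType (scalars R s)}.
Variable (dot : {dot H for @conjugate R s}).
Hypothesis hdot : scalar_product_of_norm dot.
Variables (D : set H) (A : H -> H) (v : nat -> H) (lam : nat -> R).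
Hypothesis (hA : selfadjoint dot D A) (hv : eigensystem dot D A v lam).
Notation mult := (mult dot v).
Notation prj := (prj dot v).

Lemma prj_neq0 (x : H) : x != 0 -> exists k, prj k x != 0.
Proof.
move=> x0; apply: contrapT => h; move/eqP: x0; apply.
apply: (prj_complete hdot hv) => k; apply/eqP/negPn/negP => pk.
by apply: h; exists k.
Qed.

(** All terms of the expansion decrease, and strictly at an index where [x] has a nonzero component;
    this is where a nonzero datum is essential. *)
Lemma mult_lt (c c' : nat -> R) (x z z' : H) : x != 0 ->
  (forall k, 0 <= c' k < c k) -> mult c x z -> mult c' x z' -> rnorm z' ^+ 2 < rnorm z ^+ 2.
Proof.
move=> x0 cc hz hz'; have [k0 pk] := prj_neq0 x0.
pose w k := (c k ^+ 2 - c' k ^+ 2) * rnorm (prj k x) ^+ 2.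
have cc2 k : c' k ^+ 2 < c k ^+ 2.
  by have /andP[h1 h2] := cc k; rewrite ltrXn2r// ?nnegrE// (le_trans h1)// ltW.
have w0 k : 0 <= w k by rewrite mulr_ge0 ?sqr_ge0// subr_ge0 ltW.
have wk : 0 < w k0.
  rewrite mulr_gt0 ?subr_gt0// exprn_gt0// lt_neqAle rnorm_ge0 andbT eq_sym.
  by apply: contra pk => /eqP/rnorm0_eq0 ->.
rewrite -subr_gt0; apply: (lt_le_trans wk); rewrite lerBrDr -lerBrDl.
apply: (rnorm_sqr_le hdot hv) => n.
have nd : nondecreasing_seq (fun n => energy dot v n z') by exact: energy_nd.
(* Lengthening the partial sum to include the index [k0] keeps the strict gain [w k0] in the
   limit. *)
apply: (@le_trans _ _ (energy dot v (maxn n k0.+1) z')); first by apply: nd; exact: leq_maxl.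
rewrite lerBrDl; apply: le_trans (bessel hdot hv (maxn n k0.+1) z).
rewrite !(energy_mult _ hz) !(energy_mult _ hz') -lerBrDr -sumrB.
have kn : (k0 < maxn n k0.+1)%N by exact: leq_maxr.
rewrite (bigD1 (Ordinal kn))//= -mulrBl -/(w k0) lerDl.
by apply: sumr_ge0 => i _; rewrite -mulrBl; exact: w0.
Qed.

Section fixed_datum.
Variables (rho0 T t0 : R) (phi : H).
Hypotheses (r01 : 0 < rho0 < 1) (t00 : 0 < t0) (tT : t0 <= T) (phi0 : phi != 0).
Hypothesis decr : forall l p q, lam 0%N <= l -> rho0 <= p -> p < q -> q <= 1 ->
  mlf q l t0 < mlf p l t0.

Let unit_range rho : rho0 <= rho <= 1 -> 0 < rho <= 1.
Proof. by have /andP[a _] := r01; move=> /andP[h ->]; rewrite (lt_le_trans a h). Qed.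

Let t0T : 0 < t0 <= T. Proof. by rewrite t00. Qed.

Let exsol rho : rho0 <= rho <= 1 -> exists u, forward_solution D A T rho phi u /\
  forall t, 0 < t -> mult (fun k => mlf rho (lam k) t) phi (u t).
Proof.
move=> /unit_range r; have [u [w [J [hu hw hJ]]]] := solution_coefs hdot hv phi r.
exact: (solution_exists hdot hA hv T r hu hw hJ).
Qed.

Lemma W_solution rho u : rho0 <= rho <= 1 -> forward_solution D A T rho phi u ->
  W D A T phi t0 rho = rnorm (u t0) ^+ 2.
Proof.
move=> r su; rewrite /W; set u' := get _.
have su' : forward_solution D A T rho phi u'.
  by apply: (getPex (P := [set u | forward_solution D A T rho phi u])); exists u.
by rewrite (forward_unique hdot hA hv (unit_range r) su su' t0T).
Qed.

Lemma W_mult rho : rho0 <= rho <= 1 -> exists2 z,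
  mult (fun k => mlf rho (lam k) t0) phi z & W D A T phi t0 rho = rnorm z ^+ 2.
Proof.
move=> r; have [u [su mu]] := exsol r; exists (u t0); first exact: mu.
exact: W_solution.
Qed.

(** Squares of coefficients are comparable because [mlf] is nonnegative on the range: it decreases
    to its value at order 1, an exponential. *)
Lemma W_decr p q : rho0 <= p -> p < q -> q <= 1 -> W D A T phi t0 q < W D A T phi t0 p.
Proof.
move=> rp pq q1.
have [|z hz ->] := @W_mult p; first by rewrite rp (le_trans (ltW pq)).
have [|z' hz' ->] := @W_mult q; first by rewrite q1 (le_trans rp (ltW pq)).
apply: (mult_lt phi0 _ hz hz') => k; have lk := lam_gt0 hv k; have l0 := lam_ge0 hv k.
rewrite decr// andbT; apply: (@le_trans _ _ (mlf 1 (lam k) t0)).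
  by rewrite mlf1// expR_ge0.
have := q1; rewrite le_eqVlt => /predU1P[->//|q1'].
by apply: ltW; apply: decr => //; exact: (le_trans rp (ltW pq)).
Qed.

(** The norm, that is the square root of [W], is Lipschitz in the order by the reverse triangle
    inequality; [W] is its square. *)
Lemma W_continuous : {within `[rho0, 1], continuous (W D A T phi t0)}.
Proof.
have [C C0 hC] := mlf_lip_order (es_pos hv) t00.
have lip : {within `[rho0, 1], continuous (fun rho => Num.sqrt (W D A T phi t0 rho))}.
  apply: (@lipschitz_within _ _ _ _ (C * rnorm phi)); first by rewrite mulr_ge0 ?rnorm_ge0.
  move=> p q rp rq; have [z hz ->] := W_mult rp; have [z' hz' ->] := W_mult rq.
  rewrite !sqrtr_sqr (ger0_norm (rnorm_ge0 z)) (ger0_norm (rnorm_ge0 z')).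
  have h : rnorm (z - z') <= C * `|p - q| * rnorm phi.
    apply: (mult_bound hdot hv _ (mult_sub hz hz')) => k.
    by apply: hC; [exact: (lam_ge0 hv)|exact: unit_range|exact: unit_range].
  rewrite [leRHS]mulrAC; apply: le_trans h.
  have h1 := rnormD (z - z') z'; have h2 := rnormD (z' - z) z.
  rewrite !subrK in h1 h2; rewrite (rnormB z') in h2.
  by rewrite ler_norml; apply/andP; split; lra.
have e : {in `[rho0, 1]%classic, (fun rho => Num.sqrt (W D A T phi t0 rho) * Num.sqrt (W D A T phi t0 rho)) =1 W D A T phi t0}.
  by move=> rho _; rewrite -expr2 sqr_sqrtr// /W sqr_ge0.
apply: subspace_eq_continuous e _ => rho.
by apply: cvgM; exact: lip.
Qed.

Lemma inverse_problem_solvable d0 :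
  inverse_uniquely_solvable D A T rho0 phi t0 d0 <->
  W D A T phi t0 1 <= d0 <= W D A T phi t0 rho0.
Proof.
have /andP[a0 a1] := r01.
have Wle p q : rho0 <= p -> p <= q -> q <= 1 -> W D A T phi t0 q <= W D A T phi t0 p.
  move=> rp; rewrite le_eqVlt => /predU1P[->//|pq] q1; exact/ltW/W_decr.
split=> [[u [rho [[r su <-] _]]]|/andP[h1 h2]].
  rewrite -(W_solution r su); have /andP[ra rb] := r.
  by rewrite !Wle.
have [|rho rI We] := IVT (ltW a1) W_continuous (v := d0).
  have h : W D A T phi t0 1 <= W D A T phi t0 rho0 by exact: le_trans h2.
  by rewrite (min_r h) (max_l h) h1 h2.
move: rI; rewrite in_itv/= => r.
have [u [su _]] := exsol r; exists u, rho; split.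
  by split => //; rewrite -(W_solution r su).
move=> u' rho' [r' su' e'].
have We' : W D A T phi t0 rho' = d0 by rewrite (W_solution r' su').
have /andP[ra rb] := r; have /andP[ra' rb'] := r'.
have rr : rho' = rho.
  have [h|h|//] := ltgtP rho' rho.
    by have := W_decr ra' h rb; rewrite We We' ltxx.
  by have := W_decr ra h rb'; rewrite We We' ltxx.
split=> // t tt; rewrite rr in su'.
exact: (forward_unique hdot hA hv (unit_range r) su' su tt).
Qed.

End fixed_datum.
End inverse_problem.

Theorem theorem1p5 (R : realType) (rho0 lam1 : R)
    (hrho0 : 0 < rho0 < 1) (hlam1 : 0 < lam1) :
  exists T0 : R, 0 < T0 /\
    forall (s : scalar_kind) (H : completeNormedModType (scalars R s))
      (dot : {dot H for @conjugate R s})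
      (D : set H) (A : H -> H) (v : nat -> H) (lam : nat -> R),
      scalar_product_of_norm dot ->
      separable H ->
      selfadjoint dot D A ->
      positive_operator dot D A ->
      eigensystem dot D A v lam ->
      lam 0%N = lam1 ->
      forall (T : R) (phi : H) (t0 d0 : R),
        phi != 0 ->
        T0 <= t0 <= T ->
        (inverse_uniquely_solvable D A T rho0 phi t0 d0 <->
         W D A T phi t0 1 <= d0 <= W D A T phi t0 rho0).
Proof.
(* The threshold comes from the scalar statement alone, so it depends only on [rho0] and [lam1] and
   serves every space, operator and datum. *)
have [T0 [T01 hT0]] := mlf_decr hrho0 hlam1; exists T0.
split=> [|s H dot D A v lam hdot _ hA _ hv l0 T phi t0 d0 phi0 /andP[Tt tT]].
  exact: lt_le_trans T01.
have t00 : 0 < t0 by apply: lt_le_trans Tt; exact: lt_le_trans T01.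
apply: (inverse_problem_solvable hdot hA hv hrho0 t00 tT phi0).
by move=> l p q hl rp pq q1; apply: (hT0 t0 l p q Tt) => //; rewrite -l0.
Qed.
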